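(* Let $g$ be a Ricci-flat Beig–Schmidt metric with first-order data $(\sigma,k_{ab})$ satisfying $\square\sigma+3\sigma=0$, $(\square-3)k_{ab}=0$, $h^{(0)ab}k_{ab}=0$, $\mathcal D^bk_{ab}=0$. Then on the hypersurfaces $\rho=\text{const}$, as $\rho\to\infty$, $$\sqrt{-h}\,(K-\hat K)=\tfrac14\sqrt{-h^{(0)}}\,\bigl[3\sigma^2+\sigma_{ab}k^{ab}-\sigma_{ab}\sigma^{ab}\bigr]+\mathcal O(\rho^{-1}),$$ so that the on-shell Mann–Marolf action has no divergent terms and, in the limit $\rho\to\infty$, $$16\pi G\,S_{\text{on-shell}}=\frac12\int_{dS_3}d^3x\sqrt{-h^{(0)}}\,\bigl[3\sigma^2+\sigma_{ab}k^{ab}-\sigma_{ab}\sigma^{ab}\bigr].$$ Moreover, $S_{\text{on-shell}}=0$, where integrals over $dS_3$ of total divergences are taken to vanish (no boundary contributions from integrations by parts).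
   Context: $h^{(0)}_{ab}dx^adx^b=-d\tau^2+\cosh^2\tau(d\theta^2+\sin^2\theta\,d\phi^2)$ is the unit $dS_3$ metric with Levi-Civita connection $\mathcal D$; $\square=\mathcal D^a\mathcal D_a$, $\sigma_{ab}=\mathcal D_a\mathcal D_b\sigma$, and indices of $\sigma_{ab},k_{ab}$ are moved with $h^{(0)}$. Beig–Schmidt metric: $ds^2=(1+\sigma/\rho)^2d\rho^2+h_{ab}dx^adx^b$ as $\rho\to\infty$, with $h_{ab}=\rho^2\bigl(h^{(0)}_{ab}+\rho^{-1}h^{(1)}_{ab}+\rho^{-2}h^{(2)}_{ab}+\mathcal O(\rho^{-3})\bigr)$, where $\sigma$ and $h^{(n)}_{ab}$ are fields on $dS_3$, and $k_{ab}:=h^{(1)}_{ab}+2\sigma h^{(0)}_{ab}$. Asymptotic expansions may be differentiated term by term. Mann–Marolf action: $$S=\frac1{16\pi G}\int_{\mathcal M}\sqrt{-g}\,R+\frac1{8\pi G}\int_{\partial\mathcal M}\sqrt{-h}\,(K-\hat K),$$ where $\partial\mathcal M$ is a hypersurface $\rho=\text{const}$ (only this boundary is considered) with induced metric $h_{ab}$, $K_{ab}$ is its extrinsic curvature, $K=h^{ab}K_{ab}$, $\hat K=h^{ab}\hat K_{ab}$. The symmetric tensor $\hat K_{ab}$ is defined by $\mathcal R_{ab}=\hat K_{ab}\hat K-\hat K_a{}^c\hat K_{cb}$ (indices moved with $h_{ab}$), with $\mathcal R_{ab}$ the Ricci tensor of $h_{ab}$; one takes the asymptotic power-series solution $\hat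 K_{ab}=\rho h^{(0)}_{ab}+\mathcal O(\rho^0)$. ''On-shell'' means evaluated on Ricci-flat metrics, where the bulk term vanishes. *)

(* Defs.v *)
Set Warnings "-all".
From mathcomp Require Export all_boot all_order all_algebra.
From mathcomp Require Export all_classical all_reals all_analysis.
Export Order.TTheory GRing.Theory Num.Theory numFieldNormedType.Exports.

Set Implicit Arguments.
Unset Strict Implicit.
Unset Printing Implicit Defensive.

Local Open Scope classical_set_scope.
Local Open Scope ring_scope.

Section Calculus.
Context {R : realType} {n : nat}.
Implicit Types (f : 'rV[R]_n -> R) (U : set 'rV[R]_n) (s : seq 'I_n).

Definition pd (i : 'I_n) f (x : 'rV[R]_n) : R := 'D_(delta_mx 0 i) f x.

Definition pds s f : 'rV[R]_n -> R := foldr pd f s.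

Definition smooth_on U f : Prop :=
  forall s x, U x ->
    {for x, continuous (pds s f)} /\
    (forall i, derivable (pds s f) x (delta_mx 0 i)).

End Calculus.

(* Coordinate formulas for a pseudo-Riemannian metric g_{ab} on an open set of
   R^n.  Conventions: the unit sphere (and unit dS_3) has positive Ricci
   curvature, R_{ab} = (n - 1) g_{ab}.  A covariant tensor field of rank r is
   encoded as T : 'rV_n -> seq 'I_n -> R, where T x [:: a_1; ...; a_r] is the
   component T_{a_1 ... a_r}(x); values on lists of another length are
   irrelevant. *)
Section Geometry.
Context {R : realType} {n : nat}.
Implicit Types (g : 'rV[R]_n -> 'M[R]_n) (x : 'rV[R]_n).
Implicit Types (T : 'rV[R]_n -> seq 'I_n -> R).

(* Gamma^c_{ab} *)
Definition christoffel g x (c a b : 'I_n) : R :=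
  2^-1 * \sum_d invmx (g x) c d *
    (pd a (fun y => g y d b) x + pd b (fun y => g y d a) x
     - pd d (fun y => g y a b) x).

Definition ricci g x : 'M[R]_n :=
  \matrix_(a, b) \sum_c
    (pd c (fun y => christoffel g y c a b) x
     - pd b (fun y => christoffel g y c a c) x
     + \sum_d (christoffel g x c c d * christoffel g x d a b
               - christoffel g x c b d * christoffel g x d a c)).

(* the trace g^{ab} A_{ab} *)
Definition gtrace g x (A : 'M[R]_n) : R := \tr (invmx (g x) *m A).

(* the contraction A_{ab} B^{ab} *)
Definition gdot g x (A B : 'M[R]_n) : R :=
  \tr (A *m invmx (g x) *m B^T *m invmx (g x)).

Definition scalar_curvature g x : R := gtrace g x (ricci g x).

(* D_c T_{a_1 ... a_r}, the derivative index c coming first *)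
Definition cov g T x (s : seq 'I_n) : R :=
  if s is c :: s' then
    pd c (fun y => T y s') x
    - \sum_(i < size s') \sum_d
        christoffel g x d c (nth c s' i) * T x (set_nth c s' i d)
  else 0.

(* g^{cd} T_{cd a_1 ... a_r} *)
Definition contract g T x (s : seq 'I_n) : R :=
  \sum_c \sum_d invmx (g x) c d * T x [:: c, d & s].

Definition divergence g T := contract g (cov g T).

Definition dalembertian g T := contract g (cov g (cov g T)).

Definition tensor0 (f : 'rV[R]_n -> R) := fun x (_ : seq 'I_n) => f x.

Definition tensor2 (t : 'rV[R]_n -> 'M[R]_n) := fun x (s : seq 'I_n) =>
  if s is [:: a; b] then t x a b else 0.

Definition hessian g (f : 'rV[R]_n -> R) x : 'M[R]_n :=
  \matrix_(a, b) cov g (cov g (tensor0 f)) x [:: a; b].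

(* The covariant tensor fields built locally from g, f and t: differential
   polynomials in f and t formed with covariant derivatives, tensor products,
   index permutations and metric contractions, with constant coefficients. *)
Inductive local_tensor g (f : 'rV[R]_n -> R) (t : 'rV[R]_n -> 'M[R]_n) :
    nat -> ('rV[R]_n -> seq 'I_n -> R) -> Prop :=
| local_scalar : local_tensor g f t 0 (tensor0 f)
| local_sym2 : local_tensor g f t 2 (tensor2 t)
| local_metric : local_tensor g f t 2 (tensor2 g)
| local_scale r T (c : R) : local_tensor g f t r T ->
    local_tensor g f t r (fun x s => c * T x s)
| local_add r T1 T2 : local_tensor g f t r T1 -> local_tensor g f t r T2 ->
    local_tensor g f t r (fun x s => T1 x s + T2 x s)
| local_prod r1 r2 T1 T2 :
    local_tensor g f t r1 T1 -> local_tensor g f t r2 T2 ->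
    local_tensor g f t (r1 + r2)%N
      (fun x s => T1 x (take r1 s) * T2 x (drop r1 s))
| local_perm r T (p : r.-tuple 'I_r) : uniq p -> local_tensor g f t r T ->
    local_tensor g f t r
      (fun x s => T x (pmap (fun i : 'I_r => onth s i) p))
| local_contract r T : local_tensor g f t r.+2 T ->
    local_tensor g f t r (contract g T)
| local_cov r T : local_tensor g f t r T ->
    local_tensor g f t r.+1 (cov g T).

End Geometry.

Section DeSitter.
Context {R : realType}.
Implicit Types (x : 'rV[R]_3) (t : R).

Definition cosh t : R := (expR t + expR (- t)) / 2.
Definition sinh t : R := (expR t - expR (- t)) / 2.

(* coordinates (tau, theta, phi) on dS_3 *)
Definition tau x : R := x 0 (@Ordinal 3 0 isT).
Definition theta x : R := x 0 (@Ordinal 3 1 isT).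
Definition phi x : R := x 0 (@Ordinal 3 2 isT).

Definition chart x : Prop := 0 < theta x < pi.

Definition h0 x : 'M[R]_3 :=
  diag_mx (\row_(a < 3)
    [:: -1; cosh (tau x) ^+ 2; cosh (tau x) ^+ 2 * sin (theta x) ^+ 2]`_a).

(* The isometric embedding of dS_3 in Minkowski space R^{1,3} as the hyperboloid
   - Y_0^2 + Y_1^2 + Y_2^2 + Y_3^2 = 1.  The chart is singular at the poles
   theta = 0, pi and 2 pi-periodic in phi, so smooth fields on all of dS_3 are
   taken to be the pull-backs of smooth fields of the ambient R^4; dS_3 being a
   closed submanifold, every smooth field on it arises in this way. *)
Definition embed x : 'rV[R]_4 :=
  \row_(mu < 4)
    [:: sinh (tau x);
        cosh (tau x) * sin (theta x) * cos (phi x);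
        cosh (tau x) * sin (theta x) * sin (phi x);
        cosh (tau x) * cos (theta x)]`_mu.

Definition jac_embed x : 'M[R]_(3, 4) :=
  \matrix_(a, mu) pd a (fun y => embed y 0 mu) x.

Definition pullback2 x (F : 'M[R]_4) : 'M[R]_3 :=
  jac_embed x *m F *m (jac_embed x)^T.

Definition smooth_scalar (f : 'rV[R]_3 -> R) : Prop :=
  exists2 F : 'rV[R]_4 -> R, smooth_on setT F &
    forall x, chart x -> f x = F (embed x).

Definition smooth_tensor2 (t : 'rV[R]_3 -> 'M[R]_3) : Prop :=
  exists2 F : 'rV[R]_4 -> 'M[R]_4,
    (forall mu nu, smooth_on setT (fun y => F y mu nu)) &
    forall x, chart x -> t x = pullback2 x (F (embed x)).

(* integration of d tau d theta d phi over tau1 < tau < tau2; the null set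
   theta = 0, pi or phi = 0 is left out *)
Definition slab (tau1 tau2 : R) : set (R * R * R) :=
  `]tau1, tau2[ `*` `]0, pi[ `*` `]0, 2 * pi[.

Definition coord_point (u : R * R * R) : 'rV[R]_3 :=
  \row_(a < 3) [:: u.1.1; u.1.2; u.2]`_a.

Definition lebesgue3 :
    {measure set (measurableTypeR R * measurableTypeR R * measurableTypeR R)
       -> \bar R} :=
  ((@lebesgue_measure R \x @lebesgue_measure R) \x @lebesgue_measure R)%E.

Definition slab_int (tau1 tau2 : R) (f : 'rV[R]_3 -> R) : R :=
  \int[lebesgue3]_(u in slab tau1 tau2) f (coord_point u).

(* The integral of d^3x sqrt(-h0) f over dS_3 exists and equals I: the slab
   integrals converge to I when tau1 -> -oo and tau2 -> +oo independently. *)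
Definition dS_integral (f : 'rV[R]_3 -> R) (I : R) : Prop :=
  (fun u : R * R =>
     slab_int u.1 u.2 (fun x => Num.sqrt (- \det (h0 x)) * f x))
    @ filter_prod (ninfty_nbhs R) (pinfty_nbhs R) --> I.

(* Integrations by parts on dS_3 have no boundary contributions: the integral
   of D^a V_a vanishes for every current V built locally from sigma and k.
   Without the locality requirement the condition would be absurd, since every
   function on dS_3 is the divergence of some vector field. *)
Definition no_boundary_terms (sigma : 'rV[R]_3 -> R) (k : 'rV[R]_3 -> 'M[R]_3)
    : Prop :=
  forall V, local_tensor h0 sigma k 1 V ->
    dS_integral (fun x => divergence h0 V x [::]) 0.

Definition lagrangian (sigma : 'rV[R]_3 -> R) (k : 'rV[R]_3 -> 'M[R]_3) x : R :=
  3 * sigma x ^+ 2 + gdot h0 x (hessian h0 sigma x) (k x)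
  - gdot h0 x (hessian h0 sigma x) (hessian h0 sigma x).

End DeSitter.

(* Spacetime: points p : 'rV_(1 + d) with rho in slot 0. *)
Section Spacetime.
Context {R : realType}.

Definition radius d (p : 'rV[R]_(1 + d)) : R := lsubmx p 0 0.
Definition tail d (p : 'rV[R]_(1 + d)) : 'rV[R]_d := rsubmx p.
Definition pt d (rho : R) (x : 'rV[R]_d) : 'rV[R]_(1 + d) := row_mx rho%:M x.

(* F(rho, Y) = O(rho^m) as rho -> +oo, uniformly for Y in compact sets of R^4,
   differentiably to all orders: each d/drho improves the power by one, each
   d/dY preserves it. *)
Definition symbol (m : int) (F : 'rV[R]_(1 + 4) -> R) : Prop :=
  forall M : R, exists2 rho1 : R, 0 < rho1 &
    forall s : seq 'I_(1 + 4), exists C : R, forall p,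
      rho1 < radius p -> `|tail p| <= M ->
      (forall i, derivable (pds s F) p (delta_mx 0 i)) /\
      `|pds s F p| <= C * radius p ^ (m - (count_mem (lshift 4 ord0) s)%:Z).

(* the asymptotic region rho > r0(tau); the bound depends on tau because
   only local uniformity on dS_3 is meant in the expansions *)
Definition region (r0 : R -> R) (p : 'rV[R]_(1 + 3)) : Prop :=
  r0 (tau (tail p)) < radius p /\ chart (tail p).

(* rho-dependent tensors t_{ab} on dS_3 of order O(rho^m), where the expansion
   may be differentiated term by term *)
Definition tensor_O (r0 : R -> R) (m : int) (t : 'rV[R]_(1 + 3) -> 'M[R]_3)
    : Prop :=
  exists2 F : 'rV[R]_(1 + 4) -> 'M[R]_4,
    (forall mu nu, symbol m (fun q => F q mu nu)) &
    forall p, region r0 p ->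
      t p = pullback2 (tail p) (F (pt (radius p) (embed (tail p)))).

(* (1 + sigma/rho)^2 drho^2 + h_{ab} dx^a dx^b *)
Definition bs_metric (sigma : 'rV[R]_3 -> R) (h : 'rV[R]_(1 + 3) -> 'M[R]_3)
    (p : 'rV[R]_(1 + 3)) : 'M[R]_(1 + 3) :=
  block_mx ((1 + sigma (tail p) / radius p) ^+ 2)%:M 0 0 (h p).

Record beig_schmidt (r0 : R -> R) (sigma : 'rV[R]_3 -> R)
    (h1 h2 : 'rV[R]_3 -> 'M[R]_3) (h : 'rV[R]_(1 + 3) -> 'M[R]_3) : Prop := {
  bs_r0_gt0 : forall t, 0 < r0 t;
  bs_r0_cont : continuous r0;
  bs_sigma : smooth_scalar sigma;
  bs_h1 : smooth_tensor2 h1;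
  bs_h1_sym : forall x, chart x -> (h1 x)^T = h1 x;
  bs_h2 : smooth_tensor2 h2;
  bs_h2_sym : forall x, chart x -> (h2 x)^T = h2 x;
  bs_smooth : forall a b, smooth_on (region r0) (fun p => h p a b);
  bs_sym : forall p, region r0 p -> (h p)^T = h p;
  bs_nondegenerate : forall p, region r0 p -> bs_metric sigma h p \in unitmx;
  bs_expansion : tensor_O r0 (-3) (fun p =>
    radius p ^- 2 *: h p
    - (h0 (tail p) + (radius p)^-1 *: h1 (tail p)
       + radius p ^- 2 *: h2 (tail p)))
}.

Definition k_of (sigma : 'rV[R]_3 -> R) (h1 : 'rV[R]_3 -> 'M[R]_3)
    (x : 'rV[R]_3) : 'M[R]_3 := h1 x + (2 * sigma x) *: h0 x.

Definition ricci_flat (r0 : R -> R) (g : 'rV[R]_(1 + 3) -> 'M[R]_(1 + 3))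
    : Prop :=
  forall p, region r0 p -> ricci g p = 0.

Definition slice (h : 'rV[R]_(1 + 3) -> 'M[R]_3) (rho : R) (x : 'rV[R]_3) :=
  h (pt rho x).

(* n_mu, the unit conormal of rho = const pointing towards larger rho *)
Definition conormal (g : 'rV[R]_(1 + 3) -> 'M[R]_(1 + 3)) p (mu : 'I_(1 + 3))
    : R :=
  if mu == lshift 3 ord0
  then (Num.sqrt (invmx (g p) (lshift 3 ord0) (lshift 3 ord0)))^-1 else 0.

(* K_{ab} = nabla_a n_b along the hypersurface *)
Definition extrinsic (g : 'rV[R]_(1 + 3) -> 'M[R]_(1 + 3)) p : 'M[R]_3 :=
  \matrix_(a, b)
    (pd (rshift 1 a) (fun q => conormal g q (rshift 1 b)) p
     - \sum_l christoffel g p l (rshift 1 a) (rshift 1 b) * conormal g p l).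

(* Khat p is the solution of R_{ab} = Khat_{ab} Khat - Khat_a^c Khat_{cb} on the
   hypersurfaces with Khat_{ab} = rho h0_{ab} + O(rho^0). *)
Record is_Khat (r0 : R -> R) (h Khat : 'rV[R]_(1 + 3) -> 'M[R]_3) : Prop := {
  Khat_sym : forall p, region r0 p -> (Khat p)^T = Khat p;
  Khat_eq : forall rho x, region r0 (pt rho x) ->
    ricci (slice h rho) x =
      gtrace (slice h rho) x (Khat (pt rho x)) *: Khat (pt rho x)
      - Khat (pt rho x) *m invmx (h (pt rho x)) *m Khat (pt rho x);
  Khat_expansion :
    tensor_O r0 0 (fun p => Khat p - radius p *: h0 (tail p))
}.

(* sqrt(-h) (K - Khat) *)
Definition boundary_density (sigma : 'rV[R]_3 -> R)
    (h Khat : 'rV[R]_(1 + 3) -> 'M[R]_3) (rho : R) (x : 'rV[R]_3) : R :=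
  Num.sqrt (- \det (h (pt rho x))) *
  (gtrace (slice h rho) x (extrinsic (bs_metric sigma h) (pt rho x))
   - gtrace (slice h rho) x (Khat (pt rho x))).

(* sqrt(-g) R integrated over r0(tau) < rho' < rho at fixed x *)
Definition bulk_density (r0 : R -> R) (g : 'rV[R]_(1 + 3) -> 'M[R]_(1 + 3))
    (rho : R) (x : 'rV[R]_3) : R :=
  \int[@lebesgue_measure R]_(r in `]r0 (tau x), rho[)
    (Num.sqrt (- \det (g (pt r x))) * scalar_curvature g (pt r x)).

(* the Mann-Marolf action of the part tau1 < tau < tau2 of spacetime, with
   boundary at radius rho *)
Definition action (G : R) (r0 : R -> R) (sigma : 'rV[R]_3 -> R)
    (h Khat : 'rV[R]_(1 + 3) -> 'M[R]_3) (tau1 tau2 rho : R) : R :=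
  (16 * pi * G)^-1 *
    slab_int tau1 tau2 (bulk_density r0 (bs_metric sigma h) rho)
  + (8 * pi * G)^-1 * slab_int tau1 tau2 (boundary_density sigma h Khat rho).

(* S is the value of the action in the limit rho -> +oo, the slab then
   exhausting dS_3 *)
Definition action_value (G : R) (r0 : R -> R) (sigma : 'rV[R]_3 -> R)
    (h Khat : 'rV[R]_(1 + 3) -> 'M[R]_3) (S : R) : Prop :=
  exists2 A : R -> R -> R,
    (forall tau1 tau2, tau1 < tau2 ->
      action G r0 sigma h Khat tau1 tau2 rho @[rho --> +oo] --> A tau1 tau2) &
    (fun u : R * R => A u.1 u.2)
      @ filter_prod (ninfty_nbhs R) (pinfty_nbhs R) --> S.

End Spacetime.

(* Main.v *)
Require Import Defs.
From mathcomp Require Import ring lra.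

(* In the orthonormal frame of the embedding of dS_3 in R^{1,3} all expansions are
   uniform on the slabs [|tau| <= T], up to the poles of the angular coordinates.
   For the Ricci-flat metric N^2 drho^2 + h with N = 1 + sigma / rho, the Gauss and
   evolution equations are exact:
     tr Ric(h) = (tr K)^2 - tr K^2,
     Ric(h) = N^-1 d_rho K + (tr K) K - 2 K K + N^-1 D D N.
   Write rho h^-1 K = 1 + P and rho h^-1 Khat = 1 + E.  As Khat has the same trace
   identity, 4 (tr P - tr E) = (tr E)^2 - tr E^2 - (tr P)^2 + tr P^2 exactly, so that
   h2 drops out and the first orders
     P = - k / (2 rho) + ...,  E = (sigma + D D sigma - k / 2) / rho + ...
   give the finite density.  It is a total divergence: by box sigma = - 3 sigma,
   D^b k_ab = 0 and R_ab = 2 h0_ab,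
     3 sigma^2 + sigma_ab k^ab - sigma_ab sigma^ab
       = D^b (sigma^a k_ab - sigma^a sigma_ab - sigma sigma_b). *)

Set Implicit Arguments.
Unset Strict Implicit.
Unset Printing Implicit Defensive.

Local Open Scope classical_set_scope.
Local Open Scope ring_scope.

(** * Differential calculus on coordinate space *)

(** The obstacle is the chart: at the poles the Christoffel symbols of [h0] and the inverse of [h]
    blow up, so coordinate components have no bounds uniform in theta. Every field is a pull-back
    from R^{1,3}, and its components along the frame are bounded; only the Lamé factors degenerate,
    and they enter every tensor as one and the same conjugation, which drops out of traces. In the
    asymptotics only the Hessian of sigma involves Christoffel symbols of a slice, and
    [hessian_pullback] shows that their singular part cancels. The evolution equation avoids second
    tangential derivatives of [h]: it gives Ric(h) through d_rho h and d_rho^2 h, from which h2,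
    constant in rho, disappears. As sqrt(-h) grows like rho^3, tr P - tr E is needed at order
    rho^-2, one order beyond the expansions of P and E. The trace identity supplies it: 4 = 2 * 3 -
    2 is the linear coefficient of (tr X)^2 - tr X^2 at the identity in dimension three, and (tr
    P)^2, (tr E)^2 are O(rho^-4), because the first-order parts are traceless by tr k = 0 and box
    sigma = - 3 sigma. *)

Section PointwiseDerive.
Context {R : realType} {V : normedModType R}.
Implicit Types (f g : V -> R) (x v : V).

Lemma is_derive_funD f g x v df dg : is_derive x v f df -> is_derive x v g dg ->
  is_derive x v (fun y => f y + g y) (df + dg).
Proof. by move=> Hf Hg; exact: (is_deriveD (f := f) (g := g)). Qed.

Lemma is_derive_funB f g x v df dg : is_derive x v f df -> is_derive x v g dg ->
  is_derive x v (fun y => f y - g y) (df - dg).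
Proof. by move=> Hf Hg; exact: (is_deriveB (f := f) (g := g)). Qed.

Lemma is_derive_funN f x v df : is_derive x v f df ->
  is_derive x v (fun y => - f y) (- df).
Proof. by move=> Hf; exact: (is_deriveN (f := f)). Qed.

Lemma is_derive_funM f g x v df dg : is_derive x v f df -> is_derive x v g dg ->
  is_derive x v (fun y => f y * g y) (df * g x + f x * dg).
Proof.
move=> Hf Hg; have H := is_deriveM Hf Hg.
by apply: is_derive_eq H _; rewrite /GRing.scale /=; ring.
Qed.

Lemma is_derive_funZ (c : R) f x v df : is_derive x v f df ->
  is_derive x v (fun y => c * f y) (c * df).
Proof. by move=> Hf; exact: (is_deriveZ (f := f)). Qed.

Lemma is_derive_funX2 f x v df : is_derive x v f df ->
  is_derive x v (fun y => f y ^+ 2) (2 * f x * df).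
Proof.
move=> Hf; rewrite (_ : (fun y => _) = fun y => f y * f y); last first.
  by apply: funext => y; rewrite expr2.
by apply: is_derive_eq (is_derive_funM Hf Hf) _; ring.
Qed.

Lemma is_derive_funV f x v df : f x != 0 -> is_derive x v f df ->
  is_derive x v (fun y => (f y)^-1) (- (f x) ^- 2 * df).
Proof.
move=> fx Hf; have Df : derivable f x v by [].
have -> : - f x ^- 2 * df = 'D_v (fun y => (f y)^-1) x.
  by rewrite deriveV// derive_val.
by apply: derivableP; exact: derivableV.
Qed.

Lemma is_derive_cstfun (c : R) x v : is_derive x v (fun=> c) 0.
Proof. exact: is_derive_cst. Qed.

Lemma is_derive_funsum (I : Type) (r : seq I) (F : I -> V -> R) (dF : I -> R) x v :
  (forall i, is_derive x v (F i) (dF i)) ->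
  is_derive x v (fun y => \sum_(i <- r) F i y) (\sum_(i <- r) dF i).
Proof.
move=> HF; elim: r => [|i r IH].
  rewrite big_nil (_ : (fun y => _) = fun=> 0); first exact: is_derive_cstfun.
  by apply: funext => y; rewrite big_nil.
rewrite big_cons (_ : (fun y => _) = fun y => F i y + \sum_(j <- r) F j y).
  exact: is_derive_funD.
by apply: funext => y; rewrite big_cons.
Qed.

(** Differentiating along [v] means differentiating at 0 the restriction to the line through [x],
    where the one-variable chain rule applies. *)
Lemma is_derive_comp1 (phi : R -> R) f x v a b :
  is_derive (f x) 1 phi a -> is_derive x v f b ->
  is_derive x v (fun y => phi (f y)) (a * b).
Proof.
move=> Hphi Hf.
pose g (t : R) := f (t *: v + x).
have line (F : V -> R) l :
    is_derive x v F l <-> is_derive (0 : R) 1 (fun t => F (t *: v + x)) l.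
  have E : (fun h : R => h^-1 *: (F (h *: v + x) - F x)) =
      (fun h : R => h^-1 *: (F ((h *: (1 : R) + 0 : R) *: v + x) - F ((0 : R) *: v + x))).
    by apply: funext => h; rewrite addr0 scale0r add0r /GRing.scale /= mulr1.
  split=> -[D <-]; apply: DeriveDef; rewrite /derivable /derive;
    by [rewrite -E|rewrite E].
apply/line; have {Hf} Hg : is_derive (0 : R) 1 g b by apply/line.
apply: (@is_derive1_comp R phi g 0) => //.
by rewrite /g scale0r add0r.
Qed.

End PointwiseDerive.

Section Partial.
Context {R : realType} {n : nat}.
Implicit Types (f g : 'rV[R]_n -> R) (x : 'rV[R]_n) (U : set 'rV[R]_n).

Definition dirv (i : 'I_n) : 'rV[R]_n := delta_mx 0 i.

Lemma is_derive_pd i f x d : is_derive x (dirv i) f d -> pd i f x = d.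
Proof. by move=> H; rewrite /pd derive_val. Qed.

Lemma derivable_pd i f x : derivable f x (dirv i) ->
  is_derive x (dirv i) f (pd i f x).
Proof. exact: derivableP. Qed.

Lemma pd_near i f g x : (\near x, f x = g x) -> pd i f x = pd i g x.
Proof. exact: near_eq_derive. Qed.

Lemma is_derive_line (F : 'rV[R]_n -> R) (z : 'rV[R]_n) i (t l : R) :
  is_derive (z + t *: dirv i) (dirv i) F l <->
  is_derive t 1 (fun s => F (z + s *: dirv i)) l.
Proof.
have E : (fun h : R => h^-1 *: (F (h *: dirv i + (z + t *: dirv i)) - F (z + t *: dirv i))) =
    (fun h : R => h^-1 *: (F (z + (h *: (1 : R) + t : R) *: dirv i) - F (z + t *: dirv i))).
  apply: funext => h; rewrite [h *: 1]mulr1 scalerDl.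
  by rewrite [X in F X](_ : _ = z + (h *: dirv i + t *: dirv i))// addrCA.
split=> -[D <-]; apply: DeriveDef; rewrite /derivable /derive;
  by [rewrite -E|rewrite E].
Qed.

Lemma mvt_partial (F : 'rV[R]_n -> R) (z : 'rV[R]_n) i (t : R) :
  (forall c : R, 0 <= c <= 1 -> derivable F (z + (c * t) *: dirv i) (dirv i)) ->
  exists2 c : R, 0 <= c <= 1 &
    F (z + t *: dirv i) - F z = pd i F (z + (c * t) *: dirv i) * t.
Proof.
move=> DF.
pose g (c : R) := F (z + (c * t) *: dirv i).
have Hg (c : R) : 0 <= c <= 1 -> is_derive c 1 g (pd i F (z + (c * t) *: dirv i) * t).
  move=> /DF /derivable_pd/is_derive_line H.
  have Hm : is_derive c 1 (fun y : R => y * t) t.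
    by apply: is_derive_eq (is_derive_funM (is_derive_id c 1) (is_derive_cstfun t c 1)) _; ring.
  exact: (is_derive_comp1 (f := fun y : R => y * t) (x := c) H Hm).
have [c||c cI E] := @MVT_segment R g (fun c => pd i F (z + (c * t) *: dirv i) * t) 0 1 ler01.
- by rewrite in_itv /= => /andP[c0 c1]; apply: Hg; rewrite !ltW.
- apply: continuous_in_subspaceT => c; rewrite inE /= in_itv /= => cI.
  apply: differentiable_continuous; apply/derivable1_diffP.
  by have := Hg _ cI => -[].
exists c; first by move: cI; rewrite in_itv.
by move: E; rewrite /g mul1r mul0r scale0r addr0 subr0 mulr1.
Qed.

Lemma rV_norm_le (x : 'rV[R]_n) (e : R) : 0 <= e ->
  (forall j, `|x 0 j| <= e) -> `|x| <= e.
Proof.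
move=> e0 H; rewrite [`|x|]mx_normrE (bigmax_le _ e0)// => -[i j] _ /=.
by rewrite ord1.
Qed.

Lemma rV_coord_le (x : 'rV[R]_n) j : `|x 0 j| <= `|x|.
Proof. by rewrite [leRHS]mx_normrE; exact: (le_bigmax _ (fun ij => `|x ij.1 ij.2|) (0, j)). Qed.

(** [x] is changed into [y] one coordinate at a time, with one mean value theorem per change. In the
    sup norm all intermediate points stay within [|y - x|] of [x]. *)
Lemma mvt_telescope (F : 'rV[R]_n -> R) (x y : 'rV[R]_n) :
  (forall z i, `|z - x| <= `|y - x| -> derivable F z (dirv i)) ->
  exists2 xi : 'I_n -> 'rV[R]_n, forall i, `|xi i - x| <= `|y - x| &
    F y - F x = \sum_i pd i F (xi i) * (y 0 i - x 0 i).
Proof.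
move=> DF.
pose w (k : nat) : 'rV[R]_n := \row_j (if (j < k)%N then y 0 j else x 0 j).
have wS (i : 'I_n) : w i.+1 = w i + (y 0 i - x 0 i) *: dirv i.
  apply/rowP => j; rewrite !mxE eqxx /= ltnS leq_eqVlt -val_eqE /=.
  have [/val_inj ->|_] := eqVneq (val j) (val i); first by rewrite /= ltnn; ring.
  by rewrite /= mulr0 addr0.
have wc (i : 'I_n) (c : R) : 0 <= c <= 1 ->
    `|w i + (c * (y 0 i - x 0 i)) *: dirv i - x| <= `|y - x|.
  move=> /andP[c0 c1]; apply: rV_norm_le => // j.
  have := rV_coord_le (y - x) j; rewrite !mxE eqxx /= -val_eqE /=.
  have [/val_inj ->|_] := eqVneq (val j) (val i).
    rewrite ltnn mulr1 addrAC subrr add0r normrM ger0_norm// => /(le_trans _); apply.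
    by rewrite ler_piMl.
  by rewrite mulr0 addr0; case: ifP => // _ _; rewrite subrr normr0.
have step (i : 'I_n) : {c : R | 0 <= c <= 1 &
    F (w i.+1) - F (w i) = pd i F (w i + (c * (y 0 i - x 0 i)) *: dirv i) * (y 0 i - x 0 i)}.
  apply: cid2; have [|c c01 E] := @mvt_partial F (w i) i (y 0 i - x 0 i).
    by move=> c c01; apply: DF; exact: wc.
  by exists c => //; rewrite wS.
exists (fun i : 'I_n => w i + (s2val (step i) * (y 0 i - x 0 i)) *: dirv i).
  by move=> i; apply: wc; case: (step i).
rewrite (_ : F y - F x = \sum_(0 <= k < n) (F (w k.+1) - F (w k))).
  by rewrite big_mkord; apply: eq_bigr => i _; case: (step i).
rewrite telescope_sumr//; congr (F _ - F _); apply/rowP => j; rewrite mxE.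
  by rewrite ltn_ord.
by rewrite ltn0.
Qed.

(** The increments of [mvt_telescope] make [F] Lipschitz at [x]. Symbols come with partial
    derivatives and bounds for them only; their continuity is recovered in this way. *)
Lemma bounded_partials_continuous (F : 'rV[R]_n -> R) x (e C : R) : 0 < e ->
  (forall z i, `|z - x| <= e -> derivable F z (dirv i) /\ `|pd i F z| <= C) ->
  {for x, continuous F}.
Proof.
move=> e0 H; apply/(@cvgrPdist_le _ _ _ (nbhs x)) => d d0.
have C0 : 0 <= `|C| by [].
near=> y.
have yx : `|y - x| <= e by rewrite distrC; near: y; apply: cvgr_dist_le.
rewrite distrC; apply: le_trans (_ : `|C| * n%:R * `|y - x| <= _).
  have [|xi xiP ->] := @mvt_telescope F x y.
    by move=> z i zx; have [] := H z i (le_trans zx yx).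
  apply: le_trans (ler_norm_sum _ _ _) _.
  apply: le_trans (_ : \sum_(i < n) (`|C| * `|y - x|) <= _).
    apply: ler_sum => i _; rewrite normrM ler_pM//.
      by have [_ /le_trans] := H (xi i) i (le_trans (xiP i) yx); apply; exact: ler_norm.
    by have := rV_coord_le (y - x) i; rewrite !mxE.
  by rewrite sumr_const card_ord -[X in X <= _]mulr_natr mulrAC.
have K0 : 0 < `|C| * n%:R + 1 by rewrite ltr_wpDl// mulr_ge0.
apply: le_trans (_ : (`|C| * n%:R + 1) * `|y - x| <= _).
  by rewrite ler_wpM2r// lerDl.
rewrite mulrC -ler_pdivlMr// distrC; near: y; apply: cvgr_dist_le => //.
by rewrite divr_gt0.
Unshelve. all: by end_near. Qed.

End Partial.

(** * The chain rule from continuous partial derivatives *)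

Section ChainRule.
Context {R : realType}.

Lemma cvg_bigsum (I T : Type) (F : set_system T) (FF : Filter F) (r : seq I)
    (f : I -> T -> R) (l : I -> R) :
  (forall i, f i x @[x --> F] --> l i) ->
  \sum_(i <- r) f i x @[x --> F] --> \sum_(i <- r) l i.
Proof.
move=> H; elim: r => [|i r IH].
  rewrite big_nil (_ : (fun x => _) = fun=> 0); first exact: cvg_cst.
  by apply: funext => y; rewrite big_nil.
rewrite big_cons (_ : (fun x => _) = fun x => f i x + \sum_(j <- r) f j x).
  exact: cvgD.
by apply: funext => y; rewrite big_cons.
Qed.

(* [f] need only be derivable along [v]: the increments of [F] along the curve
   are evaluated by the mean value theorem. *)
Lemma is_derive_chain n (V : normedModType R) (F : 'rV[R]_n -> R)
    (f : V -> 'rV[R]_n) (df : 'I_n -> R) x v :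
  {for x, continuous f} ->
  (\forall z \near f x, forall i, derivable F z (dirv i)) ->
  (forall i, {for f x, continuous (pd i F)}) ->
  (forall i, is_derive x v (fun y => f y 0 i) (df i)) ->
  is_derive x v (fun y => F (f y)) (\sum_i pd i F (f x) * df i).
Proof.
move=> fc DF cF Hf.
have fline : f (h *: v + x) @[h --> (0 : R)^'] --> f x.
  apply: (@cvg_comp _ _ _ (fun h : R => h *: v + x) f _ (nbhs x)) => //.
  apply: cvg_within_filter.
  have H0 : (h *: v + x) @[h --> (0 : R)] --> (0 : R) *: v + x.
    by apply: cvgD; [apply: cvgZr_tmp; exact: cvg_id|exact: cvg_cst].
  by rewrite scale0r add0r in H0.
have main : h^-1 *: (F (f (h *: v + x)) - F (f x)) @[h --> (0 : R)^'] -->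
    \sum_i pd i F (f x) * df i.
  have [e /= e0 He] := (nbhs_ballP _ _).1 DF.
  have NE : \forall h \near (0 : R)^', `|f (h *: v + x) - f x| < e.
    by near=> h; rewrite distrC; near: h; apply: cvgr_dist_lt.
  have tele y : `|y - f x| < e -> exists2 xi : 'I_n -> 'rV[R]_n,
      forall i, `|xi i - f x| <= `|y - f x| &
      F y - F (f x) = \sum_i pd i F (xi i) * (y 0 i - f x 0 i).
    move=> ye; apply: mvt_telescope => z i zy; apply: He.
    by rewrite mx_norm_ball /ball_ /= distrC (le_lt_trans zy).
  (* Outside the ball [f x] is a filler that makes [xi] total; close to 0 only the first branch
     occurs. *)
  pose xi h i := if pselect (`|f (h *: v + x) - f x| < e) is left H
    then s2val (cid2 (tele _ H)) i else f x.
  have xic i : xi h i @[h --> (0 : R)^'] --> f x.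
    apply/cvgrPdist_le => d d0; near=> h; rewrite distrC /xi.
    case: pselect => [H|?]; last by rewrite subrr normr0 ltW.
    case: (cid2 _) => w /= wP _; apply: le_trans (wP i) _.
    by rewrite distrC; near: h; apply: cvgr_dist_le.
  have E : \forall h \near (0 : R)^', \sum_i pd i F (xi h i) *
      (h^-1 *: (f (h *: v + x) 0 i - f x 0 i)) =
      h^-1 *: (F (f (h *: v + x)) - F (f x)).
    near=> h; rewrite /xi; case: pselect => [H|[]]; last by near: h.
    case: (cid2 _) => w /= wP ->; rewrite scaler_sumr; apply: eq_bigr => i _.
    by rewrite /GRing.scale /= mulrCA.
  apply: cvg_trans (near_eq_cvg E) _.
  apply: cvg_bigsum => i; apply: cvgM.
    by apply: (@cvg_comp _ _ _ (fun h => xi h i) (pd i F) _ (nbhs (f x))); [exact: xic|exact: cF].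
  by have [D <-] := Hf i; exact: D.
apply: DeriveDef; first by apply/cvg_ex; eexists; exact: main.
exact/cvg_lim.
Unshelve. all: by end_near. Qed.

Lemma rV_continuous n (T : topologicalType) (f : T -> 'rV[R]_n) x :
  (forall i, {for x, continuous (fun y => f y 0 i)}) -> {for x, continuous f}.
Proof.
move=> H; apply/(@cvgrPdist_le _ _ _ (nbhs x)) => e e0.
have NE : \forall y \near x, forall i, `|f x 0 i - f y 0 i| <= e.
  apply: filter_forall => j.
  exact: (cvgr_dist_le _ _ (H j) _ e0).
apply: filterS NE => y NE; apply: rV_norm_le; first exact: ltW.
by move=> j; rewrite !mxE.
Qed.

End ChainRule.

(** * Symmetry of second partial derivatives *)

Section Schwarz.
Context {R : realType} {n : nat}.
Implicit Types (f : 'rV[R]_n -> R) (x : 'rV[R]_n) (i j : 'I_n).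

(* Both sides are limits of the same second difference quotient. *)
Let second_difference f x i j (e : R) (t : R) : 0 < t -> 2 * t <= e ->
  (forall z, `|z - x| <= e -> derivable f z (dirv i) /\ derivable (pd i f) z (dirv j)) ->
  exists2 z, `|z - x| <= 2 * t &
    f (x + t *: dirv j + t *: dirv i) - f (x + t *: dirv j)
    - (f (x + t *: dirv i) - f x) = pd j (pd i f) z * t * t.
Proof.
move=> t0 te H.
have nd k : `|dirv k : 'rV[R]_n| <= 1.
  by apply: rV_norm_le => // l; rewrite mxE eqxx /=; case: eqP => _; rewrite ?normr0 ?normr1.
have B (a b : R) : 0 <= a <= 1 -> 0 <= b <= 1 ->
    `|x + (a * t) *: dirv j + (b * t) *: dirv i - x| <= 2 * t.
  move=> /andP[a0 a1] /andP[b0 b1].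
  rewrite -[x + _ + _]addrA [x + _]addrC addrK; apply: le_trans (ler_normD _ _) _; rewrite !normrZ.
  have := nd j; have := nd i; rewrite ?(ger0_norm a0) ?(ger0_norm b0) (ger0_norm (ltW t0)).
  set u := `|dirv i|; set w := `|dirv j| => u1 w1.
  have u0 : 0 <= u := normr_ge0 _.
  have w0 : 0 <= w := normr_ge0 _.
  have : a * t * w <= t.
    by rewrite -mulrA mulrCA ler_piMr ?(ltW t0)// mulr_ile1.
  have : b * t * u <= t.
    by rewrite -mulrA mulrCA ler_piMr ?(ltW t0)// mulr_ile1.
  by lra.
pose G (z : 'rV[R]_n) := f (z + t *: dirv j) - f z.
have dG (z : 'rV[R]_n) : `|z + t *: dirv j - x| <= 2 * t -> `|z - x| <= 2 * t ->
    is_derive z (dirv i) G (pd i f (z + t *: dirv j) - pd i f z).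
  move=> z1 z2; apply: is_derive_funB.
    have /derivable_pd := (H _ (le_trans z1 te)).1.
    set l := pd _ _ _ => -[D E].
    have EE : (fun h : R => h^-1 *: (f (h *: dirv i + (z + t *: dirv j)) - f (z + t *: dirv j))) =
        (fun h : R => h^-1 *: (f ((h *: dirv i + z) + t *: dirv j) - f (z + t *: dirv j))).
      by apply: funext => h; rewrite addrA.
    by apply: DeriveDef; rewrite /derivable /derive -?EE.
  by apply: derivable_pd; have [] := H _ (le_trans z2 te).
have II : 0 <= (1 : R) <= 1 by rewrite ler01 lexx.
have dGc (c : R) : 0 <= c <= 1 -> is_derive (x + (c * t) *: dirv i) (dirv i) G
   (pd i f (x + (c * t) *: dirv i + t *: dirv j) - pd i f (x + (c * t) *: dirv i)).
  move=> c01; apply: dG.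
    by have := B 1 c II c01; rewrite mul1r (addrAC x).
  by have := B 0 c _ c01; rewrite mul0r scale0r addr0; apply; rewrite lexx ler01.
have [|c c01] := @mvt_partial _ _ G x i t.
  by move=> c c01; have [] := dGc c c01.
rewrite (is_derive_pd (dGc c c01)) => E.
have [|b b01] := @mvt_partial _ _ (pd i f) (x + (c * t) *: dirv i) j t.
  move=> b b01; apply: (H _ _).2.
  by rewrite (addrAC x); apply: le_trans te; exact: B.
move=> E2; exists (x + (c * t) *: dirv i + (b * t) *: dirv j).
  by rewrite (addrAC x); exact: B.
rewrite -E2 -E /G (addrAC x (t *: dirv i)); ring.
Qed.

Lemma pd_comm f x i j :
  (\forall z \near x, (forall k, derivable f z (dirv k)) /\
     forall k l, derivable (pd k f) z (dirv l)) ->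
  (forall k l, {for x, continuous (pd k (pd l f))}) ->
  pd i (pd j f) x = pd j (pd i f) x.
Proof.
have tlt (s : R) : 0 < s -> 2 * (s / 4) < s by lra.
have swap (a b c e p q : R) : a - b - (c - e) = p -> a - c - (b - e) = q -> p = q.
  by move=> <- <-; ring.
have fin (d : R) : 0 < d -> ~ d <= d / 4 + d / 4 by lra.
move=> /nbhs_ballP[e /= e0 He] C; apply/eqP; rewrite -subr_eq0; apply/negPn/negP => N.
have [d dE] : exists d : R, d = `|pd i (pd j f) x - pd j (pd i f) x| by eexists.
have d0 : 0 < d by rewrite dE normr_gt0.
have d4 : 0 < d / 4 by rewrite divr_gt0.
have [r1 /= r10 H1] := (nbhs_ballP _ _).1 (cvgr_dist_lt _ _ (C i j) _ d4).
have [r2 /= r20 H2] := (nbhs_ballP _ _).1 (cvgr_dist_lt _ _ (C j i) _ d4).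
have [r rE] : exists r : R, r = Num.min e (Num.min r1 r2) by eexists.
have r0 : 0 < r by rewrite rE !lt_min e0 r10 r20.
have [t t0 tr] : exists2 t : R, 0 < t & 2 * t < r.
  by exists (r / 4); [rewrite divr_gt0|exact: tlt].
have He' z : `|z - x| <= 2 * t -> ball x e z.
  move=> zx; rewrite mx_norm_ball /ball_ /= distrC (le_lt_trans zx)// (lt_le_trans tr)//.
  by rewrite rE ge_min lexx.
have [||z1 z1P E1] := @second_difference f x i j (2 * t) t t0.
- exact: lexx.
- by move=> z /He' /He[].
have [||z2 z2P E2] := @second_difference f x j i (2 * t) t t0.
- exact: lexx.
- by move=> z /He' /He[].
(* The second difference is symmetric in [i] and [j], so the two mixed derivatives agree, though at
   different points [z1] and [z2]. Both points are so close to [x] that each derivative is within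
   [d / 4] of its value there, which a gap [d > 0] excludes. *)
have E : pd j (pd i f) z1 = pd i (pd j f) z2.
  have : pd j (pd i f) z1 * t * t = pd i (pd j f) z2 * t * t.
    by apply: swap E1 _; rewrite (addrAC x); exact: E2.
  by move=> /mulIf /mulIf; apply; rewrite gt_eqF.
have := H2 z1; have := H1 z2; rewrite mx_norm_ball /ball_ /=.
have zr z k : r <= k -> `|z - x| <= 2 * t -> `|x - z| < k.
  move=> rk zx; rewrite distrC; exact: le_lt_trans zx (lt_le_trans tr rk).
have rr1 : r <= r1 by rewrite rE !ge_min lexx orbT.
have rr2 : r <= r2 by rewrite rE !ge_min lexx !orbT.
move=> /(_ (zr _ _ rr1 z2P)) A /(_ (zr _ _ rr2 z1P)) B.
apply: (fin _ d0).
rewrite {1}dE (_ : _ - _ = (pd i (pd j f) x - pd i (pd j f) z2)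
     - (pd j (pd i f) x - pd j (pd i f) z1)); last by rewrite E opprB addrA subrK.
exact: le_trans (ler_normB _ _) (lerD (ltW A) (ltW B)).
Qed.

End Schwarz.

Notation o0 := (@Ordinal 3 0 isT).
Notation o1 := (@Ordinal 3 1 isT).
Notation o2 := (@Ordinal 3 2 isT).

Lemma ord3P (P : 'I_3 -> Prop) : P o0 -> P o1 -> P o2 -> forall i, P i.
Proof.
move=> P0 P1 P2 [[|[|[|//]]] p].
- by rewrite (_ : Ordinal p = o0)//; exact: val_inj.
- by rewrite (_ : Ordinal p = o1)//; exact: val_inj.
- by rewrite (_ : Ordinal p = o2)//; exact: val_inj.
Qed.

Lemma ord4P (P : 'I_4 -> Prop) : P (@Ordinal 4 0 isT) -> P (@Ordinal 4 1 isT) ->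
  P (@Ordinal 4 2 isT) -> P (@Ordinal 4 3 isT) -> forall i, P i.
Proof.
move=> P0 P1 P2 P3 [[|[|[|[|//]]]] p].
- by rewrite (_ : Ordinal p = @Ordinal 4 0 isT)//; exact: val_inj.
- by rewrite (_ : Ordinal p = @Ordinal 4 1 isT)//; exact: val_inj.
- by rewrite (_ : Ordinal p = @Ordinal 4 2 isT)//; exact: val_inj.
- by rewrite (_ : Ordinal p = @Ordinal 4 3 isT)//; exact: val_inj.
Qed.

Lemma sum3E (V : nmodType) (F : 'I_3 -> V) : \sum_i F i = F o0 + F o1 + F o2.
Proof.
rewrite !big_ord_recr big_ord0 /= add0r.
by congr (_ + _ + _); congr F; exact: val_inj.
Qed.

Lemma sum4E (V : nmodType) (F : 'I_4 -> V) : \sum_i F i =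
  F (@Ordinal 4 0 isT) + F (@Ordinal 4 1 isT) + F (@Ordinal 4 2 isT)
  + F (@Ordinal 4 3 isT).
Proof.
rewrite !big_ord_recr big_ord0 /= add0r.
by congr (_ + _ + _ + _); congr F; exact: val_inj.
Qed.

(** * The embedding of dS_3 in R^{1,3} *)

Section Hyperbolic.
Context {R : realType}.
Implicit Types t : R.

Lemma is_derive_cosh t : is_derive t 1 (@cosh R) (sinh t).
Proof.
have Hn : is_derive t 1 (fun y : R => expR (- y)) (- expR (- t)).
  apply: is_derive_eq (is_derive_comp1 (is_derive_expR (- t)) (is_derive_funN (is_derive_id t 1))) _.
  by rewrite mulrN mulr1.
apply: is_derive_eq (is_derive_funM (is_derive_funD (is_derive_expR t) Hn)
  (is_derive_cstfun 2^-1 t 1)) _.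
by rewrite /sinh; ring.
Qed.

Lemma is_derive_sinh t : is_derive t 1 (@sinh R) (cosh t).
Proof.
have Hn : is_derive t 1 (fun y : R => expR (- y)) (- expR (- t)).
  apply: is_derive_eq (is_derive_comp1 (is_derive_expR (- t)) (is_derive_funN (is_derive_id t 1))) _.
  by rewrite mulrN mulr1.
apply: is_derive_eq (is_derive_funM (is_derive_funB (is_derive_expR t) Hn)
  (is_derive_cstfun 2^-1 t 1)) _.
by rewrite /cosh; ring.
Qed.

Lemma cosh_gt0 t : 0 < cosh t.
Proof. by rewrite /cosh divr_gt0// addr_gt0// expR_gt0. Qed.

Lemma cosh2E t : cosh t ^+ 2 = 1 + sinh t ^+ 2.
Proof.
have E : expR t * expR (- t) = 1 by rewrite -expRD subrr expR0.
by rewrite /cosh /sinh !exprMn sqrrD sqrrB E; field.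
Qed.

Lemma cosh_le t (T : R) : `|t| <= T -> cosh t <= expR T.
Proof.
move=> tT; have [t1 t2] : t <= T /\ - t <= T by split; move: tT; rewrite ler_norml; lra.
rewrite /cosh ler_pdivrMr//.
have e1 : expR t <= expR T by rewrite ler_expR.
have e2 : expR (- t) <= expR T by rewrite ler_expR.
by rewrite mulr_natr mulr2n lerD.
Qed.

Lemma sinh_le t (T : R) : `|t| <= T -> `|sinh t| <= expR T.
Proof.
move=> tT; have [t1 t2] : t <= T /\ - t <= T by split; move: tT; rewrite ler_norml; lra.
have e1 : expR t <= expR T by rewrite ler_expR.
have e2 : expR (- t) <= expR T by rewrite ler_expR.
have e3 := expR_gt0 t; have e4 := expR_gt0 (- t).
rewrite /sinh ler_norml; apply/andP; split.
  by rewrite ler_pdivlMr//; lra.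
by rewrite ler_pdivrMr//; lra.
Qed.

End Hyperbolic.

Section Chart.
Context {R : realType}.
Implicit Types (x : 'rV[R]_3).

Lemma is_derive_coord n (x : 'rV[R]_n) i j :
  is_derive x (dirv i) (fun y : 'rV[R]_n => y 0 j) (i == j)%:R.
Proof.
have -> : x = x + (0 : R) *: dirv i by rewrite scale0r addr0.
apply/is_derive_line.
rewrite (_ : (fun s => _) = fun s : R => x 0 j + s * (i == j)%:R); last first.
  by apply: funext => s; rewrite !mxE eqxx /= eq_sym.
apply: is_derive_eq (is_derive_funD (is_derive_cstfun (x 0 j) (0 : R) (1 : R))
  (is_derive_funM (is_derive_id (0 : R) (1 : R)) (is_derive_cstfun (i == j)%:R (0 : R) (1 : R)))) _.
by rewrite mul1r mulr0 addr0 add0r.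
Qed.

Definition chx x := cosh (tau x).
Definition shx x := sinh (tau x).
Definition snx x := sin (theta x).
Definition csx x := cos (theta x).
Definition sphx x := sin (phi x).
Definition cphx x := cos (phi x).

Lemma is_derive_chx x i : is_derive x (dirv i) chx ((i == o0)%:R * shx x).
Proof.
rewrite mulrC.
exact: (is_derive_comp1 (is_derive_cosh (tau x)) (is_derive_coord x i o0)).
Qed.
Lemma is_derive_shx x i : is_derive x (dirv i) shx ((i == o0)%:R * chx x).
Proof.
rewrite mulrC.
exact: (is_derive_comp1 (is_derive_sinh (tau x)) (is_derive_coord x i o0)).
Qed.
Lemma is_derive_snx x i : is_derive x (dirv i) snx ((i == o1)%:R * csx x).
Proof.
rewrite mulrC.
exact: (is_derive_comp1 (is_derive_sin (theta x)) (is_derive_coord x i o1)).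
Qed.
Lemma is_derive_csx x i : is_derive x (dirv i) csx ((i == o1)%:R * (- snx x)).
Proof.
rewrite mulrC.
exact: (is_derive_comp1 (is_derive_cos (theta x)) (is_derive_coord x i o1)).
Qed.
Lemma is_derive_sphx x i : is_derive x (dirv i) sphx ((i == o2)%:R * cphx x).
Proof.
rewrite mulrC.
exact: (is_derive_comp1 (is_derive_sin (phi x)) (is_derive_coord x i o2)).
Qed.
Lemma is_derive_cphx x i : is_derive x (dirv i) cphx ((i == o2)%:R * (- sphx x)).
Proof.
rewrite mulrC.
exact: (is_derive_comp1 (is_derive_cos (phi x)) (is_derive_coord x i o2)).
Qed.

Lemma chx2E x : chx x ^+ 2 = 1 + shx x ^+ 2. Proof. exact: cosh2E. Qed.
Lemma snx2E x : snx x ^+ 2 = 1 - csx x ^+ 2.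
Proof. by rewrite -(cos2Dsin2 (theta x)) /snx /csx; ring. Qed.
Lemma sphx2E x : sphx x ^+ 2 = 1 - cphx x ^+ 2.
Proof. by rewrite -(cos2Dsin2 (phi x)) /sphx /cphx; ring. Qed.

(** The coefficients [a], [b], [d] certify that [l - r] lies in the ideal of the three Pythagorean
    relations; once they are supplied, the identity is left to [ring]. *)
Lemma trig_mod x (a b d l r : R) :
  l - r = a * (chx x ^+ 2 - (1 + shx x ^+ 2)) + b * (snx x ^+ 2 - (1 - csx x ^+ 2))
    + d * (sphx x ^+ 2 - (1 - cphx x ^+ 2)) -> l = r.
Proof.
by rewrite chx2E snx2E sphx2E !subrr !mulr0 !addr0 => /eqP; rewrite subr_eq0 => /eqP.
Qed.

Lemma chx_neq0 x : chx x != 0. Proof. by rewrite gt_eqF// cosh_gt0. Qed.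
Lemma snx_gt0 x : chart x -> 0 < snx x.
Proof. by move=> xc; apply: sin_gt0_pi. Qed.
Lemma snx_neq0 x : chart x -> snx x != 0.
Proof. by move=> /snx_gt0 h; rewrite gt_eqF. Qed.

Definition eta : 'M[R]_3 := diag_mx (\row_(a < 3) [:: -1; 1; 1]`_a).
Definition eta4 : 'M[R]_4 := diag_mx (\row_(a < 4) [:: -1; 1; 1; 1]`_a).

(* Rows: the orthonormal frame of dS_3 along tau, theta, phi, as vectors of R^{1,3}. *)
Definition frame x : 'M[R]_(3, 4) := \matrix_(a, mu)
  (nth [::] [:: [:: chx x; shx x * snx x * cphx x; shx x * snx x * sphx x; shx x * csx x];
      [:: 0; csx x * cphx x; csx x * sphx x; - snx x];
      [:: 0; - sphx x; cphx x; 0]] a)`_mu.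
Definition lame x : 'rV[R]_3 := \row_(a < 3) [:: 1; chx x; chx x * snx x]`_a.

(** The Christoffel symbols of dS_3 in closed form. They first serve as the tangential coefficients
    of the Gauss formula [is_derive_jac]; [christoffel_h0] identifies them with those of the
    Levi-Civita connection. *)
Definition gamma0 x (c a b : 'I_3) : R :=
  match val c, val a, val b with
  | 0%N, 1%N, 1%N => chx x * shx x
  | 0%N, 2%N, 2%N => chx x * shx x * snx x ^+ 2
  | 1%N, 0%N, 1%N | 1%N, 1%N, 0%N | 2%N, 0%N, 2%N | 2%N, 2%N, 0%N => shx x / chx x
  | 1%N, 2%N, 2%N => - (snx x * csx x)
  | 2%N, 1%N, 2%N | 2%N, 2%N, 1%N => csx x / snx x
  | _, _, _ => 0
  end.

End Chart.

(** The derivative is an existential variable, filled in along the syntax of the function. *)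
Ltac isd := lazymatch goal with
  | |- is_derive _ _ (fun y => @?f y + - @?g y) _ => eapply is_derive_funB; isd
  | |- is_derive _ _ (fun y => @?f y + @?g y) _ => eapply is_derive_funD; isd
  | |- is_derive _ _ (fun y => @?f y * @?g y) _ => eapply is_derive_funM; isd
  | |- is_derive _ _ (fun y => - @?f y) _ => eapply is_derive_funN; isd
  | |- is_derive _ _ (fun y => chx y) _ => eapply is_derive_chx
  | |- is_derive _ _ (fun y => shx y) _ => eapply is_derive_shx
  | |- is_derive _ _ (fun y => snx y) _ => eapply is_derive_snx
  | |- is_derive _ _ (fun y => csx y) _ => eapply is_derive_csx
  | |- is_derive _ _ (fun y => sphx y) _ => eapply is_derive_sphx
  | |- is_derive _ _ (fun y => cphx y) _ => eapply is_derive_cphx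
  | |- is_derive _ _ chx _ => eapply is_derive_chx
  | |- is_derive _ _ shx _ => eapply is_derive_shx
  | |- is_derive _ _ snx _ => eapply is_derive_snx
  | |- is_derive _ _ csx _ => eapply is_derive_csx
  | |- is_derive _ _ sphx _ => eapply is_derive_sphx
  | |- is_derive _ _ cphx _ => eapply is_derive_cphx
  | |- is_derive _ _ (fun y => ?c) _ => eapply is_derive_cstfun
  end.

Section Embedding.
Context {R : realType}.
Implicit Types (x : 'rV[R]_3).

Lemma jac_embed_entry x a mu : jac_embed x a mu = lame x 0 a * frame x a mu.
Proof.
rewrite mxE; apply: is_derive_pd.
rewrite (_ : (fun y => _) = fun y : 'rV[R]_3 => [:: shx y; chx y * snx y * cphx y;
   chx y * snx y * sphx y; chx y * csx y]`_mu); last by apply: funext => y; rewrite mxE.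
move: mu; apply: ord4P; rewrite /=; (eapply is_derive_eq; [isd|]);
  move: a; apply: ord3P; rewrite !mxE /=; ring.
Qed.

Lemma jac_embedE x : jac_embed x = diag_mx (lame x) *m frame x.
Proof. by apply/matrixP => a mu; rewrite mul_diag_mx jac_embed_entry [RHS]mxE. Qed.

Lemma is_derive_embed x i mu :
  is_derive x (dirv i) (fun y => embed y 0 mu) (jac_embed x i mu).
Proof.
rewrite mxE; apply: derivableP.
rewrite (_ : (fun y => _) = fun y : 'rV[R]_3 => [:: shx y; chx y * snx y * cphx y;
   chx y * snx y * sphx y; chx y * csx y]`_mu); last by apply: funext => y; rewrite mxE.
suff [d []] : exists d, is_derive x (dirv i) (fun y : 'rV[R]_3 => [:: shx y; chx y * snx y * cphx y;
   chx y * snx y * sphx y; chx y * csx y]`_mu) d by [].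
by move: mu; apply: ord4P; rewrite /=; eexists; isd.
Qed.

(* Gauss formula for the hyperboloid, with unit normal [embed x]. *)
Lemma is_derive_jac x b a mu : chart x ->
  is_derive x (dirv b) (fun y => jac_embed y a mu)
    (\sum_c gamma0 x c a b * jac_embed x c mu - h0 x a b * embed x 0 mu).
Proof.
move=> xc; have s0 := snx_neq0 xc; have c0 := chx_neq0 x.
have C := chx2E x; have S := snx2E x.
rewrite sum3E !jac_embed_entry.
rewrite (_ : (fun y => _) = fun y => lame y 0 a * frame y a mu); last first.
  by apply: funext => y; rewrite jac_embed_entry.
rewrite (_ : (fun y => _) = fun y => [:: 1; chx y; chx y * snx y]`_a *
  (nth [::] [:: [:: chx y; shx y * snx y * cphx y; shx y * snx y * sphx y; shx y * csx y];
      [:: 0; csx y * cphx y; csx y * sphx y; - snx y];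
      [:: 0; - sphx y; cphx y; 0]] a)`_mu); last first.
  by apply: funext => y; rewrite !mxE.
rewrite /h0 /embed /gamma0 !mxE -/(chx x) -/(shx x) -/(snx x) -/(csx x) -/(sphx x) -/(cphx x).
move: mu; apply: ord4P; move: a; apply: ord3P; rewrite /=;
  (eapply is_derive_eq; [isd|]); move: b; apply: ord3P; rewrite /=;
  rewrite ?mulr1n ?mulr0n;
  try (by field; rewrite ?s0 ?c0).
- by apply: (@trig_mod _ x (chx x * snx x * cphx x) 0 0); ring.
- by apply: (@trig_mod _ x (chx x * snx x ^+ 3 * cphx x) (chx x * snx x * cphx x) 0); ring.
- by apply: (@trig_mod _ x (chx x * snx x * sphx x) 0 0); ring.
- by apply: (@trig_mod _ x (chx x * snx x ^+ 3 * sphx x) (chx x * snx x * sphx x) 0); ring.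
- by apply: (@trig_mod _ x (chx x * csx x) 0 0); ring.
- by apply: (@trig_mod _ x (chx x * snx x ^+ 2 * csx x) 0 0); ring.
Qed.

Lemma h0_frame x : h0 x = diag_mx (lame x) *m eta *m diag_mx (lame x).
Proof.
apply/matrixP => a b; rewrite mul_mx_diag mul_diag_mx !mxE.
by move: a; apply: ord3P; move: b; apply: ord3P; rewrite /=; rewrite ?mulr1n ?mulr0n /chx /snx; ring.
Qed.

Lemma frame_eta4 x : frame x *m eta4 *m (frame x)^T = eta.
Proof.
have C := chx2E x; have S := snx2E x; have P := sphx2E x.
apply/matrixP => a b; rewrite /eta4 mul_mx_diag mxE sum4E !mxE.
move: a; apply: ord3P; move: b; apply: ord3P; rewrite /= ?mulr1n ?mulr0n.
all: try ring.
- apply: (@trig_mod _ x (-1) (shx x ^+ 2) (shx x ^+ 2 * snx x ^+ 2)); ring.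
- apply: (@trig_mod _ x 0 0 (shx x * snx x * csx x)); ring.
- apply: (@trig_mod _ x 0 0 (shx x * snx x * csx x)); ring.
- apply: (@trig_mod _ x 0 1 (csx x ^+ 2)); ring.
- apply: (@trig_mod _ x 0 0 1); ring.
Qed.

Lemma frame_normal x : frame x *m eta4 *m (embed x)^T = 0.
Proof.
have C := chx2E x; have S := snx2E x; have P := sphx2E x.
apply/matrixP => a b; rewrite /eta4 mul_mx_diag mxE sum4E !mxE.
rewrite -/(chx x) -/(shx x) -/(snx x) -/(csx x) -/(sphx x) -/(cphx x).
move: a; apply: ord3P; rewrite /=.
all: try ring.
- apply: (@trig_mod _ x 0 (shx x * chx x) (shx x * chx x * snx x ^+ 2)); ring.
- apply: (@trig_mod _ x 0 0 (csx x * snx x * chx x)); ring.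
Qed.

End Embedding.

Section ContinuityCombinators.
Context {R : realType}.

Lemma smooth_on_pd n (F : 'rV[R]_n -> R) U mu : smooth_on U F ->
  smooth_on U (pd mu F).
Proof. by move=> H s x Ux; have := H (rcons s mu) x Ux; rewrite /pds foldr_rcons. Qed.

Lemma smooth_on_derivable n (F : 'rV[R]_n -> R) U (x : 'rV[R]_n) i : smooth_on U F -> U x ->
  derivable F x (dirv i).
Proof. by move=> H Ux; have [_] := H [::] x Ux; apply. Qed.

Lemma smooth_on_continuous n (F : 'rV[R]_n -> R) U (x : 'rV[R]_n) : smooth_on U F -> U x ->
  {for x, continuous F}.
Proof. by move=> H Ux; have [] := H [::] x Ux. Qed.

Lemma continuous_coord n (x : 'rV[R]_n) j :
  {for x, continuous (fun y : 'rV[R]_n => y 0 j)}.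
Proof. exact: coord_continuous. Qed.

Lemma continuous_comp1 (T : topologicalType) (phi : R -> R) (f : T -> R) x :
  continuous phi -> {for x, continuous f} ->
  {for x, continuous (fun y => phi (f y))}.
Proof. by move=> Hp Hf; apply: (@continuous_comp _ _ _ f phi) => //; exact: Hp. Qed.

Lemma continuous_derivable1 (phi dphi : R -> R) :
  (forall t : R, is_derive t 1 phi (dphi t)) -> continuous phi.
Proof.
by move=> H t; apply: differentiable_continuous; apply/derivable1_diffP; case: (H t).
Qed.

Lemma continuous_funM (T : topologicalType) (f g : T -> R) x :
  {for x, continuous f} -> {for x, continuous g} ->
  {for x, continuous (fun y => f y * g y)}.
Proof. by move=> Hf Hg; exact: (cvgM Hf Hg). Qed.

Lemma continuous_funD (T : topologicalType) (f g : T -> R) x :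
  {for x, continuous f} -> {for x, continuous g} ->
  {for x, continuous (fun y => f y + g y)}.
Proof. by move=> Hf Hg; exact: (cvgD Hf Hg). Qed.

Lemma continuous_cstfun (T : topologicalType) (c : R) (x : T) :
  {for x, continuous (fun=> c)}.
Proof. exact: cst_continuous. Qed.

Lemma rV_nearW n (x : 'rV[R]_n) (P : 'rV[R]_n -> Prop) :
  (forall z, P z) -> \forall z \near x, P z.
Proof. by move=> H; apply: (@filterE _ _ (nbhs_filter x)). Qed.

End ContinuityCombinators.

(** * Smooth functions on the chart *)

Section SmoothFunctions.
Context {R : realType}.
Implicit Types (x : 'rV[R]_3) (f g : 'rV[R]_3 -> R).

(* An algebra of functions on the coordinate space, containing the pull-backs
   of the ambient smooth functions, and stable under partial derivatives. *)
Inductive ambient_algebra : ('rV[R]_3 -> R) -> Prop :=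
| amb_cst c : ambient_algebra (fun=> c)
| amb_chx : ambient_algebra (@chx R)
| amb_shx : ambient_algebra (@shx R)
| amb_snx : ambient_algebra (@snx R)
| amb_csx : ambient_algebra (@csx R)
| amb_sphx : ambient_algebra (@sphx R)
| amb_cphx : ambient_algebra (@cphx R)
| amb_comp F : smooth_on setT F -> ambient_algebra (fun x => F (embed x))
| amb_add f g : ambient_algebra f -> ambient_algebra g ->
    ambient_algebra (fun x => f x + g x)
| amb_mul f g : ambient_algebra f -> ambient_algebra g ->
    ambient_algebra (fun x => f x * g x).

Lemma continuous_chx x : {for x, continuous (@chx R)}.
Proof.
apply: (continuous_comp1 (phi := @cosh R)); last exact: continuous_coord.
by apply: continuous_derivable1 => t; exact: is_derive_cosh.
Qed.
Lemma continuous_shx x : {for x, continuous (@shx R)}.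
Proof.
apply: (continuous_comp1 (phi := @sinh R)); last exact: continuous_coord.
by apply: continuous_derivable1 => t; exact: is_derive_sinh.
Qed.
Lemma continuous_snx x : {for x, continuous (@snx R)}.
Proof.
by apply: (continuous_comp1 (phi := @sin R)); [exact: continuous_sin|exact: continuous_coord].
Qed.
Lemma continuous_csx x : {for x, continuous (@csx R)}.
Proof.
by apply: (continuous_comp1 (phi := @cos R)); [exact: continuous_cos|exact: continuous_coord].
Qed.
Lemma continuous_sphx x : {for x, continuous (@sphx R)}.
Proof.
by apply: (continuous_comp1 (phi := @sin R)); [exact: continuous_sin|exact: continuous_coord].
Qed.
Lemma continuous_cphx x : {for x, continuous (@cphx R)}.
Proof.
by apply: (continuous_comp1 (phi := @cos R)); [exact: continuous_cos|exact: continuous_coord].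
Qed.

Lemma continuous_embed x : {for x, continuous (@embed R)}.
Proof.
apply: rV_continuous => mu.
rewrite (_ : (fun y => _) = fun y : 'rV[R]_3 => [:: shx y; chx y * snx y * cphx y;
   chx y * snx y * sphx y; chx y * csx y]`_mu); last by apply: funext => y; rewrite mxE.
have [A B C] := And3 (@continuous_chx x) (@continuous_snx x) (@continuous_csx x).
move: mu; apply: ord4P; rewrite /=.
- exact: continuous_shx.
- exact: continuous_funM (continuous_funM A B) (@continuous_cphx x).
- exact: continuous_funM (continuous_funM A B) (@continuous_sphx x).
- exact: continuous_funM A C.
Qed.

Lemma is_derive_ambient (F : 'rV[R]_4 -> R) x i :
  (\forall z \near embed x, forall mu, derivable F z (dirv mu)) ->
  (forall mu, {for embed x, continuous (pd mu F)}) ->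
  is_derive x (dirv i) (fun y => F (embed y))
    (\sum_mu pd mu F (embed x) * jac_embed x i mu).
Proof.
move=> DF CF; apply: is_derive_chain => //; first exact: continuous_embed.
by move=> mu; exact: is_derive_embed.
Qed.

Lemma is_derive_ambient_smooth (F : 'rV[R]_4 -> R) x i : smooth_on setT F ->
  is_derive x (dirv i) (fun y => F (embed y))
    (\sum_mu pd mu F (embed x) * jac_embed x i mu).
Proof.
move=> HF; apply: is_derive_ambient.
  by apply: rV_nearW => z mu; exact: smooth_on_derivable HF _.
by move=> mu; exact: (@smooth_on_continuous _ _ _ setT (embed x) (smooth_on_pd mu HF) I).
Qed.

Lemma amb_sum I (r : seq I) (F : I -> 'rV[R]_3 -> R) :
  (forall i, ambient_algebra (F i)) ->
  ambient_algebra (fun x => \sum_(i <- r) F i x).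
Proof.
move=> H; elim: r => [|i r IH].
  by rewrite (_ : (fun x => _) = fun=> 0); [exact: amb_cst|apply: funext => y; rewrite big_nil].
rewrite (_ : (fun x => _) = fun x => F i x + \sum_(j <- r) F j x); first exact: amb_add.
by apply: funext => y; rewrite big_cons.
Qed.

Lemma amb_opp f : ambient_algebra f -> ambient_algebra (fun x => - f x).
Proof.
move=> Hf; rewrite (_ : (fun x => _) = fun x => -1 * f x).
  by apply: amb_mul => //; exact: amb_cst.
by apply: funext => y; rewrite mulN1r.
Qed.

Lemma amb_jac a mu : ambient_algebra (fun x => jac_embed x a mu).
Proof.
rewrite (_ : (fun y => _) = fun y => [:: 1; chx y; chx y * snx y]`_a *
  (nth [::] [:: [:: chx y; shx y * snx y * cphx y; shx y * snx y * sphx y; shx y * csx y];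
      [:: 0; csx y * cphx y; csx y * sphx y; - snx y];
      [:: 0; - sphx y; cphx y; 0]] a)`_mu); last first.
  by apply: funext => y; rewrite jac_embed_entry !mxE.
by move: mu; apply: ord4P; move: a; apply: ord3P; rewrite /=;
  repeat first [exact: amb_chx|exact: amb_shx|exact: amb_snx
   |exact: amb_csx|exact: amb_sphx|exact: amb_cphx|exact: amb_cst|apply: amb_opp|apply: amb_mul].
Qed.

Lemma amb_is_derive f : ambient_algebra f -> forall i, exists2 f' : 'rV[R]_3 -> R,
  ambient_algebra f' & forall x, is_derive x (dirv i) f (f' x).
Proof.
elim=> {f} [c|||||||F HF|f g _ IHf _ IHg|f g fA IHf gA IHg] i.
- by exists (fun=> 0); [exact: amb_cst|move=> x; exact: is_derive_cstfun].
- exists (fun x => (i == o0)%:R * shx x); last by move=> x; exact: is_derive_chx.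
  by apply: amb_mul; [exact: amb_cst|exact: amb_shx].
- exists (fun x => (i == o0)%:R * chx x); last by move=> x; exact: is_derive_shx.
  by apply: amb_mul; [exact: amb_cst|exact: amb_chx].
- exists (fun x => (i == o1)%:R * csx x); last by move=> x; exact: is_derive_snx.
  by apply: amb_mul; [exact: amb_cst|exact: amb_csx].
- exists (fun x => (i == o1)%:R * - snx x); last by move=> x; exact: is_derive_csx.
  by apply: amb_mul; [exact: amb_cst|apply: amb_opp; exact: amb_snx].
- exists (fun x => (i == o2)%:R * cphx x); last by move=> x; exact: is_derive_sphx.
  by apply: amb_mul; [exact: amb_cst|exact: amb_cphx].
- exists (fun x => (i == o2)%:R * - sphx x); last by move=> x; exact: is_derive_cphx.
  by apply: amb_mul; [exact: amb_cst|apply: amb_opp; exact: amb_sphx].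
- exists (fun x => \sum_mu pd mu F (embed x) * jac_embed x i mu).
    apply: amb_sum => mu; apply: amb_mul; last exact: amb_jac.
    by apply: amb_comp; exact: smooth_on_pd.
  by move=> x; exact: is_derive_ambient_smooth.
- have [f' f'A Hf] := IHf i; have [g' g'A Hg] := IHg i.
  exists (fun x => f' x + g' x); first exact: amb_add.
  by move=> x; exact: is_derive_funD.
- have [f' f'A Hf] := IHf i; have [g' g'A Hg] := IHg i.
  exists (fun x => f' x * g x + f x * g' x); last by move=> x; exact: is_derive_funM.
  by apply: amb_add; apply: amb_mul.
Qed.

Lemma amb_continuous f x : ambient_algebra f -> {for x, continuous f}.
Proof.
elim=> {f} [c|||||||F HF|f g _ IHf _ IHg|f g _ IHf _ IHg].
- exact: continuous_cstfun.
- exact: continuous_chx.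
- exact: continuous_shx.
- exact: continuous_snx.
- exact: continuous_csx.
- exact: continuous_sphx.
- exact: continuous_cphx.
- apply: (@continuous_comp _ _ _ (@embed R) F); first exact: continuous_embed.
  exact: smooth_on_continuous HF _.
- exact: continuous_funD.
- exact: continuous_funM.
Qed.

Lemma amb_pd f i : ambient_algebra f -> ambient_algebra (pd i f).
Proof.
move=> /amb_is_derive/(_ i)[f' f'A H].
by rewrite (_ : pd i f = f')//; apply: funext => x; exact: is_derive_pd.
Qed.

Lemma amb_derivable f i x : ambient_algebra f -> derivable f x (dirv i).
Proof. by move=> /amb_is_derive/(_ i)[f' f'A H]; have [] := H x. Qed.

Lemma amb_pd_comm f i j x : ambient_algebra f ->
  pd i (pd j f) x = pd j (pd i f) x.
Proof.
move=> fA; apply: pd_comm.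
  apply: rV_nearW => z; split=> [k|k l]; apply: amb_derivable => //.
  exact: amb_pd.
by move=> k l; apply: amb_continuous; do 2 apply: amb_pd.
Qed.

Lemma chart_open x : chart x -> \forall y \near x, chart y.
Proof.
move=> /andP[t0 tpi].
have H0 : \forall y \near x, 0 < theta y.
  by have := @continuous_coord R 3 x o1; move/cvgr_gt; apply.
have H1 : \forall y \near x, theta y < pi.
  by have := @continuous_coord R 3 x o1; move/cvgr_lt; apply.
by near=> y; apply/andP; split; near: y.
Unshelve. all: by end_near. Qed.

Definition chart_eq f g := forall x, chart x -> f x = g x.

Lemma chart_eq_near f g x : chart_eq f g -> chart x -> \forall y \near x, f y = g y.
Proof. by move=> fg /chart_open; apply: filterS => y /fg. Qed.

Lemma chart_eq_pd f g i : chart_eq f g -> chart_eq (pd i f) (pd i g).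
Proof. by move=> fg x xc; apply: pd_near; exact: chart_eq_near. Qed.

Lemma chart_eq_is_derive f g x v d : chart_eq f g -> chart x ->
  is_derive x v g d -> is_derive x v f d.
Proof.
move=> fg xc; apply: near_eq_is_derive; apply: filterS (chart_open xc) => y yc.
by rewrite fg.
Qed.

Lemma chart_eq_continuous f g x : chart_eq f g -> chart x ->
  {for x, continuous g} -> {for x, continuous f}.
Proof.
move=> fg xc gc; rewrite /prop_for /continuous_at fg//.
have N : \forall y \near x, g y = f y.
  by apply: filterS (chart_open xc) => y yc; rewrite fg.
exact: cvg_trans (near_eq_cvg N) gc.
Qed.

(** Fields are prescribed on the chart only. Since the chart is open, agreement there with a
    function of the algebra passes to all partial derivatives. *)
Definition chart_smooth f := exists2 g, ambient_algebra g & chart_eq f g.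

Lemma chart_smooth_pd f i : chart_smooth f -> chart_smooth (pd i f).
Proof.
by move=> [g gA fg]; exists (pd i g); [exact: amb_pd|exact: chart_eq_pd].
Qed.

Lemma chart_smooth_is_derive f i x : chart_smooth f -> chart x ->
  is_derive x (dirv i) f (pd i f x).
Proof.
move=> [g gA fg] xc; rewrite (chart_eq_pd i fg xc).
by apply: chart_eq_is_derive fg xc _; apply: derivable_pd; exact: amb_derivable.
Qed.

Lemma chart_smooth_continuous f x : chart_smooth f -> chart x ->
  {for x, continuous f}.
Proof.
by move=> [g gA fg] xc; apply: chart_eq_continuous fg xc _; exact: amb_continuous.
Qed.

Lemma chart_smooth_pd_comm f i j x : chart_smooth f -> chart x ->
  pd i (pd j f) x = pd j (pd i f) x.
Proof.
move=> [g gA fg] xc; rewrite (chart_eq_pd i (chart_eq_pd j fg) xc).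
by rewrite (chart_eq_pd j (chart_eq_pd i fg) xc); exact: amb_pd_comm.
Qed.

Lemma smooth_scalar_chart f : smooth_scalar f -> chart_smooth f.
Proof. by move=> [F HF H]; exists (fun x => F (embed x)) => //; exact: amb_comp. Qed.

Lemma smooth_tensor2_chart (t : 'rV[R]_3 -> 'M[R]_3) a b : smooth_tensor2 t ->
  chart_smooth (fun x => t x a b).
Proof.
move=> [F HF H].
exists (fun x => \sum_nu (\sum_mu jac_embed x a mu * F (embed x) mu nu) * jac_embed x b nu).
  apply: amb_sum => nu; apply: amb_mul; last exact: amb_jac.
  apply: amb_sum => mu; apply: amb_mul; first exact: amb_jac.
  by apply: (amb_comp (F := fun y => F y mu nu)).
move=> x xc; rewrite H// /pullback2 mxE; apply: eq_bigr => nu _.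
by rewrite !mxE.
Qed.

End SmoothFunctions.

(** * Determinants and adjugates under predicates stable by sums and products *)

Section ClosedPredicates.
Context {R : realType} {T : Type} (Pr : (T -> R) -> Prop).
Hypotheses (Pr_cst : forall c, Pr (fun=> c))
  (Pr_add : forall f g, Pr f -> Pr g -> Pr (fun x => f x + g x))
  (Pr_mul : forall f g, Pr f -> Pr g -> Pr (fun x => f x * g x)).

Lemma closed_sum I (r : seq I) (P : pred I) (F : I -> T -> R) :
  (forall i, Pr (F i)) -> Pr (fun x => \sum_(i <- r | P i) F i x).
Proof.
move=> H; elim: r => [|i r IH].
  by rewrite (_ : (fun x => _) = fun=> 0)//; apply: funext => y; rewrite big_nil.
have [Pi|Pi] := boolP (P i).
  rewrite (_ : (fun x => _) = fun x => F i x + \sum_(j <- r | P j) F j x).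
    exact: Pr_add.
  by apply: funext => y; rewrite big_cons Pi.
rewrite (_ : (fun x => _) = fun x => \sum_(j <- r | P j) F j x)//.
by apply: funext => y; rewrite big_cons (negbTE Pi).
Qed.

Lemma closed_prod I (r : seq I) (F : I -> T -> R) :
  (forall i, Pr (F i)) -> Pr (fun x => \prod_(i <- r) F i x).
Proof.
move=> H; elim: r => [|i r IH].
  by rewrite (_ : (fun x => _) = fun=> 1)//; apply: funext => y; rewrite big_nil.
rewrite (_ : (fun x => _) = fun x => F i x * \prod_(j <- r) F j x).
  exact: Pr_mul.
by apply: funext => y; rewrite big_cons.
Qed.

(** The Leibniz formula consists of constants, sums and products. The predicate is left abstract
    because the same argument serves derivability, continuity and the classes [bigO]. *)
Lemma closed_det n (A : T -> 'M[R]_n) : (forall i j, Pr (fun x => A x i j)) ->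
  Pr (fun x => \det (A x)).
Proof.
move=> H; apply: closed_sum => s; apply: Pr_mul => //.
exact: closed_prod.
Qed.

Lemma closed_mulmx m n p (A : T -> 'M[R]_(m, n)) (B : T -> 'M[R]_(n, p)) :
  (forall i j, Pr (fun x => A x i j)) -> (forall i j, Pr (fun x => B x i j)) ->
  forall i j, Pr (fun x => (A x *m B x) i j).
Proof.
move=> HA HB i j; rewrite (_ : (fun x => _) = fun x => \sum_k A x i k * B x k j).
  by apply: closed_sum => k; exact: Pr_mul.
by apply: funext => x; rewrite mxE.
Qed.

Lemma closed_adj n (A : T -> 'M[R]_n) : (forall i j, Pr (fun x => A x i j)) ->
  forall i j, Pr (fun x => (\adj (A x)) i j).
Proof.
move=> HA i j; rewrite (_ : (fun x => _) =
    fun x => (-1) ^+ (j + i) * \det (row' j (col' i (A x)))).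
  apply: Pr_mul => //; apply: closed_det => k l.
  rewrite (_ : (fun x => _) = fun x => A x (lift j k) (lift i l))//.
  by apply: funext => x; rewrite !mxE.
by apply: funext => x; rewrite !mxE.
Qed.

End ClosedPredicates.

Section DerivableMatrix.
Context {R : realType} {V : normedModType R}.

Lemma derivable_invmx n (A : V -> 'M[R]_n) (x v : V) :
  (\forall y \near x, A y \in unitmx) -> A x \in unitmx ->
  (forall i j, derivable (fun y => A y i j) x v) ->
  forall i j, derivable (fun y => invmx (A y) i j) x v.
Proof.
move=> U Ux H i j.
have E : \forall y \near x, (\det (A y))^-1 * (\adj (A y)) i j = invmx (A y) i j.
  by apply: filterS U => y yU; rewrite /invmx yU [RHS]mxE.
apply: near_eq_derivable E _.
have Dc (c : R) : derivable (fun _ : V => c) x v by exact: derivable_cst.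
have Da (f k : V -> R) : derivable f x v -> derivable k x v ->
    derivable (fun y => f y + k y) x v.
  by move=> /derivableP Hf /derivableP Hk; case: (is_derive_funD Hf Hk).
have Dm (f k : V -> R) : derivable f x v -> derivable k x v ->
    derivable (fun y => f y * k y) x v.
  by move=> /derivableP Hf /derivableP Hk; case: (is_derive_funM Hf Hk).
have D1 : derivable (fun y => \det (A y)) x v.
  exact: (closed_det (Pr := fun f => derivable f x v) Dc Da Dm).
have D2 : derivable (fun y => (\adj (A y)) i j) x v.
  exact: (closed_adj (Pr := fun f => derivable f x v) Dc Da Dm H).
have d0 : \det (A x) != 0 by rewrite -unitfE -unitmxE.
have DV : derivable (fun y => (\det (A y))^-1) x v.
  by case: (is_derive_funV (f := fun y => \det (A y)) d0 (derivableP D1)).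
exact: Dm DV D2.
Qed.

(** Cramer's formula gives derivability; the value is then forced by differentiating A^-1 A = 1. *)
Lemma derive_invmx n (A : V -> 'M[R]_n) (x v : V) (dA : 'M[R]_n) :
  (\forall y \near x, A y \in unitmx) -> A x \in unitmx ->
  (forall i j, is_derive x v (fun y => A y i j) (dA i j)) ->
  forall i j, is_derive x v (fun y => invmx (A y) i j)
    (- (invmx (A x) *m dA *m invmx (A x)) i j).
Proof.
move=> U Ux H.
have DA i j : derivable (fun y => A y i j) x v by case: (H i j).
have D := derivable_invmx U Ux DA.
pose B : 'M[R]_n := \matrix_(i, j) 'D_v (fun y => invmx (A y) i j) x.
have DB i j : is_derive x v (fun y => invmx (A y) i j) (B i j).
  by rewrite mxE; exact: derivableP.
suff BE : B = - (invmx (A x) *m dA *m invmx (A x)).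
  by move=> i j; have := DB i j; rewrite BE mxE.
have E : B *m A x + invmx (A x) *m dA = 0.
  apply/matrixP => i j; rewrite !mxE -big_split /=.
  have D1 : is_derive x v (fun y => \sum_k invmx (A y) i k * A y k j)
      (\sum_k (B i k * A x k j + invmx (A x) i k * dA k j)).
    by apply: is_derive_funsum => k; exact: is_derive_funM.
  rewrite -(@derive_val _ _ _ _ _ _ _ D1).
  rewrite (@near_eq_derive _ _ _ _ (fun=> (1%:M : 'M[R]_n) i j)).
    by rewrite derive_cst.
  by apply: filterS U => y yU; rewrite -(mulVmx yU) mxE.
move/eqP: E; rewrite addr_eq0 => /eqP E.
by rewrite -[LHS](mulmxK Ux) E mulNmx.
Qed.

End DerivableMatrix.

Section LaplacianDivergence.
Context {R : realType} {d : nat}.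

(* The contracted identity [G^c_cd h^de v_e + d_c (h^cd) v_d = - h^cd G^e_cd v_e],
   where [A c] stands for [d_c h]. *)
Lemma laplacian_divergence (Hi : 'M[R]_d) (A : 'I_d -> 'M[R]_d) (v : 'I_d -> R) :
  Hi^T = Hi -> (forall c, (A c)^T = A c) ->
  \sum_c \sum_e (- (Hi *m A c *m Hi) c e * v e)
  + \sum_c \sum_e (2^-1 * \sum_f Hi c f * (A c f e + A e f c - A f c e))
       * (\sum_f Hi e f * v f) =
  - \sum_c \sum_e Hi c e * \sum_f (2^-1 * \sum_i Hi f i * (A c i e + A e i c - A i c e)) * v f.
Proof.
move=> sHi sA.
have eHi c e : Hi c e = Hi e c by rewrite -{1}sHi mxE.
have eA c e f : A c e f = A c f e by rewrite -{1}(sA c) mxE.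
(* [W] is [v] with raised index; [P] and [T] are the two traces h^ce d_c h_ef and h^ce d_f h_ec of
   the derivative of the metric. The two sums on the left are - P.W and T.W / 2, the one on the
   right is P.W - T.W / 2. *)
pose W f := \sum_e Hi f e * v e.
pose P f := \sum_c \sum_e Hi c e * A c e f.
pose T f := \sum_c \sum_e Hi c e * A f e c.
have L1 : \sum_c \sum_e (- (Hi *m A c *m Hi) c e * v e) = - \sum_f P f * W f.
  rewrite /P; under [X in _ = - X]eq_bigr do rewrite mulr_suml.
  rewrite [X in _ = - X]exchange_big -sumrN; apply: eq_bigr => c _.
  rewrite /W.
  transitivity (- \sum_f \sum_e (Hi *m A c) c f * (Hi f e * v e)).
    rewrite [X in _ = - X]exchange_big -sumrN; apply: eq_bigr => e _ /=.
    by rewrite [(_ *m Hi) c e]mxE mulNr mulr_suml; congr (- _); apply: eq_bigr => f _; rewrite mulrA.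
  by congr (- _); apply: eq_bigr => f _; rewrite -mulr_sumr mxE.
have L2 : \sum_c \sum_e (2^-1 * \sum_f Hi c f * (A c f e + A e f c - A f c e)) * W e
    = 2^-1 * \sum_e T e * W e.
  rewrite exchange_big mulr_sumr; apply: eq_bigr => e _ /=.
  rewrite -mulr_suml -mulr_sumr -mulrA; congr (_ * (_ * _)).
  transitivity (T e + (\sum_c \sum_f Hi c f * A c f e - \sum_c \sum_f Hi c f * A f c e)).
    rewrite -sumrB -big_split; apply: eq_bigr => c _ /=.
    by rewrite -sumrB -big_split; apply: eq_bigr => f _ /=; ring.
  rewrite [X in _ + (X - _)]exchange_big /=.
  rewrite [X in _ + (X - _)](_ : _ = \sum_c \sum_f Hi c f * A f c e) ?subrr ?addr0//.
  by apply: eq_bigr => c _; apply: eq_bigr => f _; rewrite eHi.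
have L3 : \sum_c \sum_e Hi c e * \sum_f (2^-1 * \sum_i Hi f i * (A c i e + A e i c - A i c e)) * v f
    = \sum_f P f * W f - 2^-1 * \sum_e T e * W e.
  transitivity (\sum_c \sum_e Hi c e * \sum_i 2^-1 * (A c i e + A e i c - A i c e) * W i).
    apply: eq_bigr => c _; apply: eq_bigr => e _; congr (_ * _).
    under eq_bigr do rewrite mulrAC mulr_sumr.
    rewrite exchange_big; apply: eq_bigr => i _ /=; rewrite /W mulr_sumr.
    by apply: eq_bigr => f _; rewrite (eHi f i); ring.
  transitivity (\sum_i (\sum_c \sum_e Hi c e * (2^-1 * (A c i e + A e i c - A i c e))) * W i).
    under eq_bigr do under eq_bigr do rewrite mulr_sumr.
    under eq_bigr do rewrite exchange_big.
    rewrite exchange_big; apply: eq_bigr => i _ /=; rewrite mulr_suml.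
    by apply: eq_bigr => c _; rewrite mulr_suml; apply: eq_bigr => e _; ring.
  rewrite mulr_sumr -sumrB; apply: eq_bigr => i _; rewrite mulrA -mulrBl; congr (_ * _).
  transitivity (2^-1 * P i + 2^-1 * (\sum_c \sum_e Hi c e * A e c i) - 2^-1 * T i).
    rewrite !mulr_sumr -sumrN -!big_split; apply: eq_bigr => c _ /=.
    rewrite !mulr_sumr -sumrN -!big_split; apply: eq_bigr => e _ /=.
    by rewrite (eA i e c) (eA c i e) (eA e i c); ring.
  rewrite [X in _ + 2^-1 * X](_ : _ = P i); first by field.
  rewrite exchange_big; apply: eq_bigr => c _; apply: eq_bigr => e _.
  by rewrite eHi.
by rewrite L1 L2 L3; ring.
Qed.

End LaplacianDivergence.

(** * The radial decomposition of the Ricci tensor *)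

Section ADMDecomposition.
Context {R : realType} {d : nat}.
Implicit Types (f : 'rV[R]_(1 + d) -> R) (p q : 'rV[R]_(1 + d)).

Notation rr := (lshift d (ord0 : 'I_1)).
Notation tg a := (rshift 1 a).

Definition lapse_metric (N : 'rV[R]_(1 + d) -> R) (h : 'rV[R]_(1 + d) -> 'M[R]_d) p :
  'M[R]_(1 + d) := block_mx ((N p) ^+ 2)%:M 0 0 (h p).

Lemma pt_radius_tail p : pt (radius p) (tail p) = p.
Proof.
rewrite /pt /radius /tail -[RHS]hsubmxK; congr row_mx.
by apply/matrixP => i j; rewrite !ord1 [LHS]mxE eqxx mulr1n.
Qed.

Lemma radius_pt rho (x : 'rV[R]_d) : radius (pt rho x) = rho.
Proof. by rewrite /radius /pt row_mxKl mxE eqxx. Qed.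

Lemma tail_pt rho (x : 'rV[R]_d) : tail (pt rho x) = x.
Proof. by rewrite /tail /pt row_mxKr. Qed.

Lemma pt_add_dirv rho (x : 'rV[R]_d) a (t : R) :
  t *: dirv (tg a) + pt rho x = pt rho (t *: dirv a + x).
Proof.
apply/rowP => i; rewrite !mxE; case: splitP => [j Ej|j Ej].
  have -> : (i == tg a) = false by apply/negbTE; rewrite -val_eqE /= Ej ord1.
  by rewrite andbF mulr0 add0r.
rewrite !mxE; congr (_ * _%:R + _); congr (_ && _).
by rewrite -!val_eqE /= Ej.
Qed.

Lemma pd_slice (f : 'rV[R]_(1 + d) -> R) rho (x : 'rV[R]_d) a :
  pd a (fun y => f (pt rho y)) x = pd (tg a) f (pt rho x).
Proof.
have E : (fun t : R => t^-1 *: (f (pt rho (t *: dirv a + x)) - f (pt rho x))) =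
   (fun t : R => t^-1 *: (f (t *: dirv (tg a) + pt rho x) - f (pt rho x))).
  by apply: funext => t; rewrite pt_add_dirv.
exact: (congr1 (fun F : R -> R => lim (F @ (0 : R)^')) E).
Qed.

Lemma is_derive_slice (f : 'rV[R]_(1 + d) -> R) rho (x : 'rV[R]_d) a l :
  is_derive (pt rho x) (dirv (tg a)) f l <->
  is_derive x (dirv a) (fun y => f (pt rho y)) l.
Proof.
have E : (fun t : R => t^-1 *: (f (t *: dirv (tg a) + pt rho x) - f (pt rho x))) =
   (fun t : R => t^-1 *: (f (pt rho (t *: dirv a + x)) - f (pt rho x))).
  by apply: funext => t; rewrite pt_add_dirv.
split=> -[D <-]; apply: DeriveDef; rewrite /derivable /derive; by [rewrite -E|rewrite E].
Qed.

Variables (N : 'rV[R]_(1 + d) -> R) (h : 'rV[R]_(1 + d) -> 'M[R]_d)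
  (U : set 'rV[R]_(1 + d)).
Hypotheses (oU : forall p, U p -> \forall q \near p, U q)
  (N0 : forall p, U p -> N p != 0) (hu : forall p, U p -> h p \in unitmx)
  (hs : forall p, U p -> (h p)^T = h p)
  (dN : forall p i, U p -> derivable N p (dirv i))
  (ddN : forall p i j, U p -> derivable (pd i N) p (dirv j))
  (dh : forall p i a b, U p -> derivable (fun q => h q a b) p (dirv i))
  (ddh : forall p i j a b, U p -> derivable (pd i (fun q => h q a b)) p (dirv j)).

Notation g := (lapse_metric N h).

Definition dmx (i : 'I_(1 + d)) q : 'M[R]_d := \matrix_(a, b) pd i (fun y => h y a b) q.

(** The Christoffel symbols of the slice metric as functions of the spacetime point, so that they
    can be compared with those of the full metric; [slice_christoffel] identifies them. *)
Definition gam q (c a b : 'I_d) : R :=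
  2^-1 * \sum_e invmx (h q) c e * (dmx (tg a) q e b + dmx (tg b) q e a - dmx (tg e) q a b).

(** The extrinsic curvature when the shift vanishes; [extrinsic_extK] identifies it with [extrinsic]
    for positive lapse. *)
Definition extK q : 'M[R]_d := (2 * N q)^-1 *: dmx rr q.
Definition dextK q : 'M[R]_d := \matrix_(a, b) pd rr (fun y => extK y a b) q.
Definition hessN q : 'M[R]_d :=
  \matrix_(a, b) (pd (tg b) (pd (tg a) N) q - \sum_c gam q c a b * pd (tg c) N q).

Let mixK q : 'M[R]_d := invmx (h q) *m extK q.

Lemma hessNE q a b : hessN q a b =
  pd (tg b) (pd (tg a) N) q - \sum_c gam q c a b * pd (tg c) N q.
Proof. by rewrite [LHS]mxE. Qed.

Lemma extKE q a b : extK q a b = (2 * N q)^-1 * dmx rr q a b.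
Proof. by rewrite [LHS]mxE. Qed.

Lemma pd_eq_on f1 f2 p i : U p -> (forall q, U q -> f1 q = f2 q) ->
  pd i f1 p = pd i f2 p.
Proof. by move=> Up H; apply: pd_near; apply: filterS (oU Up) => q /H. Qed.

Lemma dmx_sym q i : U q -> (dmx i q)^T = dmx i q.
Proof.
move=> Uq; apply/matrixP => a b; rewrite !mxE; apply: pd_eq_on => // y /hs E.
by rewrite -{1}E mxE.
Qed.

Lemma invh_sym q : U q -> (invmx (h q))^T = invmx (h q).
Proof. by move=> /hs E; rewrite trmx_inv E. Qed.

Lemma g_rr q : g q rr rr = N q ^+ 2.
Proof. by rewrite /lapse_metric block_mxEul mxE eqxx mulr1n. Qed.
Lemma g_rt q a : g q rr (tg a) = 0.
Proof. by rewrite /lapse_metric block_mxEur mxE. Qed.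
Lemma g_tr q a : g q (tg a) rr = 0.
Proof. by rewrite /lapse_metric block_mxEdl mxE. Qed.
Lemma g_tt q a b : g q (tg a) (tg b) = h q a b.
Proof. by rewrite /lapse_metric block_mxEdr. Qed.

Lemma invg q : U q -> invmx (g q) = block_mx ((N q) ^- 2)%:M 0 0 (invmx (h q)).
Proof.
move=> Uq; rewrite invmx_block_diag.
  by rewrite invmx_scalar.
rewrite unitmxE det_ublock det_scalar1 unitrM -unitmxE hu// andbT.
by rewrite unitfE expf_neq0// N0.
Qed.

Lemma ig_rr q : U q -> invmx (g q) rr rr = N q ^- 2.
Proof. by move=> Uq; rewrite invg// block_mxEul mxE eqxx mulr1n. Qed.
Lemma ig_rt q a : U q -> invmx (g q) rr (tg a) = 0.
Proof. by move=> Uq; rewrite invg// block_mxEur mxE. Qed.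
Lemma ig_tr q a : U q -> invmx (g q) (tg a) rr = 0.
Proof. by move=> Uq; rewrite invg// block_mxEdl mxE. Qed.
Lemma ig_tt q a b : U q -> invmx (g q) (tg a) (tg b) = invmx (h q) a b.
Proof. by move=> Uq; rewrite invg// block_mxEdr. Qed.

Lemma sum1d (F : 'I_(1 + d) -> R) : \sum_i F i = F rr + \sum_(a < d) F (tg a).
Proof. by rewrite big_split_ord big_ord1. Qed.

Lemma pd_grr i q : U q -> pd i (fun y => g y rr rr) q = 2 * N q * pd i N q.
Proof.
move=> Uq; rewrite (_ : (fun y => _) = fun y => N y ^+ 2); last first.
  by apply: funext => y; exact: g_rr.
by apply: is_derive_pd; apply: is_derive_funX2; apply: derivable_pd; exact: dN.
Qed.
Lemma pd_grt i q a : pd i (fun y => g y rr (tg a)) q = 0.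
Proof.
rewrite (_ : (fun y => _) = fun=> 0); last by apply: funext => y; exact: g_rt.
by apply: is_derive_pd; exact: is_derive_cstfun.
Qed.
Lemma pd_gtr i q a : pd i (fun y => g y (tg a) rr) q = 0.
Proof.
rewrite (_ : (fun y => _) = fun=> 0); last by apply: funext => y; exact: g_tr.
by apply: is_derive_pd; exact: is_derive_cstfun.
Qed.
Lemma pd_gtt i q a b : pd i (fun y => g y (tg a) (tg b)) q = dmx i q a b.
Proof.
rewrite mxE (_ : (fun y => _) = fun y => h y a b)//; apply: funext => y; exact: g_tt.
Qed.

Let pdgE := (pd_grt, pd_gtr, pd_gtt).

Lemma chr_ttt q c a b : U q -> christoffel g q (tg c) (tg a) (tg b) = gam q c a b.
Proof.
move=> Uq; rewrite /christoffel sum1d ig_tr// mul0r add0r; congr (_ * _).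
by apply: eq_bigr => e _; rewrite ig_tt// !pdgE.
Qed.

Lemma chr_rtt q a b : U q -> christoffel g q rr (tg a) (tg b) = - (N q)^-1 * extK q a b.
Proof.
move=> Uq; have n0 := N0 Uq; rewrite /christoffel sum1d ig_rr// big1; last first.
  by move=> e _; rewrite ig_rt// mul0r.
rewrite !pdgE extKE; field; exact: n0.
Qed.

Lemma chr_ttr q c a : U q -> christoffel g q (tg c) (tg a) rr = N q * mixK q c a.
Proof.
move=> Uq; have n0 := N0 Uq; rewrite /christoffel sum1d ig_tr// mul0r add0r /mixK mxE.
rewrite !mulr_sumr; apply: eq_bigr => e _; rewrite ig_tt// !pdgE extKE; field; exact: n0.
Qed.

Lemma chr_trt q c a : U q -> christoffel g q (tg c) rr (tg a) = N q * mixK q c a.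
Proof.
move=> Uq; have n0 := N0 Uq; rewrite /christoffel sum1d ig_tr// mul0r add0r /mixK mxE.
rewrite !mulr_sumr; apply: eq_bigr => e _; rewrite ig_tt// !pdgE extKE; field; exact: n0.
Qed.

Lemma chr_rrt q a : U q -> christoffel g q rr rr (tg a) = (N q)^-1 * pd (tg a) N q.
Proof.
move=> Uq; have n0 := N0 Uq; rewrite /christoffel sum1d ig_rr// big1; last first.
  by move=> e _; rewrite ig_rt// mul0r.
rewrite !pdgE pd_grr//; field; exact: n0.
Qed.

Lemma chr_rtr q a : U q -> christoffel g q rr (tg a) rr = (N q)^-1 * pd (tg a) N q.
Proof.
move=> Uq; have n0 := N0 Uq; rewrite /christoffel sum1d ig_rr// big1; last first.
  by move=> e _; rewrite ig_rt// mul0r.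
rewrite !pdgE pd_grr//; field; exact: n0.
Qed.

Lemma chr_rrr q : U q -> christoffel g q rr rr rr = (N q)^-1 * pd rr N q.
Proof.
move=> Uq; have n0 := N0 Uq; rewrite /christoffel sum1d ig_rr// big1; last first.
  by move=> e _; rewrite ig_rt// mul0r.
rewrite pd_grr//; field; exact: n0.
Qed.

Lemma chr_trr q c : U q -> christoffel g q (tg c) rr rr =
  - N q * \sum_e invmx (h q) c e * pd (tg e) N q.
Proof.
move=> Uq; have n0 := N0 Uq; rewrite /christoffel sum1d ig_tr// mul0r add0r.
rewrite !mulr_sumr; apply: eq_bigr => e _; rewrite ig_tt// !pdgE pd_grr//; by field.
Qed.

Let chrE := (chr_ttt, chr_rtt, chr_ttr, chr_trt, chr_rrt, chr_rtr, chr_rrr, chr_trr).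

Lemma dmx_is_derive i p a b : U p -> is_derive p (dirv i) (fun q => h q a b) (dmx i p a b).
Proof. by move=> Up; rewrite mxE; apply: derivable_pd; exact: dh. Qed.

Lemma dmx_derivable i j p a b : U p -> derivable (fun q => dmx i q a b) p (dirv j).
Proof.
move=> Up; rewrite (_ : (fun q => _) = pd i (fun q => h q a b)); first exact: ddh.
by apply: funext => q; rewrite mxE.
Qed.

Lemma is_derive_invN p i : U p ->
  is_derive p (dirv i) (fun q => (N q)^-1) (- (N p) ^- 2 * pd i N p).
Proof.
by move=> Up; apply: is_derive_funV; [exact: N0|apply: derivable_pd; exact: dN].
Qed.

Lemma extK_derivable p i a b : U p -> derivable (fun q => extK q a b) p (dirv i).
Proof.
move=> Up; rewrite (_ : (fun q => _) = fun q => (2^-1 * (N q)^-1) * dmx rr q a b).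
  apply: derivableM; last exact: dmx_derivable.
  apply: derivableM; first exact: derivable_cst.
  by have [] := is_derive_invN i Up.
by apply: funext => q; rewrite mxE invfM.
Qed.

Lemma dextK_is_derive p a b : U p ->
  is_derive p (dirv rr) (fun q => extK q a b) (dextK p a b).
Proof. by move=> Up; rewrite mxE; apply: derivable_pd; exact: extK_derivable. Qed.

Lemma invh_is_derive p i : U p -> forall a b, is_derive p (dirv i) (fun q => invmx (h q) a b)
    (- (invmx (h p) *m dmx i p *m invmx (h p)) a b).
Proof.
move=> Up; apply: derive_invmx => [||a b]; last exact: dmx_is_derive.
- by apply: filterS (oU Up) => q /hu.
- exact: hu.
Qed.

Lemma extK_sym q : U q -> (extK q)^T = extK q.
Proof. by move=> Uq; rewrite /extK linearZ /= dmx_sym. Qed.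

Lemma dmx_rr q : U q -> dmx rr q = (2 * N q) *: extK q.
Proof.
move=> Uq; rewrite /extK scalerA divff ?scale1r//.
by rewrite mulf_neq0// N0.
Qed.

Lemma slice_christoffel rho (x : 'rV[R]_d) c a b :
  christoffel (fun y => h (pt rho y)) x c a b = gam (pt rho x) c a b.
Proof.
rewrite /christoffel /gam; congr (_ * _); apply: eq_bigr => e _.
by rewrite !mxE !(pd_slice (fun q => h q _ _)).
Qed.

Lemma ricci_slice rho (x : 'rV[R]_d) a b :
  ricci (fun y => h (pt rho y)) x a b = \sum_c
    (pd (tg c) (fun q => gam q c a b) (pt rho x) - pd (tg b) (fun q => gam q c a c) (pt rho x)
    + \sum_e (gam (pt rho x) c c e * gam (pt rho x) e a b
       - gam (pt rho x) c b e * gam (pt rho x) e a c)).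
Proof.
rewrite mxE; apply: eq_bigr => c _; rewrite -!(pd_slice (fun q => gam q _ _ _)).
have F u v w : (fun y => christoffel (fun y0 => h (pt rho y0)) y u v w) =
    (fun y => gam (pt rho y) u v w).
  by apply: funext => y; exact: slice_christoffel.
rewrite !F; congr (_ + _); apply: eq_bigr => e _.
by rewrite !slice_christoffel.
Qed.

(** The contracted index is split. Its tangential values give the Ricci tensor of the slice and the
    terms of [S2], its radial value gives [E1], [E2] and [S1]. The terms with d_rho N and with the
    product d_a N d_b N cancel between the derivatives and the radial-radial product. *)
Lemma ricci_tangential p a b : U p ->
  ricci g p (tg a) (tg b) = ricci (fun y => h (pt (radius p) y)) (tail p) a b
    - ((N p)^-1 * dextK p a b + (N p)^-1 * hessN p a b + \tr (mixK p) * extK p a b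
       - 2 * (extK p *m invmx (h p) *m extK p) a b).
Proof.
move=> Up; have n0 := N0 Up.
rewrite ricci_slice pt_radius_tail mxE sum1d.
have E1 : pd rr (fun y => christoffel g y rr (tg a) (tg b)) p =
    N p ^- 2 * pd rr N p * extK p a b - (N p)^-1 * dextK p a b.
  rewrite (pd_eq_on _ Up (fun q Uq => chr_rtt a b Uq)); apply: is_derive_pd.
  apply: is_derive_eq (is_derive_funM (is_derive_funN (is_derive_invN rr Up)) (dextK_is_derive a b Up)) _.
  by ring.
have E2 : pd (tg b) (fun y => christoffel g y rr (tg a) rr) p =
    (N p)^-1 * pd (tg b) (pd (tg a) N) p - N p ^- 2 * pd (tg b) N p * pd (tg a) N p.
  rewrite (pd_eq_on _ Up (fun q Uq => chr_rtr a Uq)); apply: is_derive_pd.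
  apply: is_derive_eq (is_derive_funM (is_derive_invN (tg b) Up) (derivable_pd (@ddN p (tg a) (tg b) Up))) _.
  by ring.
have KK : (extK p *m invmx (h p) *m extK p) b a = (extK p *m invmx (h p) *m extK p) a b.
  have X : (extK p *m invmx (h p) *m extK p)^T = extK p *m invmx (h p) *m extK p.
    by rewrite !trmx_mul extK_sym// invh_sym// mulmxA.
  by rewrite -{1}X mxE.
have S1 : \sum_e (christoffel g p rr rr (tg e) * christoffel g p (tg e) (tg a) (tg b)
    - christoffel g p rr (tg b) (tg e) * christoffel g p (tg e) (tg a) rr) =
    (N p)^-1 * \sum_c gam p c a b * pd (tg c) N p
    + (extK p *m invmx (h p) *m extK p) b a.
  rewrite -mulmxA [X in _ + X]mxE mulr_sumr -big_split; apply: eq_bigr => e _ /=.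
  by rewrite !chrE// -/(mixK p); field.
have S2 : \sum_c (pd (tg c) (fun y => christoffel g y (tg c) (tg a) (tg b)) p
      - pd (tg b) (fun y => christoffel g y (tg c) (tg a) (tg c)) p
      + \sum_i (christoffel g p (tg c) (tg c) i * christoffel g p i (tg a) (tg b)
         - christoffel g p (tg c) (tg b) i * christoffel g p i (tg a) (tg c))) =
    \sum_c (pd (tg c) (fun q => gam q c a b) p - pd (tg b) (fun q => gam q c a c) p
      + \sum_e (gam p c c e * gam p e a b - gam p c b e * gam p e a c))
    + (- \tr (mixK p) * extK p a b + (extK p *m invmx (h p) *m extK p) a b).
  rewrite -mulmxA [X in _ + (_ + X)]mxE mulNr mulr_suml -sumrN -!big_split.
  apply: eq_bigr => c _ /=; rewrite sum1d !chrE//.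
  rewrite (pd_eq_on _ Up (fun q Uq => chr_ttt c a b Uq)).
  rewrite (pd_eq_on _ Up (fun q Uq => chr_ttt c a c Uq)).
  rewrite (_ : \sum_e (christoffel g p (tg c) (tg c) (tg e) * _ - _) =
      \sum_e (gam p c c e * gam p e a b - gam p c b e * gam p e a c)); last first.
    by apply: eq_bigr => e _; rewrite !chrE.
  by rewrite -/(mixK p); field.
rewrite E1 E2 sum1d S1 S2 !chrE// KK hessNE.
move: (\sum_c _) (\sum_c _) (dextK p a b) => u w z; by field.
Qed.

(** The radial derivative of h^-1 is - h^-1 (2 N K) h^-1, which accounts for the quadratic term. *)
Lemma dmixK_trace p : U p ->
  is_derive p (dirv rr) (fun q => \tr (mixK q))
    (\tr (invmx (h p) *m dextK p) - 2 * N p * \tr (mixK p *m mixK p)).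
Proof.
move=> Up.
pose D := (- (invmx (h p) *m dmx rr p *m invmx (h p))) *m extK p + invmx (h p) *m dextK p.
have HD c : is_derive p (dirv rr) (fun q => mixK q c c) (D c c).
  rewrite (_ : (fun q => _) = fun q => \sum_e invmx (h q) c e * extK q e c); last first.
    by apply: funext => q; rewrite mxE.
  rewrite /D !mxE -big_split; apply: is_derive_funsum => e.
  apply: is_derive_eq (is_derive_funM (invh_is_derive rr Up c e) (dextK_is_derive e c Up)) _.
  by rewrite [X in _ = X * _ + _]mxE.
apply: is_derive_eq (is_derive_funsum _ HD) _.
rewrite -[LHS]/(\tr D) /D dmx_rr// /mixK.
move: (extK p) (dextK p) (invmx (h p)) => K K' Hi.
rewrite mxtraceD addrC mulNmx -scalemxAr -!scalemxAl !linearN linearZ /=.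
by rewrite !mulmxA.
Qed.

Lemma ricci_radial p : U p -> ricci g p rr rr =
  - N p * (\tr (invmx (h p) *m hessN p) + \tr (invmx (h p) *m dextK p)
           - N p * \tr (mixK p *m mixK p)).
Proof.
move=> Up; have n0 := N0 Up.
rewrite mxE sum1d subrr add0r sum1d.
have S0 : \sum_(e < d) (christoffel g p rr rr (tg e) * christoffel g p (tg e) rr rr
    - christoffel g p rr rr (tg e) * christoffel g p (tg e) rr rr) = 0.
  by rewrite big1// => e _; rewrite subrr.
rewrite S0 subrr !add0r.
have HT : \sum_c pd rr (fun y => christoffel g y (tg c) rr (tg c)) p =
    pd rr N p * \tr (mixK p) + N p * (\tr (invmx (h p) *m dextK p)
      - 2 * N p * \tr (mixK p *m mixK p)).
  have H1 : is_derive p (dirv rr) (fun q => N q * \tr (mixK q))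
      (pd rr N p * \tr (mixK p) + N p * (\tr (invmx (h p) *m dextK p)
      - 2 * N p * \tr (mixK p *m mixK p))).
    exact: is_derive_funM (derivable_pd (@dN p rr Up)) (dmixK_trace Up).
  rewrite -(is_derive_pd H1).
  have DM c : derivable (fun q => mixK q c c) p (dirv rr).
    rewrite (_ : (fun q => _) = fun q => \sum_e invmx (h q) c e * extK q e c); last first.
      by apply: funext => q; rewrite mxE.
    have HM e : derivable (fun q => invmx (h q) c e * extK q e c) p (dirv rr).
      by case: (is_derive_funM (invh_is_derive rr Up c e) (dextK_is_derive e c Up)).
    by case: (is_derive_funsum (index_enum 'I_d) (fun e => derivableP (HM e))).
  have H2 c : is_derive p (dirv rr) (fun q => N q * mixK q c c)
      (pd rr (fun y => christoffel g y (tg c) rr (tg c)) p).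
    rewrite (pd_eq_on _ Up (fun q Uq => chr_trt c c Uq)); apply: derivable_pd.
    by case: (is_derive_funM (derivable_pd (@dN p rr Up)) (derivable_pd (DM c))).
  have H3 := is_derive_funsum (index_enum 'I_d) H2.
  rewrite -(is_derive_pd H3); congr (pd _ _ _); apply: funext => q.
  by rewrite /mxtrace mulr_sumr.
have HX c : pd (tg c) (fun y => christoffel g y (tg c) rr rr) p =
    - pd (tg c) N p * (\sum_e invmx (h p) c e * pd (tg e) N p)
    - N p * (\sum_e (- (invmx (h p) *m dmx (tg c) p *m invmx (h p)) c e * pd (tg e) N p
                    + invmx (h p) c e * pd (tg c) (pd (tg e) N) p)).
  rewrite (pd_eq_on _ Up (fun q Uq => chr_trr c Uq)); apply: is_derive_pd.
  have H e : is_derive p (dirv (tg c)) (fun q => invmx (h q) c e * pd (tg e) N q)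
     (- (invmx (h p) *m dmx (tg c) p *m invmx (h p)) c e * pd (tg e) N p
                    + invmx (h p) c e * pd (tg c) (pd (tg e) N) p).
    exact: is_derive_funM (invh_is_derive (tg c) Up c e) (derivable_pd (@ddN p (tg e) (tg c) Up)).
  apply: is_derive_eq (is_derive_funM (is_derive_funN (derivable_pd (@dN p (tg c) Up)))
    (is_derive_funsum (index_enum 'I_d) H)) _.
  by rewrite (mulNr (N p)).
pose V c := \sum_e invmx (h p) c e * pd (tg e) N p.
have HG : \sum_c \sum_i (christoffel g p (tg c) (tg c) i * christoffel g p i rr rr
      - christoffel g p (tg c) rr i * christoffel g p i rr (tg c)) =
    \tr (mixK p) * pd rr N p + \sum_c pd (tg c) N p * V c
    - N p * (\sum_c \sum_e gam p c c e * V e) - N p ^+ 2 * \tr (mixK p *m mixK p).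
  rewrite /mxtrace mulr_suml !mulr_sumr -!sumrN -!big_split; apply: eq_bigr => c _ /=.
  rewrite sum1d !chrE// -/(V c).
  rewrite (_ : \sum_e (christoffel g p (tg c) (tg c) (tg e) * _ - _) =
      \sum_e (gam p c c e * (- N p * V e) - N p * mixK p c e * (N p * mixK p e c))); last first.
    by apply: eq_bigr => e _; rewrite !chrE.
  rewrite (_ : \sum_e (_ - _) = - N p * (\sum_e gam p c c e * V e)
      - N p ^+ 2 * (mixK p *m mixK p) c c); last first.
    rewrite (mxE _ _ c c) !mulr_sumr -sumrN -big_split; apply: eq_bigr => e _ /=.
    by ring.
  by move: (\sum_e gam p c c e * V e) => w; field.
transitivity (\sum_c pd (tg c) (fun y => christoffel g y (tg c) rr rr) p
  - (pd rr N p * \tr (mixK p) + N p * (\tr (invmx (h p) *m dextK p)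
      - 2 * N p * \tr (mixK p *m mixK p)))
  + (\tr (mixK p) * pd rr N p + \sum_c pd (tg c) N p * V c
    - N p * (\sum_c \sum_e gam p c c e * V e) - N p ^+ 2 * \tr (mixK p *m mixK p))).
  by rewrite big_split sumrB; congr (_ - _ + _); [exact: HT|exact: HG].
rewrite (eq_bigr _ (fun c _ => HX c)) /=.
pose B1 := \sum_c \sum_e (- (invmx (h p) *m dmx (tg c) p *m invmx (h p)) c e * pd (tg e) N p).
pose B2 := \sum_c \sum_e invmx (h p) c e * pd (tg c) (pd (tg e) N) p.
pose B3 := \sum_c \sum_e gam p c c e * V e.
pose B4 := \sum_c \sum_e invmx (h p) c e * \sum_f gam p f c e * pd (tg f) N p.
rewrite (_ : \sum_c (_ - _) = - (\sum_c pd (tg c) N p * V c) - N p * (B1 + B2)); last first.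
  rewrite /B1 /B2 -big_split mulr_sumr -[X in _ = X - _]sumrN -sumrB.
  by apply: eq_bigr => c _ /=; rewrite mulNr big_split.
(* The derivatives of h^-1 and the contracted Christoffel symbols combine into the connection term
   of the Laplacian, so that together with [B2] they form the trace of the covariant Hessian of
   [N]. *)
have HL : B1 + B3 = - B4.
  exact: (@laplacian_divergence R d (invmx (h p)) (fun c => dmx (tg c) p)
    (fun c => pd (tg c) N p) (invh_sym Up) (fun c => dmx_sym (tg c) Up)).
have -> : \tr (invmx (h p) *m hessN p) = B2 - B4.
  rewrite /mxtrace /B2 /B4 -sumrB; apply: eq_bigr => c _; rewrite mxE -sumrB.
  apply: eq_bigr => e _; rewrite hessNE mulrBr; congr (_ - _ * _).
  apply: eq_bigr => f _; congr (_ * _); rewrite /gam; congr (_ * _).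
  apply: eq_bigr => i _; congr (_ * (_ - _)); first by rewrite addrC.
  by rewrite -{1}(dmx_sym (tg i) Up) mxE.
rewrite -[B3]/(\sum_c \sum_e gam p c c e * V e) in HL *.
rewrite (_ : \sum_c \sum_e gam p c c e * V e = - B4 - B1); last by rewrite -HL addrC addKr.
clear HL B3 HG; clearbody B1 B2 B4.
move: (\sum_c pd (tg c) N p * V c) (\tr (mixK p)) (\tr (mixK p *m mixK p))
  (\tr (invmx (h p) *m dextK p)) (pd rr N p) => u1 u2 u3 u4 u5.
by ring.
Qed.

Theorem adm_ricci_tangential p : U p -> ricci g p = 0 ->
  ricci (fun y => h (pt (radius p) y)) (tail p) =
  (N p)^-1 *: dextK p + (N p)^-1 *: hessN p
  + \tr (invmx (h p) *m extK p) *: extK p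
  - 2 *: (extK p *m invmx (h p) *m extK p).
Proof.
move=> Up R0; apply/matrixP => a b.
have := ricci_tangential a b Up; rewrite R0 mxE => /eqP; rewrite eq_sym subr_eq0 => /eqP ->.
by rewrite /mixK !mxE.
Qed.

(** The radial equation expresses tr D D N + tr d_rho K by tr K^2. Inserted into the trace of the
    evolution equation it removes both terms and turns - 2 tr K^2 into - tr K^2. *)
Theorem hamiltonian_constraint p : U p -> ricci g p = 0 ->
  \tr (invmx (h p) *m ricci (fun y => h (pt (radius p) y)) (tail p)) =
  \tr (invmx (h p) *m extK p) ^+ 2
  - \tr (invmx (h p) *m extK p *m (invmx (h p) *m extK p)).
Proof.
move=> Up R0; have n0 := N0 Up.
have := ricci_radial Up; rewrite R0 mxE => /eqP; rewrite eq_sym mulf_eq0 oppr_eq0 (negbTE n0) /=.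
rewrite subr_eq0 => /eqP E.
rewrite adm_ricci_tangential//; move: E; rewrite /mixK.
move: (extK p) (dextK p) (hessN p) (invmx (h p)) => K K' S Hi E.
have {}E : \tr (Hi *m S) = N p * \tr (Hi *m K *m (Hi *m K)) - \tr (Hi *m K').
  by rewrite -E addrK.
rewrite !mulmxDr mulmxN -!scalemxAr !mxtraceD linearN !linearZ /= E !mulmxA /GRing.scale /=.
by field.
Qed.

End ADMDecomposition.

(** * Asymptotics in the frame *)

Section UniformAsymptotics.
Context {R : realType} {X : Type} (dom : X -> Prop).
Implicit Types (z : R * X) (f g : R * X -> R) (P Q : R * X -> Prop) (m n : nat).

(** A point is a radius together with a point of the domain, and the threshold is uniform in the
    latter. It is at least 1 so that powers of 1 / rho decrease in the exponent, as [bigO_weak]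
    needs. *)
Definition eventually_on P := exists2 r1 : R, 1 <= r1 &
  forall z, r1 < z.1 -> dom z.2 -> P z.

Definition bigO m f := exists C : R, eventually_on (fun z => `|f z| <= C * z.1 ^- m).

Lemma ev_and P Q : eventually_on P -> eventually_on Q ->
  eventually_on (fun z => P z /\ Q z).
Proof.
move=> [r1 r1P H1] [r2 r2P H2]; exists (Num.max r1 r2).
  by rewrite le_max r1P.
by move=> z; rewrite gt_max => /andP[z1 z2] zd; split; [exact: H1|exact: H2].
Qed.

Lemma ev_imp P Q : eventually_on P ->
  (forall z, 1 < z.1 -> dom z.2 -> P z -> Q z) -> eventually_on Q.
Proof.
move=> [r1 r1P H] I; exists r1 => // z zr zd; apply: I => //; last exact: H.
exact: le_lt_trans zr.
Qed.

Lemma ev_all P : (forall z, 1 < z.1 -> dom z.2 -> P z) -> eventually_on P.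
Proof. by move=> H; exists 1 => // z; exact: H. Qed.

Lemma bigO_eq m f g : eventually_on (fun z => f z = g z) -> bigO m g -> bigO m f.
Proof.
by move=> E [C H]; exists C; apply: ev_imp (ev_and E H) _ => z _ _ [->].
Qed.

Lemma bigO_ext m f g : (forall z, f z = g z) -> bigO m g -> bigO m f.
Proof. by move=> E; apply: bigO_eq; apply: ev_all => z _ _. Qed.

Lemma bigO_add m f g : bigO m f -> bigO m g -> bigO m (fun z => f z + g z).
Proof.
move=> [C H] [D I]; exists (C + D); apply: ev_imp (ev_and H I) _ => z _ _ [h i].
by rewrite mulrDl (le_trans (ler_normD _ _))// lerD.
Qed.

Lemma bigO_mul m n f g : bigO m f -> bigO n g -> bigO (m + n) (fun z => f z * g z).
Proof.
move=> [C H] [D I]; exists (C * D); apply: ev_imp (ev_and H I) _ => z z1 _ [h i].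
rewrite normrM; apply: le_trans (ler_pM _ _ h i) _ => //.
by rewrite exprD invfM mulrACA.
Qed.

Lemma bigO_weak m n f : (m <= n)%N -> bigO n f -> bigO m f.
Proof.
move=> mn [C H]; exists `|C|; apply: ev_imp H _ => z z1 _ h; apply: le_trans h _.
have z0 : 0 < z.1 by apply: lt_trans z1.
apply: le_trans (_ : `|C| * z.1 ^- n <= _).
  by rewrite ler_wpM2r ?ler_norm// invr_ge0 exprn_ge0// ltW.
rewrite ler_wpM2l// lef_pV2 ?posrE ?exprn_gt0//.
by apply: ler_weXn2l => //; exact: ltW.
Qed.

Lemma bigO_cst (c : R) : bigO 0 (fun=> c).
Proof. by exists `|c|; apply: ev_all => z _ _; rewrite expr0 invr1 mulr1. Qed.

Lemma bigO_bounded (C : R) f : (forall z, dom z.2 -> `|f z| <= C) -> bigO 0 f.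
Proof. by move=> H; exists C; apply: ev_all => z _ zd; rewrite expr0 invr1 mulr1 H. Qed.

Lemma bigO_opp m f : bigO m f -> bigO m (fun z => - f z).
Proof. by move=> [C H]; exists C; apply: ev_imp H _ => z _ _; rewrite normrN. Qed.

Lemma bigO_sub m f g : bigO m f -> bigO m g -> bigO m (fun z => f z - g z).
Proof. by move=> Hf Hg; apply: bigO_add => //; exact: bigO_opp. Qed.

Lemma bigO_0 m : bigO m (fun=> 0).
Proof. by exists 0; apply: ev_all => z _ _; rewrite normr0 mul0r. Qed.

Lemma bigO_sum I (r : seq I) m (F : I -> R * X -> R) :
  (forall i, bigO m (F i)) -> bigO m (fun z => \sum_(i <- r) F i z).
Proof.
move=> H; elim: r => [|i r IH].
  by apply: bigO_ext (bigO_0 m) => z; rewrite big_nil.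
by apply: bigO_ext (bigO_add (H i) IH) => z; rewrite big_cons.
Qed.

Definition inv_radius z : R := z.1^-1.
Notation u := inv_radius.

Lemma bigO_u : bigO 1 u.
Proof.
exists 1; apply: ev_all => z z1 _; rewrite mul1r expr1 ger0_norm// invr_ge0.
by apply: ltW; exact: lt_trans z1.
Qed.

Lemma bigO_uX m : bigO m (fun z => u z ^+ m).
Proof.
exists 1; apply: ev_all => z z1 _; rewrite mul1r -exprVn ger0_norm// exprn_ge0// invr_ge0.
by apply: ltW; exact: lt_trans z1.
Qed.

Lemma bigO_inv (c : R) f : 0 < c -> eventually_on (fun z => c <= `|f z|) ->
  bigO 0 (fun z => (f z)^-1).
Proof.
move=> c0 H; exists c^-1; apply: ev_imp H _ => z _ _ h.
rewrite expr0 invr1 mulr1 normfV lef_pV2 ?posrE//.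
exact: lt_le_trans c0 h.
Qed.

Lemma bigO1_small (c : R) f : 0 < c -> bigO 1 f -> eventually_on (fun z => `|f z| <= c).
Proof.
move=> c0 [C [r1 r1P H]]; exists (Num.max r1 (`|C| / c)); first by rewrite le_max r1P.
move=> z; rewrite gt_max => /andP[z1 z2] zd; apply: le_trans (H z z1 zd) _.
have z0 : 0 < z.1 by apply: lt_trans z1; exact: lt_le_trans r1P.
rewrite expr1 ler_pdivrMr//; apply: le_trans (ler_norm C) _.
by rewrite mulrC -ler_pdivrMr// ltW.
Qed.

(** An expansion f0 + f1 / rho + O(rho^-2). The coefficients may be any bounded functions, even of
    the radius, so that they can be rewritten by equalities that hold only eventually
    ([ex1_evext]). *)
Definition ex1 f f0 f1 :=
  [/\ bigO 0 f0, bigO 0 f1 & bigO 2 (fun z => f z - f0 z - u z * f1 z)].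

Lemma ex1_bigO f f0 f1 : ex1 f f0 f1 -> bigO 0 f.
Proof.
move=> [H0 H1 H]; have H' := bigO_weak (isT : (0 <= 2)%N) H.
have H1' := bigO_weak (isT : (0 <= 1)%N) (bigO_mul bigO_u H1).
by apply: bigO_ext (bigO_add H' (bigO_add H0 H1')) => z; ring.
Qed.

Lemma ex1_sub0 f f0 f1 : ex1 f f0 f1 -> bigO 1 (fun z => f z - f0 z).
Proof.
move=> [H0 H1 H]; have H' := bigO_weak (isT : (1 <= 2)%N) H.
have H1' := bigO_mul bigO_u H1.
by apply: bigO_ext (bigO_add H' H1') => z; ring.
Qed.

Lemma ex1_eq f g f0 f1 : eventually_on (fun z => f z = g z) -> ex1 g f0 f1 -> ex1 f f0 f1.
Proof.
move=> E [H0 H1 H]; split=> //; apply: bigO_eq H.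
by apply: ev_imp E _ => z _ _ ->.
Qed.

Lemma ex1_ext f f0 f1 g0 g1 : (forall z, f0 z = g0 z) -> (forall z, f1 z = g1 z) ->
  ex1 f g0 g1 -> ex1 f f0 f1.
Proof.
move=> E0 E1 [H0 H1 H]; split; [exact: bigO_ext E0 H0|exact: bigO_ext E1 H1|].
by apply: bigO_ext H => z; rewrite E0 E1.
Qed.

Lemma ex1_const f : bigO 0 f -> ex1 f f (fun=> 0).
Proof.
move=> H; split=> //; first exact: bigO_cst.
by apply: bigO_ext (bigO_0 2) => z; rewrite mulr0; ring.
Qed.

Lemma ex1_u f : bigO 0 f -> ex1 (fun z => u z * f z) (fun=> 0) f.
Proof.
move=> H; split=> //; first exact: bigO_cst.
by apply: bigO_ext (bigO_0 2) => z; ring.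
Qed.

Lemma ex1_O2 f : bigO 2 f -> ex1 f (fun=> 0) (fun=> 0).
Proof.
by move=> H; split; [exact: bigO_cst|exact: bigO_cst|apply: bigO_ext H => z; ring].
Qed.

Lemma ex1_add f f0 f1 g g0 g1 : ex1 f f0 f1 -> ex1 g g0 g1 ->
  ex1 (fun z => f z + g z) (fun z => f0 z + g0 z) (fun z => f1 z + g1 z).
Proof.
move=> [H0 H1 H] [I0 I1 I]; split; [exact: bigO_add|exact: bigO_add|].
by apply: bigO_ext (bigO_add H I) => z; ring.
Qed.

Lemma ex1_mul f f0 f1 g g0 g1 : ex1 f f0 f1 -> ex1 g g0 g1 ->
  ex1 (fun z => f z * g z) (fun z => f0 z * g0 z)
      (fun z => f0 z * g1 z + f1 z * g0 z).
Proof.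
move=> Hf Hg; have Og := ex1_bigO Hg.
case: Hf Hg => [H0 H1 H] [I0 I1 I]; split.
- exact: bigO_mul H0 I0.
- by apply: bigO_add; [exact: bigO_mul H0 I1|exact: bigO_mul H1 I0].
have A : bigO 2 (fun z => (f z - f0 z - u z * f1 z) * g z) := bigO_mul H Og.
have H01 : bigO 0 (fun z => f0 z + u z * f1 z).
  by apply: bigO_add => //; apply: bigO_weak (bigO_mul bigO_u H1).
have B : bigO 2 (fun z => (f0 z + u z * f1 z) * (g z - g0 z - u z * g1 z)).
  exact: bigO_mul H01 I.
have C : bigO 2 (fun z => (u z * f1 z) * (u z * g1 z)).
  exact: bigO_mul (bigO_mul bigO_u H1) (bigO_mul bigO_u I1).
by apply: bigO_ext (bigO_add A (bigO_add B C)) => z; ring.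
Qed.

Lemma ex1_sum I (r : seq I) (F F0 F1 : I -> R * X -> R) :
  (forall i, ex1 (F i) (F0 i) (F1 i)) ->
  ex1 (fun z => \sum_(i <- r) F i z) (fun z => \sum_(i <- r) F0 i z)
      (fun z => \sum_(i <- r) F1 i z).
Proof.
move=> H; split; [by apply: bigO_sum => i; case: (H i)|by apply: bigO_sum => i; case: (H i)|].
apply: (bigO_ext (g := fun z => \sum_(i <- r) (F i z - F0 i z - u z * F1 i z))).
  by move=> z; rewrite mulr_sumr -!sumrB.
by apply: bigO_sum => i; case: (H i).
Qed.

Definition mxO a b m (A : R * X -> 'M[R]_(a, b)) := forall i j, bigO m (fun z => A z i j).
Definition mex1 a b (A A0 A1 : R * X -> 'M[R]_(a, b)) :=
  forall i j, ex1 (fun z => A z i j) (fun z => A0 z i j) (fun z => A1 z i j).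

Lemma mxO_mul a b c m n (A : R * X -> 'M[R]_(a, b)) (B : R * X -> 'M[R]_(b, c)) :
  mxO m A -> mxO n B -> mxO (m + n) (fun z => A z *m B z).
Proof.
move=> HA HB i j; apply: (bigO_ext (g := fun z => \sum_k A z i k * B z k j)).
  by move=> z; rewrite mxE.
by apply: bigO_sum => k; exact: bigO_mul.
Qed.

Lemma mxO_ext a b m (A B : R * X -> 'M[R]_(a, b)) : (forall z, A z = B z) ->
  mxO m B -> mxO m A.
Proof. by move=> E H i j; apply: bigO_ext (H i j) => z; rewrite E. Qed.

Lemma mxO_eq a b m (A B : R * X -> 'M[R]_(a, b)) :
  eventually_on (fun z => A z = B z) -> mxO m B -> mxO m A.
Proof. by move=> E H i j; apply: bigO_eq (H i j); apply: ev_imp E _ => z _ _ ->. Qed.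

Lemma mxO_add a b m (A B : R * X -> 'M[R]_(a, b)) :
  mxO m A -> mxO m B -> mxO m (fun z => A z + B z).
Proof.
by move=> HA HB i j; apply: bigO_ext (bigO_add (HA i j) (HB i j)) => z; rewrite mxE.
Qed.

Lemma mxO_scale a b m n f (A : R * X -> 'M[R]_(a, b)) :
  bigO m f -> mxO n A -> mxO (m + n) (fun z => f z *: A z).
Proof.
by move=> Hf HA i j; apply: bigO_ext (bigO_mul Hf (HA i j)) => z; rewrite mxE.
Qed.

Lemma mxO_opp a b m (A : R * X -> 'M[R]_(a, b)) : mxO m A -> mxO m (fun z => - A z).
Proof. by move=> HA i j; apply: bigO_ext (bigO_opp (HA i j)) => z; rewrite mxE. Qed.

Lemma mxO_sub a b m (A B : R * X -> 'M[R]_(a, b)) :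
  mxO m A -> mxO m B -> mxO m (fun z => A z - B z).
Proof. by move=> HA HB; apply: mxO_add => //; exact: mxO_opp. Qed.

Lemma mxO_tr a m (A : R * X -> 'M[R]_a) : mxO m A -> bigO m (fun z => \tr (A z)).
Proof. by move=> H; apply: bigO_sum => i; exact: H. Qed.

Lemma mxO_trmx a b m (A : R * X -> 'M[R]_(a, b)) : mxO m A -> mxO m (fun z => (A z)^T).
Proof. by move=> H i j; apply: bigO_ext (H j i) => z; rewrite mxE. Qed.

Lemma mxO_weak a b m n (A : R * X -> 'M[R]_(a, b)) : (m <= n)%N -> mxO n A -> mxO m A.
Proof. by move=> mn H i j; exact: bigO_weak (H i j). Qed.

Lemma mxO_cst a b (A : 'M[R]_(a, b)) : mxO 0 (fun=> A).
Proof. by move=> i j; exact: bigO_cst. Qed.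

Lemma mex1_bigO a b (A A0 A1 : R * X -> 'M[R]_(a, b)) : mex1 A A0 A1 -> mxO 0 A.
Proof. by move=> H i j; exact: ex1_bigO (H i j). Qed.

Lemma mex1_mul a b c (A A0 A1 : R * X -> 'M[R]_(a, b)) (B B0 B1 : R * X -> 'M[R]_(b, c)) :
  mex1 A A0 A1 -> mex1 B B0 B1 ->
  mex1 (fun z => A z *m B z) (fun z => A0 z *m B0 z) (fun z => A0 z *m B1 z + A1 z *m B0 z).
Proof.
move=> HA HB i j.
have H := ex1_sum (index_enum 'I_b) (fun k => ex1_mul (HA i k) (HB k j)).
apply: ex1_eq (ex1_ext _ _ H).
- by apply: ev_all => z _ _; rewrite mxE.
- by move=> z; rewrite mxE.
- by move=> z; rewrite !mxE -big_split.
Qed.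

Lemma mex1_add a b (A A0 A1 B B0 B1 : R * X -> 'M[R]_(a, b)) :
  mex1 A A0 A1 -> mex1 B B0 B1 ->
  mex1 (fun z => A z + B z) (fun z => A0 z + B0 z) (fun z => A1 z + B1 z).
Proof.
move=> HA HB i j; apply: ex1_eq (ex1_ext _ _ (ex1_add (HA i j) (HB i j))).
- by apply: ev_all => z _ _; rewrite mxE.
- by move=> z; rewrite mxE.
- by move=> z; rewrite mxE.
Qed.

Lemma mex1_scale a b f f0 f1 (A A0 A1 : R * X -> 'M[R]_(a, b)) :
  ex1 f f0 f1 -> mex1 A A0 A1 ->
  mex1 (fun z => f z *: A z) (fun z => f0 z *: A0 z) (fun z => f0 z *: A1 z + f1 z *: A0 z).
Proof.
move=> Hf HA i j; apply: ex1_eq (ex1_ext _ _ (ex1_mul Hf (HA i j))).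
- by apply: ev_all => z _ _; rewrite mxE.
- by move=> z; rewrite mxE.
- by move=> z; rewrite !mxE.
Qed.

Lemma mex1_tr a (A A0 A1 : R * X -> 'M[R]_a) : mex1 A A0 A1 ->
  ex1 (fun z => \tr (A z)) (fun z => \tr (A0 z)) (fun z => \tr (A1 z)).
Proof. by move=> H; apply: ex1_sum => i; exact: H. Qed.

Lemma mex1_const a b (A : R * X -> 'M[R]_(a, b)) : mxO 0 A -> mex1 A A (fun=> 0).
Proof.
move=> H i j; apply: ex1_ext (ex1_const (H i j)) => z //.
by rewrite mxE.
Qed.

Lemma mex1_u a b (A : R * X -> 'M[R]_(a, b)) : mxO 0 A ->
  mex1 (fun z => u z *: A z) (fun=> 0) A.
Proof.
move=> H i j; apply: ex1_eq (ex1_ext _ _ (ex1_u (H i j))).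
- by apply: ev_all => z _ _; rewrite mxE.
- by move=> z; rewrite mxE.
- by [].
Qed.

Lemma mex1_O2 a b (A : R * X -> 'M[R]_(a, b)) : mxO 2 A -> mex1 A (fun=> 0) (fun=> 0).
Proof. by move=> H i j; apply: ex1_ext (ex1_O2 (H i j)) => z; rewrite mxE. Qed.

Lemma mex1_eq a b (A B A0 A1 : R * X -> 'M[R]_(a, b)) :
  eventually_on (fun z => A z = B z) -> mex1 B A0 A1 -> mex1 A A0 A1.
Proof. by move=> E H i j; apply: ex1_eq (H i j); apply: ev_imp E _ => z _ _ ->. Qed.

Lemma mex1_ext a b (A A0 A1 B0 B1 : R * X -> 'M[R]_(a, b)) :
  (forall z, A0 z = B0 z) -> (forall z, A1 z = B1 z) -> mex1 A B0 B1 -> mex1 A A0 A1.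
Proof. by move=> E0 E1 H i j; apply: ex1_ext (H i j) => z; rewrite ?E0 ?E1. Qed.

Lemma mex1_rem a b (A A0 A1 : R * X -> 'M[R]_(a, b)) : mex1 A A0 A1 ->
  mxO 2 (fun z => A z - A0 z - u z *: A1 z).
Proof. by move=> H i j; case: (H i j) => _ _; apply: bigO_ext => z; rewrite !mxE. Qed.

Lemma mex1_intro a b (A A0 A1 : R * X -> 'M[R]_(a, b)) : mxO 0 A0 -> mxO 0 A1 ->
  mxO 2 (fun z => A z - A0 z - u z *: A1 z) -> mex1 A A0 A1.
Proof. by move=> H0 H1 H i j; split=> //; apply: bigO_ext (H i j) => z; rewrite !mxE. Qed.

(** To bring a difference of determinants under [closed_det], both matrices are made values of one
    function with a boolean argument; boundedness of both values and an O(1 / rho) difference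
    survive sums and products. *)
Lemma det_bigO1 a (A B : R * X -> 'M[R]_a) : mxO 0 A -> mxO 0 B ->
  mxO 1 (fun z => A z - B z) -> bigO 1 (fun z => \det (A z) - \det (B z)).
Proof.
move=> HA HB HAB.
pose Pr (f : (R * X) * bool -> R) := [/\ bigO 0 (fun z => f (z, true)),
  bigO 0 (fun z => f (z, false)) & bigO 1 (fun z => f (z, true) - f (z, false))].
have [_ _] : Pr (fun w => \det (if w.2 then A w.1 else B w.1)); last by [].
apply: closed_det.
- move=> c; split; [exact: bigO_cst|exact: bigO_cst|].
  by apply: bigO_ext (bigO_0 1) => z; rewrite subrr.
- move=> f g [f1 f2 f3] [g1 g2 g3]; split; [exact: bigO_add|exact: bigO_add|].
  by apply: bigO_ext (bigO_add f3 g3) => z; ring.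
- move=> f g [f1 f2 f3] [g1 g2 g3]; split; [exact: bigO_mul f1 g1|exact: bigO_mul f2 g2|].
  apply: (bigO_ext (g := fun z => (f (z, true) - f (z, false)) * g (z, true)
     + f (z, false) * (g (z, true) - g (z, false)))).
    by move=> z; ring.
  by apply: bigO_add; [exact: bigO_mul f3 g1|exact: bigO_mul f2 g3].
- move=> i j; split; [exact: HA|exact: HB|].
  by apply: bigO_ext (HAB i j) => z; rewrite !mxE.
Qed.

Lemma invmx_bigO a (A : R * X -> 'M[R]_a) (c : R) : 0 < c -> mxO 0 A ->
  eventually_on (fun z => c <= `|\det (A z)|) -> mxO 0 (fun z => invmx (A z)).
Proof.
move=> c0 HA Hd i j.
apply: (bigO_eq (g := fun z => (\det (A z))^-1 * (\adj (A z)) i j)).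
  apply: ev_imp Hd _ => z _ _ dA; have dn : \det (A z) != 0.
    by rewrite -normr_gt0 (lt_le_trans c0).
  by rewrite /invmx unitmxE unitfE dn mxE.
have Hadj : bigO 0 (fun z => (\adj (A z)) i j).
  apply: (closed_adj (Pr := bigO 0)) => //.
  - exact: bigO_cst.
  - by move=> f g; exact: bigO_add.
  - by move=> f g Hf Hg; exact: bigO_mul Hf Hg.
exact: bigO_mul (bigO_inv c0 Hd) Hadj.
Qed.

End UniformAsymptotics.

(** * The finite boundary density from abstract frame data *)

Section FrameAsymptotics.
Context {R : realType} {X : Type} (dom : X -> Prop).
Implicit Types (z : R * X) (f g : R * X -> R).

Notation bigO := (@bigO R X dom).
Notation mxO := (@mxO R X dom _ _).
Notation ex1 := (@ex1 R X dom).
Notation mex1 := (@mex1 R X dom _ _).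
Notation ev := (@eventually_on R X dom).
Notation u := (@inv_radius R X).
Notation eta := (@eta R).

Lemma eta_eta : eta *m eta = 1%:M.
Proof.
apply/matrixP => a b; rewrite /eta mul_diag_mx !mxE.
by move: a; apply: ord3P; move: b; apply: ord3P; rewrite /= ?mulr1n ?mulr0n ?mulr0 ?mulr1 ?mulrNN ?mulr1.
Qed.

Lemma det_eta : \det eta = -1.
Proof.
rewrite /eta det_diag !big_ord_recr big_ord0 /= !mxE /=; by ring.
Qed.

Lemma ex1_evext f f0 f1 g0 g1 : ev (fun z => f0 z = g0 z) -> ev (fun z => f1 z = g1 z) ->
  ex1 f g0 g1 -> ex1 f f0 f1.
Proof.
move=> E0 E1 [H0 H1 H]; split; [exact: bigO_eq E0 H0|exact: bigO_eq E1 H1|].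
by apply: bigO_eq H; apply: ev_imp (ev_and E0 E1) _ => z _ _ [-> ->].
Qed.

Lemma bigO_radius2 f : bigO 3 f -> bigO 1 (fun z => z.1 ^+ 2 * f z).
Proof.
move=> [C H]; exists C; apply: ev_imp H _ => z z1 _ h.
have z0 : 0 < z.1 := lt_trans ltr01 z1.
have z20 : 0 <= z.1 ^+ 2 by rewrite exprn_ge0// ltW.
rewrite normrM (ger0_norm z20); apply: le_trans (ler_wpM2l z20 h) _.
by rewrite le_eqVlt; apply/orP; left; apply/eqP; field; rewrite gt_eqF.
Qed.

(** The map X -> (tr X) X - X^2, through which [Khat] determines the Ricci tensor, linearised at the
    identity; dimension three enters by tr 1 = 3. *)
Lemma trace_square_1D (e : 'M[R]_3) :
  \tr (1%:M + e) *: (1%:M + e) - (1%:M + e) *m (1%:M + e) =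
  2%:M + \tr e *: 1%:M + e + (\tr e *: e - e *m e).
Proof.
rewrite mxtraceD mxtrace1 mulmxDl !mulmxDr !mul1mx !mulmx1.
rewrite (_ : 2%:M = 2 *: 1%:M :> 'M[R]_3); last by rewrite scale_scalar_mx mulr1.
move: (\tr e) (e *m e) (1%:M : 'M[R]_3) => t e2 w.
by apply/matrixP => i j; rewrite !mxE; ring.
Qed.

Lemma mxtraceN n (A : 'M[R]_n) : \tr (- A) = - \tr A.
Proof. exact: raddfN. Qed.

(** The squares of [a] cancel. With [a], [b] the first-order metric and the Hessian of sigma, each
    with raised index, this makes the finite density linear in [h1]. *)
Lemma trace_square_diff (a b : 'M[R]_3) (s : R) :
  \tr ((- (2^-1 *: a) - s *: 1%:M) *m (- (2^-1 *: a) - s *: 1%:M))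
  - \tr ((b - 2^-1 *: a) *m (b - 2^-1 *: a)) =
  3 * s ^+ 2 + s * \tr a + \tr (b *m a) - \tr (b *m b).
Proof.
rewrite !(mulmxDl, mulmxDr, mulNmx, mulmxN, =^~ scalemxAl, =^~ scalemxAr).
rewrite !mul1mx !mulmx1 !(mxtraceD, mxtraceN, mxtraceZ) mxtrace1 (mxtrace_mulC a b).
by move: (\tr a) (\tr (b *m a)) (\tr (a *m a)) (\tr (b *m b)) => t x y w; field.
Qed.

Lemma trace_square_O3 n (P P1 : R * X -> 'M[R]_n) : mxO 0 P1 ->
  mxO 2 (fun z => P z - u z *: P1 z) ->
  bigO 3 (fun z => \tr (P z *m P z) - u z ^+ 2 * \tr (P1 z *m P1 z)).
Proof.
move=> H1 H.
have Hu : mxO 1 (fun z => u z *: P1 z).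
  by have := mxO_scale (bigO_u dom) H1.
have HP : mxO 1 P.
  apply: mxO_ext (mxO_add (mxO_weak (isT : (1 <= 2)%N) H) Hu) => z.
  by rewrite subrK.
have A := mxO_tr (mxO_mul H HP); have B := mxO_tr (mxO_mul Hu H).
apply: bigO_ext (bigO_add A B) => z.
rewrite -mxtraceD; set Q := u z *: P1 z.
have -> : u z ^+ 2 * \tr (P1 z *m P1 z) = \tr (Q *m Q).
  by rewrite /Q -scalemxAl -scalemxAr !mxtraceZ mulrA.
rewrite -raddfB; congr (\tr _); rewrite mulmxBl mulmxBr addrA.
by rewrite subrK.
Qed.

Variables (sg : R * X -> R) (h1 S0 H G G' S GK : R * X -> 'M[R]_3).

Definition lapse z := 1 + u z * sg z.
(** d_rho h / (2 N). The h2 term of the metric is constant in rho, so only the derivative of the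
    O(rho^-3) remainder is left to [G]. *)
Definition frameK z : 'M[R]_3 := (2 * lapse z)^-1 *: ((2 * z.1) *: eta + h1 z + G z).
(** The product rule for [frameK]; the second summand comes from d_rho N = - sigma / rho^2. *)
Definition framedK z : 'M[R]_3 := (2 * lapse z)^-1 *: (2 *: eta + G' z)
  + (sg z * u z ^+ 2 / (2 * lapse z ^+ 2)) *: ((2 * z.1) *: eta + h1 z + G z).
(** The right-hand side of the evolution equation. Each inverse metric contributes rho^-2, and the
    Hessian of N is 1 / rho times that of sigma. *)
Definition frameRic z : 'M[R]_3 := (lapse z)^-1 *: framedK z
  + ((lapse z)^-1 * u z) *: S z + (u z ^+ 2 * \tr (invmx (H z) *m frameK z)) *: frameK z
  - (2 * u z ^+ 2) *: (frameK z *m invmx (H z) *m frameK z).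
Definition frameKhat z : 'M[R]_3 := z.1 *: eta + GK z.

Hypotheses (sgO : bigO 0 sg) (h1O : mxO 0 h1) (S0O : mxO 0 S0)
  (HO : mxO 2 (fun z => H z - eta - u z *: h1 z)) (GO : mxO 2 G) (G'O : mxO 3 G')
  (SO : mxO 1 (fun z => S z - S0 z)) (GKO : mxO 0 GK)
  (Khat_eq : ev (fun z => frameRic z =
     (u z ^+ 2 * \tr (invmx (H z) *m frameKhat z)) *: frameKhat z
     - u z ^+ 2 *: (frameKhat z *m invmx (H z) *m frameKhat z)))
  (hamilton : ev (fun z => \tr (invmx (H z) *m frameRic z) =
     u z ^+ 2 * (\tr (invmx (H z) *m frameK z) ^+ 2
       - \tr (invmx (H z) *m frameK z *m (invmx (H z) *m frameK z)))))
  (tr_h1 : ev (fun z => \tr (eta *m h1 z) = - 6 * sg z))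
  (tr_S0 : ev (fun z => \tr (eta *m S0 z) = - 3 * sg z)).

Let W z := invmx (H z).
Let Kt z := u z *: frameK z.
Let XK z := W z *m Kt z.
(** In terms of k = h1 + 2 sigma h0 these are - k / 2 and D D sigma + sigma - k / 2, each with
    raised index, whence their vanishing traces. *)
Let P1 z := - (2^-1 *: (eta *m h1 z)) - sg z *: 1%:M.
Let Y1 z := eta *m S0 z - 2^-1 *: (eta *m h1 z).

Lemma lapse_ex : ex1 lapse (fun=> 1) sg.
Proof.
split=> //; first exact: bigO_cst.
by apply: bigO_ext (bigO_0 dom 2) => z; rewrite /lapse; ring.
Qed.

Lemma lapse_bound : ev (fun z => 2^-1 <= lapse z).
Proof.
have H1 : bigO 1 (fun z => lapse z - 1) := ex1_sub0 lapse_ex.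
have c0 : 0 < (2^-1 : R) by rewrite invr_gt0.
apply: ev_imp (bigO1_small c0 H1) _ => z _ _; rewrite ler_norml.
by move=> /andP[a _]; lra.
Qed.

Lemma lapse_inv_ex : ex1 (fun z => (lapse z)^-1) (fun=> 1) (fun z => - sg z).
Proof.
split; [exact: bigO_cst|exact: bigO_opp|].
have I : bigO 0 (fun z => (lapse z)^-1).
  apply: (@bigO_inv _ _ _ 2^-1); first by rewrite invr_gt0.
  by apply: ev_imp lapse_bound _ => z _ _ /le_trans; apply; exact: ler_norm.
have B := bigO_mul (bigO_uX dom 2) (bigO_mul (bigO_mul sgO sgO) I).
apply: bigO_eq B; apply: ev_imp lapse_bound _ => z _ _ nb.
have n0 : lapse z != 0 by rewrite gt_eqF// (lt_le_trans _ nb)// invr_gt0.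
by move: n0; rewrite /lapse => n0; field.
Qed.

Lemma H_ex : mex1 H (fun=> eta) h1.
Proof. by apply: mex1_intro => //; exact: mxO_cst. Qed.

Lemma detH_O1 : bigO 1 (fun z => \det (H z) + 1).
Proof.
have A : mxO 1 (fun z => H z - eta).
  by move=> i j; apply: bigO_ext (ex1_sub0 (H_ex i j)) => z; rewrite !mxE.
have := det_bigO1 (mex1_bigO H_ex) (mxO_cst dom eta) A.
by apply: bigO_ext => z; rewrite det_eta opprK.
Qed.

Lemma detH_bound : ev (fun z => \det (H z) <= - 2^-1).
Proof.
have c0 : 0 < (2^-1 : R) by rewrite invr_gt0.
apply: ev_imp (bigO1_small c0 detH_O1) _ => z _ _; rewrite ler_norml.
by move=> /andP[_ a]; lra.
Qed.

Lemma H_unit : ev (fun z => H z \in unitmx).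
Proof.
apply: ev_imp detH_bound _ => z _ _ d; rewrite unitmxE unitfE lt_eqF//.
by apply: le_lt_trans d _; rewrite oppr_lt0 invr_gt0.
Qed.

Lemma W_O0 : mxO 0 W.
Proof.
apply: (@invmx_bigO _ _ _ _ _ 2^-1); first by rewrite invr_gt0.
  exact: mex1_bigO H_ex.
apply: ev_imp detH_bound _ => z _ _ d; rewrite lerNr in d.
by apply: le_trans d _; rewrite -normrN ler_norm.
Qed.

(** The resolvent identity W - eta = - W (H - eta) eta gives W - eta = O(1 / rho); inserted into
    itself, it yields the first-order term. *)
Lemma W_ex : mex1 W (fun=> eta) (fun z => - (eta *m h1 z *m eta)).
Proof.
pose R2 z := H z - eta - u z *: h1 z.
have etaO := mxO_cst dom eta.
have E1 : ev (fun z => W z - eta = - (u z *: (W z *m h1 z *m eta)) - W z *m R2 z *m eta).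
  apply: ev_imp H_unit _ => z _ _ Hz.
  have e : eta = W z + u z *: (W z *m h1 z *m eta) + W z *m R2 z *m eta.
    rewrite -{1}(mul1mx eta) -(mulVmx Hz) -/(W z).
    have -> : H z = eta + u z *: h1 z + R2 z by apply/matrixP => i j; rewrite /R2 !mxE; ring.
    by rewrite !mulmxDr !mulmxDl -[W z *m eta *m eta]mulmxA eta_eta mulmx1 -scalemxAr -scalemxAl.
  have aux (w t b c : 'M[R]_3) : t = w + b + c -> w - t = - b - c.
    by move=> ->; apply/matrixP => i j; rewrite !mxE; ring.
  exact: aux e.
have Wh : mxO 0 (fun z => W z *m h1 z *m eta).
  exact: mxO_mul (mxO_mul W_O0 h1O) etaO.
have WR : mxO 2 (fun z => W z *m R2 z *m eta).
  exact: mxO_mul (mxO_mul W_O0 HO) etaO.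
have D1 : mxO 1 (fun z => W z - eta).
  apply: mxO_eq E1 _; apply: mxO_sub; last exact: mxO_weak WR.
  by apply: mxO_opp; exact: mxO_scale (bigO_u dom) Wh.
apply: mex1_intro => //.
  by apply: mxO_opp; exact: mxO_mul (mxO_mul etaO h1O) etaO.
have D2 : mxO 2 (fun z => - (u z *: ((W z - eta) *m (h1 z *m eta))) - W z *m R2 z *m eta).
  apply: mxO_sub => //; apply: mxO_opp.
  exact: mxO_scale (bigO_u dom) (mxO_mul D1 (mxO_mul h1O etaO)).
apply: mxO_eq D2; apply: ev_imp E1 _ => z _ _ E; rewrite {1}E mulmxBl !mulmxA.
move: (W z *m h1 z *m eta) (eta *m h1 z *m eta) (W z *m R2 z *m eta) => a b c.
by apply/matrixP => i j; rewrite !mxE; ring.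
Qed.

Lemma Kt_ex : mex1 Kt (fun=> eta) (fun z => 2^-1 *: h1 z - sg z *: eta).
Proof.
have B : mex1 (fun z => 2 *: eta + u z *: h1 z + u z *: G z) (fun=> 2 *: eta) h1.
  have uG : mxO 2 (fun z => u z *: G z).
    by apply: mxO_weak (mxO_scale (bigO_u dom) GO).
  have A := mex1_add (mex1_add (mex1_const (mxO_cst dom (2 *: eta))) (mex1_u h1O)) (mex1_O2 uG).
  by apply: mex1_ext A => z; rewrite ?add0r !addr0.
have F := ex1_mul (ex1_const (bigO_cst dom (2^-1 : R))) lapse_inv_ex.
apply: mex1_eq (mex1_ext _ _ (mex1_scale F B)).
- apply: ev_all => z z1 _; rewrite /Kt /frameK scalerA invfM.
  have r0 : z.1 != 0 by rewrite gt_eqF// (lt_trans ltr01).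
  move: (eta) (h1 z) (G z) => e a b; apply/matrixP => i j; rewrite !mxE /inv_radius.
  by move: (lapse z)^-1 => n; field.
- by move=> z; rewrite scalerA mulr1 mulVf ?scale1r ?pnatr_eq0.
- move=> z; rewrite mulr1 mul0r addr0 scalerA; congr (_ + _).
  by rewrite -scaleNr; congr (_ *: _); field.
Qed.

Lemma XK_ex : mex1 XK (fun=> 1%:M) P1.
Proof.
apply: mex1_ext (mex1_mul W_ex Kt_ex) => z; first by rewrite eta_eta.
rewrite mulmxBr -!scalemxAr eta_eta mulNmx -[X in _ - X]mulmxA eta_eta mulmx1 /P1.
rewrite -[X in _ - X](scale1r (eta *m h1 z)) addrAC -scalerBl; congr (_ - _).
by rewrite -scaleNr; congr (_ *: _); field.
Qed.

Lemma tr_P1 : ev (fun z => \tr (P1 z) = 0).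
Proof.
apply: ev_imp tr_h1 _ => z _ _ E.
by rewrite /P1 mxtraceD !linearN /= !mxtraceZ E mxtrace1; field.
Qed.

Lemma trXK_ex : ex1 (fun z => \tr (XK z)) (fun=> 3) (fun=> 0).
Proof.
apply: ex1_evext (mex1_tr XK_ex).
  by apply: ev_all => z _ _; rewrite mxtrace1.
by apply: ev_imp tr_P1 _ => z _ _ ->.
Qed.

(** The first order vanishes: the factor 1 / N contributes - sigma eta and the derivative of 1 / N
    contributes + sigma eta. *)
Lemma framedK_ex : mex1 framedK (fun=> eta) (fun=> 0).
Proof.
have F := ex1_mul (ex1_const (bigO_cst dom (2^-1 : R))) lapse_inv_ex.
have A := mex1_scale F (mex1_add (mex1_const (mxO_cst dom (2 *: eta)))
   (mex1_O2 (mxO_weak (isT : (2 <= 3)%N) G'O))).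
have B := mex1_scale (ex1_mul (ex1_u sgO) lapse_inv_ex) Kt_ex.
apply: mex1_eq (mex1_ext _ _ (mex1_add A B)).
- apply: ev_imp lapse_bound _ => z z1 _ nb; rewrite /framedK /Kt /frameK invfM; congr (_ + _).
  have n0 : lapse z != 0 by rewrite gt_eqF// (lt_le_trans _ nb)// invr_gt0.
  by rewrite !scalerA; congr (_ *: _); field.
- move=> z; rewrite mul0r scale0r !addr0 scalerA mulr1 mulVf ?scale1r ?pnatr_eq0//.
- move=> z; rewrite mulr1 !(mul0r, scale0r, addr0, add0r) scaler0 add0r mulr1 scalerA -scalerDl.
  by rewrite (_ : _ + _ = 0) ?scale0r//; field.
Qed.

(** The terms in sigma eta cancel: - 1 from d_rho K, - 3 from (tr K) K and + 4 from - 2 K K. *)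
Lemma frameRic_ex : mex1 frameRic (fun=> 2 *: eta) (fun z => S0 z + (3 / 2) *: h1 z).
Proof.
have uS : mex1 (fun z => u z *: S z) (fun=> 0) S0.
  apply: mex1_intro => //; first exact: mxO_cst.
  apply: mxO_ext (mxO_scale (bigO_u dom) SO) => z.
  by rewrite subr0 -scalerBr.
have A1 := mex1_scale lapse_inv_ex framedK_ex.
have A2 := mex1_scale lapse_inv_ex uS.
have A3 := mex1_scale trXK_ex Kt_ex.
have A4 := mex1_scale (ex1_const (bigO_cst dom (-2 : R))) (mex1_mul Kt_ex XK_ex).
apply: mex1_eq (mex1_ext _ _ (mex1_add (mex1_add (mex1_add A1 A2) A3) A4)).
- apply: ev_all => z _ _; rewrite /frameRic; congr (_ + _ + _ + _).
  + by rewrite scalerA.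
  + rewrite /XK /Kt /W; move: (frameK z) (invmx (H z)) => K w.
    by rewrite -scalemxAr mxtraceZ scalerA; congr (_ *: _); ring.
  + rewrite /XK /Kt /W; move: (frameK z) (invmx (H z)) => K w.
    by rewrite -!scalemxAl -!scalemxAr !scalerA -scaleNr mulmxA; congr (_ *: _); ring.
- move=> z; rewrite mulmx1; move: (eta) => e.
  by apply/matrixP => i j; rewrite !mxE; ring.
- move=> z; rewrite !mulmx1 /P1 mulmxBr mulmxN -!scalemxAr mulmxA eta_eta mul1mx mulmx1.
  move: (eta) => e; apply/matrixP => i j; rewrite !mxE; by field.
Qed.

Let Y z := W z *m frameRic z.

Lemma Y_ex : mex1 Y (fun=> 2%:M) Y1.
Proof.
apply: mex1_ext (mex1_mul W_ex frameRic_ex) => z.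
  by rewrite -scalemxAr eta_eta scale_scalar_mx mulr1.
rewrite mulNmx -[(eta *m h1 z *m eta) *m _]scalemxAr -[X in 2 *: X]mulmxA eta_eta mulmx1.
rewrite mulmxDr -scalemxAr /Y1; move: (eta *m S0 z) (eta *m h1 z) => a b.
by apply/matrixP => i j; rewrite !mxE; field.
Qed.

Lemma tr_Y1 : ev (fun z => \tr (Y1 z) = 0).
Proof.
apply: ev_imp (ev_and tr_h1 tr_S0) _ => z _ _ [E F].
by rewrite /Y1 mxtraceD linearN /= mxtraceZ E F; field.
Qed.

Let Xh z := u z *: (W z *m frameKhat z).
Let Eh z := Xh z - 1%:M.
Let P z := XK z - 1%:M.

(** This is all that the prescribed leading term of [Khat] provides; the coefficient of order 1 /
    rho is extracted from the defining equation in [Eh_rem]. *)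
Lemma Eh_O1 : mxO 1 Eh.
Proof.
have D1 : mxO 1 (fun z => W z - eta).
  by move=> i j; apply: bigO_ext (ex1_sub0 (W_ex i j)) => z; rewrite !mxE.
have A := mxO_add (mxO_mul D1 (mxO_cst dom eta))
  (mxO_scale (bigO_u dom) (mxO_mul W_O0 GKO)).
apply: mxO_eq A; apply: ev_all => z z1 _; have r0 : z.1 != 0 by rewrite gt_eqF// (lt_trans ltr01).
rewrite /Eh /Xh /frameKhat mulmxDr -scalemxAr scalerDr scalerA /inv_radius mulVf// scale1r.
by rewrite mulmxBl eta_eta addrAC.
Qed.

Lemma Y_Xh : ev (fun z => Y z = \tr (Xh z) *: Xh z - Xh z *m Xh z).
Proof.
apply: ev_imp Khat_eq _ => z _ _ E; rewrite /Y E /Xh -/(W z).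
move: (frameKhat z) (W z) => K w.
rewrite mulmxBr -!scalemxAr mxtraceZ -!scalemxAl !scalerA !mulmxA.
by congr (_ *: _ - _ *: _); ring.
Qed.

Lemma Y_Eh : ev (fun z => Y z = 2%:M + \tr (Eh z) *: 1%:M + Eh z
  + (\tr (Eh z) *: Eh z - Eh z *m Eh z)).
Proof.
apply: ev_imp Y_Xh _ => z _ _ ->; have -> : Xh z = 1%:M + Eh z by rewrite /Eh addrC subrK.
by move: (Eh z) => e; exact: trace_square_1D.
Qed.

(** The trace of [Y_Eh] is 6 + 4 tr E + (tr E)^2 - tr E^2. On the left the order 1 / rho is absent
    by [tr_Y1], and the quadratic terms are O(rho^-2) by [Eh_O1]. *)
Lemma trEh_O2 : bigO 2 (fun z => \tr (Eh z)).
Proof.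
have Z2 : bigO 2 (fun z => \tr (\tr (Eh z) *: Eh z - Eh z *m Eh z)).
  apply: mxO_tr; apply: mxO_sub; last exact: mxO_mul Eh_O1 Eh_O1.
  exact: mxO_scale (mxO_tr Eh_O1) Eh_O1.
have [_ _ T2] := mex1_tr Y_ex.
have A := bigO_mul (bigO_cst dom (4^-1 : R)) (bigO_sub T2 Z2).
apply: bigO_eq A; apply: ev_imp (ev_and Y_Eh tr_Y1) _ => z _ _ [E F].
rewrite F {}E !mxtraceD !linearN /= !mxtraceZ !mxtrace_scalar.
by move: (\tr (Eh z)) (\tr (Eh z *m Eh z)) => a b; field.
Qed.

(** Once tr E is known to be O(rho^-2), [Y_Eh] reads E = Y - 2 up to that order, and Y has been
    expanded in [Y_ex]. *)
Lemma Eh_rem : mxO 2 (fun z => Eh z - u z *: Y1 z).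
Proof.
have Z2 : mxO 2 (fun z => \tr (Eh z) *: Eh z - Eh z *m Eh z).
  apply: mxO_sub; last exact: mxO_mul Eh_O1 Eh_O1.
  exact: mxO_scale (mxO_tr Eh_O1) Eh_O1.
have T2 : mxO 2 (fun z => \tr (Eh z) *: (1%:M : 'M[R]_3)).
  exact: mxO_scale trEh_O2 (mxO_cst dom 1%:M).
apply: mxO_eq (mxO_sub (mxO_sub (mex1_rem Y_ex) T2) Z2).
apply: ev_imp Y_Eh _ => z _ _ ->.
move: (\tr (Eh z)) => t; set e2 := _ *m _; move: (Eh z) (Y1 z) e2 => e y e2.
by apply/matrixP => i j; rewrite !mxE; ring.
Qed.

Lemma P_rem : mxO 2 (fun z => P z - u z *: P1 z).
Proof. exact: mex1_rem XK_ex. Qed.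

Lemma trP_O2 : bigO 2 (fun z => \tr (P z)).
Proof.
have [_ _ T2] := trXK_ex; apply: bigO_ext T2 => z.
by rewrite /P mxtraceD linearN /= mxtrace1; ring.
Qed.

(** The trace of [Y] is computed twice, from [hamilton] with X = 1 + P and from [Y_Eh] with X = 1 +
    E. *)
Lemma trace_identity : ev (fun z => 4 * (\tr (P z) - \tr (Eh z)) =
  \tr (P z *m P z) - \tr (Eh z *m Eh z) + \tr (Eh z) ^+ 2 - \tr (P z) ^+ 2).
Proof.
apply: ev_imp (ev_and hamilton Y_Eh) _ => z _ _ [E F].
have {}E : \tr (Y z) = \tr (XK z) ^+ 2 - \tr (XK z *m XK z).
  rewrite /Y E /XK /Kt -/(W z); move: (frameK z) (W z) => K w.
  by rewrite -!scalemxAr -!scalemxAl !mxtraceZ; ring.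
have e : XK z = 1%:M + P z by rewrite /P addrC subrK.
move: E; rewrite F e; move: (Eh z) (P z) => e' p.
rewrite mulmxDl !mulmxDr !mul1mx !mulmx1 !mxtraceD !linearN /= !mxtraceZ.
rewrite !mxtrace_scalar.
move: (\tr e') (\tr (e' *m e')) (\tr p) (\tr (p *m p)) => a b c d E.
have {}E : 2 *+ 3 + a * 3%:R + a + (a * a - b) = (3%:R + c) ^+ 2 - (3%:R + c + (c + d)) by [].
rewrite (_ : 4 * (c - a) = (3%:R + c) ^+ 2 - (3%:R + c + (c + d)) - (6 + 4 * a + a ^+ 2 - b)
  + a ^+ 2 - b + d - c ^+ 2); last by ring.
by rewrite -E; ring.
Qed.

Theorem frame_density :
  bigO 1 (fun z => z.1 ^+ 3 * Num.sqrt (- \det (H z))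
      * (u z ^+ 2 * \tr (W z *m frameK z) - u z ^+ 2 * \tr (W z *m frameKhat z))
    - 4^-1 * (3 * sg z ^+ 2 + \tr (eta *m S0 z *m (eta *m (h1 z + (2 * sg z) *: eta)))
        - \tr (eta *m S0 z *m (eta *m S0 z)))).
Proof.
have P1O : mxO 0 P1.
  apply: mxO_sub; last exact: mxO_scale sgO (mxO_cst dom 1%:M).
  apply: mxO_opp; apply: mxO_scale (bigO_cst dom 2^-1) _.
  exact: mxO_mul (mxO_cst dom eta) h1O.
have Y1O : mxO 0 Y1.
  apply: mxO_sub; first exact: mxO_mul (mxO_cst dom eta) S0O.
  apply: mxO_scale (bigO_cst dom 2^-1) _.
  exact: mxO_mul (mxO_cst dom eta) h1O.
have T1 := trace_square_O3 P1O P_rem.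
have T2 := trace_square_O3 Y1O Eh_rem.
(* The squared traces are O(rho^-4), hence negligible even after multiplication by rho^2. *)
have T3 := bigO_weak (isT : (3 <= 4)%N) (bigO_mul trEh_O2 trEh_O2).
have T4 := bigO_weak (isT : (3 <= 4)%N) (bigO_mul trP_O2 trP_O2).
pose L z := \tr (P1 z *m P1 z) - \tr (Y1 z *m Y1 z).
(* Of rho^3 u^2 tr (W K) there remains rho^2 tr [XK], and the identity matrices cancel in the
   difference [XK] - [Xh]. *)
pose D z := z.1 ^+ 2 * (\tr (P z) - \tr (Eh z)).
have DL : bigO 1 (fun z => D z - 4^-1 * L z).
  have B := bigO_mul (bigO_cst dom 4^-1) (bigO_radius2 (bigO_sub (bigO_add (bigO_sub T1 T2) T3) T4)).
  apply: bigO_eq B; apply: ev_imp trace_identity _ => z z1 _ E.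
  have r0 : z.1 != 0 by rewrite gt_eqF// (lt_trans ltr01).
  rewrite /D (_ : \tr (P z) - \tr (Eh z) = 4^-1 * (4 * (\tr (P z) - \tr (Eh z)))).
    rewrite E /L /inv_radius.
    move: (\tr (P z *m P z)) (\tr (Eh z *m Eh z)) (\tr (P1 z *m P1 z)) (\tr (Y1 z *m Y1 z))
      (\tr (Eh z)) (\tr (P z)) => a b c d e f; by field.
  by rewrite mulrA mulVf ?mul1r ?pnatr_eq0.
have LO : bigO 0 L.
  by apply: bigO_sub; apply: mxO_tr; [exact: (mxO_mul P1O P1O)|exact: (mxO_mul Y1O Y1O)].
have DO : bigO 0 D.
  have A := bigO_add (bigO_weak (isT : (0 <= 1)%N) DL) (bigO_mul (bigO_cst dom 4^-1) LO).
  by apply: bigO_ext A => z; ring.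
(* Since s^2 - 1 = (s - 1) (s + 1) and s + 1 >= 1, the square root is at least as close to 1 as its
   radicand. *)
have SQ : bigO 1 (fun z => Num.sqrt (- \det (H z)) - 1).
  have [C HC] := detH_O1; exists C; apply: ev_imp (ev_and HC detH_bound) _ => z _ _ [h d].
  apply: le_trans h.
  have d0 : 0 <= - \det (H z).
    by rewrite oppr_ge0; apply: le_trans d _; rewrite oppr_le0 invr_ge0.
  have s0 := sqrtr_ge0 (- \det (H z)).
  have E : \det (H z) = - Num.sqrt (- \det (H z)) ^+ 2 by rewrite sqr_sqrtr// opprK.
  rewrite {2}E; move: (Num.sqrt _) s0 => s s0.
  rewrite (_ : - s ^+ 2 + 1 = - ((s - 1) * (s + 1))); last by ring.
  by rewrite normrN normrM ler_peMr// ger0_norm ?addr_ge0// lerDr.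
have B := bigO_add (bigO_mul SQ DO) DL.
apply: bigO_eq B; apply: ev_imp (ev_and tr_h1 tr_S0) _ => z z1 _ [th tS].
have r0 : z.1 != 0 by rewrite gt_eqF// (lt_trans ltr01).
have EL : L z = 3 * sg z ^+ 2 + \tr (eta *m S0 z *m (eta *m (h1 z + (2 * sg z) *: eta)))
        - \tr (eta *m S0 z *m (eta *m S0 z)).
  rewrite /L /P1 /Y1 (mulmxDr eta (h1 z)) -(scalemxAr (2 * sg z)) eta_eta.
  move: th tS; move: (eta *m h1 z) (eta *m S0 z) => a b th tS.
  rewrite trace_square_diff mulmxDr -scalemxAr mulmx1 mxtraceD mxtraceZ th tS.
  by ring.
have ED : z.1 ^+ 3 * Num.sqrt (- \det (H z))
      * (u z ^+ 2 * \tr (W z *m frameK z) - u z ^+ 2 * \tr (W z *m frameKhat z)) =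
    Num.sqrt (- \det (H z)) * D z.
  rewrite /D /P /Eh /XK /Xh /Kt; move: (frameK z) (frameKhat z) (W z) => K K' w.
  rewrite -scalemxAr !linearB /= !mxtraceZ mxtrace1 /inv_radius.
  by move: (\tr (w *m K)) (\tr (w *m K')) (Num.sqrt _) => a b c; field.
by rewrite ED -EL; ring.
Qed.

End FrameAsymptotics.

(** * The Hessian of a function under a pulled-back metric *)

Section Bilinear.
Context {R : realType} {n : nat}.
Implicit Types (A : 'M[R]_n) (v w : 'rV[R]_n).

Definition bil A v w : R := (v *m A *m w^T) 0 0.

Lemma bilE A v w : bil A v w = \sum_i \sum_j v 0 i * A i j * w 0 j.
Proof.
rewrite /bil mxE exchange_big; apply: eq_bigr => j _; rewrite !mxE mulr_suml.
by apply: eq_bigr.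
Qed.

Lemma bilE' A v w : bil A v w = \sum_j \sum_i v 0 i * A i j * w 0 j.
Proof. by rewrite bilE exchange_big. Qed.

Lemma bilDl A v1 v2 w : bil A (v1 + v2) w = bil A v1 w + bil A v2 w.
Proof. by rewrite /bil !mulmxDl mxE. Qed.
Lemma bilZl A (c : R) v w : bil A (c *: v) w = c * bil A v w.
Proof. by rewrite /bil -!scalemxAl mxE. Qed.
Lemma bilDr A v w1 w2 : bil A v (w1 + w2) = bil A v w1 + bil A v w2.
Proof. by rewrite /bil linearD /= mulmxDr mxE. Qed.
Lemma bilZr A (c : R) v w : bil A v (c *: w) = c * bil A v w.
Proof. by rewrite /bil linearZ /= -scalemxAr mxE. Qed.
Lemma bilZA A (c : R) v w : bil (c *: A) v w = c * bil A v w.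
Proof. by rewrite /bil -scalemxAr -scalemxAl mxE. Qed.
Lemma bilDA A B v w : bil (A + B) v w = bil A v w + bil B v w.
Proof. by rewrite /bil mulmxDr mulmxDl mxE. Qed.
Lemma bil_sym A v w : A^T = A -> bil A v w = bil A w v.
Proof.
move=> sA; rewrite /bil; have -> : w *m A *m v^T = (v *m A *m w^T)^T.
  by rewrite !trmx_mul trmxK sA mulmxA.
by rewrite [RHS]mxE.
Qed.

End Bilinear.

Section HessianFormula.
Context {R : realType}.
Implicit Types (x : 'rV[R]_3).

Lemma hessianE n (g : 'rV[R]_n -> 'M[R]_n) (f : 'rV[R]_n -> R) (x : 'rV[R]_n) a b :
  hessian g f x a b =
  pd a (pd b f) x - \sum_d christoffel g x d a b * pd d f x.
Proof.
have E y c : cov g (tensor0 f) y [:: c] = pd c f y.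
  by rewrite /cov /= big_ord0 subr0.
rewrite /hessian mxE.
have -> : cov g (cov g (tensor0 f)) x [:: a; b] =
    pd a (fun y => cov g (tensor0 f) y [:: b]) x
    - \sum_(i < 1) \sum_d christoffel g x d a (nth a [:: b] i)
        * cov g (tensor0 f) x (set_nth a [:: b] i d) by [].
have -> : (fun y => cov g (tensor0 f) y [:: b]) = pd b f by apply: funext => y.
by rewrite big_ord1; congr (_ - _); apply: eq_bigr => d _; rewrite E.
Qed.

(** The second partial derivatives of the embedding, split by the Gauss formula into a tangential
    and a normal part. *)
Definition jacD2 x (a b : 'I_3) : 'rV[R]_4 :=
  \sum_c gamma0 x c a b *: row c (jac_embed x) - h0 x a b *: embed x.

Lemma gamma0_sym x c a b : gamma0 x c a b = gamma0 x c b a.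
Proof. by move: c a b; do 3 (apply: ord3P). Qed.

Lemma h0_sym x : (h0 x)^T = h0 x.
Proof. by rewrite /h0 tr_diag_mx. Qed.

Lemma jacD2_sym x a b : jacD2 x a b = jacD2 x b a.
Proof.
rewrite /jacD2 -[in h0 x a b](h0_sym x) [(_)^T a b]mxE; congr (_ - _).
by apply: eq_bigr => c _; rewrite gamma0_sym.
Qed.

Lemma is_derive_jacD2 x c a mu : chart x ->
  is_derive x (dirv c) (fun y => jac_embed y a mu) (jacD2 x a c 0 mu).
Proof.
move=> xc; apply: is_derive_eq (is_derive_jac c a mu xc) _.
rewrite /jacD2 !mxE summxE; congr (_ - _).
by apply: eq_bigr => e _; rewrite !mxE.
Qed.

Variables (x : 'rV[R]_3) (xc : chart x) (F : 'rV[R]_4 -> R) (f : 'rV[R]_3 -> R)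
  (Phi : 'rV[R]_4 -> 'M[R]_4) (g : 'rV[R]_3 -> 'M[R]_3).
Hypotheses (HF : smooth_on setT F) (fF : forall y, chart y -> f y = F (embed y))
  (gPhi : \forall y \near x, g y = pullback2 y (Phi (embed y)))
  (dPhi : \forall z \near embed x, forall mu nu l, derivable (fun y => Phi y mu nu) z (dirv l))
  (cPhi : forall mu nu l, {for embed x, continuous (pd l (fun y => Phi y mu nu))})
  (sPhi : (Phi (embed x))^T = Phi (embed x))
  (gu : g x \in unitmx).

Let Y := embed x.
Let J a := row a (jac_embed x).
Let w a b := jacD2 x a b.
Let P := Phi Y.
Definition dambient (v : 'rV[R]_4) : 'M[R]_4 :=
  \sum_l v 0 l *: \matrix_(mu, nu) pd l (fun y => Phi y mu nu) Y.
Definition grad4 : 'rV[R]_4 := \row_mu pd mu F Y.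
Definition hess4 : 'M[R]_4 := \matrix_(l, mu) pd l (pd mu F) Y.
Definition proj4 : 'rV[R]_4 := grad4 *m (jac_embed x)^T *m invmx (g x) *m jac_embed x.

Lemma near_self (Q : 'rV[R]_3 -> Prop) : (\forall y \near x, Q y) -> Q x.
Proof. by move=> /nbhs_singleton. Qed.

Lemma dPhi_derive mu nu c :
  is_derive x (dirv c) (fun y => Phi (embed y) mu nu) (dambient (J c) mu nu).
Proof.
apply: is_derive_eq (is_derive_ambient (F := fun y => Phi y mu nu) c _ _) _.
- by apply: filterS dPhi => z H l; exact: H.
- by move=> l; exact: cPhi.
- by rewrite /dambient summxE; apply: eq_bigr => l _; rewrite !mxE mulrC.
Qed.

Lemma pd_pullback a b c : pd c (fun y => g y a b) x =
  bil P (w a c) (J b) + bil (dambient (J c)) (J a) (J b) + bil P (J a) (w b c).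
Proof.
have D : is_derive x (dirv c)
    (fun y => \sum_nu (\sum_mu jac_embed y a mu * Phi (embed y) mu nu) * jac_embed y b nu)
    (\sum_nu ((\sum_mu (w a c 0 mu * P mu nu + jac_embed x a mu * dambient (J c) mu nu)) * jac_embed x b nu
       + (\sum_mu jac_embed x a mu * P mu nu) * w b c 0 nu)).
  apply: is_derive_funsum => nu; apply: is_derive_funM; last exact: is_derive_jacD2.
  apply: is_derive_funsum => mu; apply: is_derive_funM; last exact: dPhi_derive.
  exact: is_derive_jacD2.
have E : \forall y \near x, g y a b =
    \sum_nu (\sum_mu jac_embed y a mu * Phi (embed y) mu nu) * jac_embed y b nu.
  apply: filterS gPhi => y ->; rewrite /pullback2 mxE; apply: eq_bigr => nu _.
  by rewrite !mxE.
rewrite (pd_near c E) (is_derive_pd D) !bilE' -!big_split.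
apply: eq_bigr => nu _ /=; rewrite !mulr_suml -!big_split; apply: eq_bigr => mu _ /=.
by rewrite ![J _ 0 _]mxE; ring.
Qed.

Lemma christoffel_pullback c a b : christoffel g x c a b =
  \sum_e invmx (g x) c e * (bil P (J e) (w a b) + 2^-1 * (bil (dambient (J a)) (J e) (J b)
     + bil (dambient (J b)) (J e) (J a) - bil (dambient (J e)) (J a) (J b))).
Proof.
rewrite /christoffel mulr_sumr; apply: eq_bigr => e _; rewrite !pd_pullback.
rewrite /w (jacD2_sym x e a) (jacD2_sym x e b) (jacD2_sym x b a).
rewrite (bil_sym (J a) (jacD2 x b e) sPhi).
by field.
Qed.

Lemma pd_scalar y b : chart y ->
  pd b f y = \sum_mu pd mu F (embed y) * jac_embed y b mu.
Proof.
move=> yc; apply: is_derive_pd; apply: (chart_eq_is_derive fF yc).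
exact: is_derive_ambient_smooth.
Qed.

Lemma pd_scalarE b : pd b f x = (J b *m grad4^T) 0 0.
Proof. by rewrite pd_scalar// mxE; apply: eq_bigr => mu _; rewrite !mxE mulrC. Qed.

Lemma pd2_scalar a b : pd a (pd b f) x = bil hess4 (J a) (J b) + (w b a *m grad4^T) 0 0.
Proof.
have D : is_derive x (dirv a) (fun y => \sum_mu pd mu F (embed y) * jac_embed y b mu)
   (\sum_mu ((\sum_l pd l (pd mu F) (embed x) * jac_embed x a l) * jac_embed x b mu
     + pd mu F (embed x) * w b a 0 mu)).
  apply: is_derive_funsum => mu; apply: is_derive_funM; last exact: is_derive_jacD2.
  by apply: is_derive_ambient_smooth; exact: smooth_on_pd.
have E := chart_eq_pd a (fun y yc => @pd_scalar y b yc) xc.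
rewrite E (is_derive_pd D) big_split /=; congr (_ + _).
  rewrite bilE exchange_big; apply: eq_bigr => mu _; rewrite mulr_suml.
  by apply: eq_bigr => l _; rewrite !mxE; ring.
by rewrite mxE; apply: eq_bigr => mu _; rewrite !mxE mulrC.
Qed.

(** [proj4] is the tangent vector representing df through the ambient form [P]. This makes the
    singular coefficients cancel in [hessian_pullback]. *)
Lemma proj4_bil e : bil P proj4 (J e) = (J e *m grad4^T) 0 0.
Proof.
have gx : g x = jac_embed x *m P *m (jac_embed x)^T by exact: (near_self gPhi).
have A : proj4 *m P *m (jac_embed x)^T = grad4 *m (jac_embed x)^T.
  by rewrite /proj4 -!mulmxA (mulmxA (jac_embed x) P) -gx mulVmx// mulmx1.
transitivity ((proj4 *m P *m (jac_embed x)^T) 0 e).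
  rewrite /bil [LHS]mxE [RHS]mxE; apply: eq_bigr => mu _; congr (_ * _).
  by rewrite !mxE.
by rewrite A [LHS]mxE [RHS]mxE; apply: eq_bigr => mu _; rewrite !mxE mulrC.
Qed.

(** Raising the index with [g] and pairing with df replaces the tangent vectors by [proj4] inside
    any linear form. By [christoffel_pullback], the connection term of the Hessian has this
    shape. *)
Lemma contract_proj (T : 'rV[R]_4 -> R) (TD : forall v1 v2, T (v1 + v2) = T v1 + T v2)
    (TZ : forall c v, T (c *: v) = c * T v) :
  \sum_c (\sum_e invmx (g x) c e * T (J e)) * (J c *m grad4^T) 0 0 = T proj4.
Proof.
have T0 : T 0 = 0 by rewrite -(scale0r 0) TZ mul0r.
have Tsum I (r : seq I) (c : I -> R) (v : I -> 'rV[R]_4) :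
    T (\sum_(i <- r) c i *: v i) = \sum_(i <- r) c i * T (v i).
  elim: r => [|i r IH]; first by rewrite !big_nil.
  by rewrite !big_cons TD TZ IH.
have -> : proj4 = \sum_e (grad4 *m (jac_embed x)^T *m invmx (g x)) 0 e *: J e.
  apply/rowP => mu; rewrite summxE [LHS]mxE; apply: eq_bigr => e _.
  by rewrite [RHS]mxE [J e 0 mu]mxE.
rewrite Tsum; under eq_bigr do rewrite mulr_suml.
rewrite exchange_big; apply: eq_bigr => e _; rewrite [X in _ = X * _]mxE mulr_suml.
apply: eq_bigr => c _; rewrite mulrAC; congr (_ * _); rewrite mulrC; congr (_ * _).
by rewrite !mxE; apply: eq_bigr => mu _; rewrite !mxE mulrC.
Qed.

Lemma dambientD v1 v2 : dambient (v1 + v2) = dambient v1 + dambient v2.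
Proof.
by rewrite /dambient -big_split; apply: eq_bigr => l _; rewrite mxE scalerDl.
Qed.
Lemma dambientZ c v : dambient (c *: v) = c *: dambient v.
Proof.
by rewrite /dambient scaler_sumr; apply: eq_bigr => l _; rewrite mxE scalerA.
Qed.

(** The symbols [gamma0], unbounded at the poles, enter through the second derivatives of [f] and
    through the Christoffel symbols of [g]. By [proj4_bil] the two contributions are equal and
    cancel; only the normal part of the second fundamental form survives, next to ambient
    derivatives. *)
Theorem hessian_pullback a b : hessian g f x a b =
  bil hess4 (J a) (J b) + h0 x a b * (bil P proj4 Y - (Y *m grad4^T) 0 0)
  - 2^-1 * (bil (dambient (J a)) proj4 (J b) + bil (dambient (J b)) proj4 (J a)
            - bil (dambient proj4) (J a) (J b)).
Proof.
rewrite hessianE pd2_scalar.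
under eq_bigr do rewrite pd_scalarE christoffel_pullback.
rewrite (contract_proj (T := fun v => bil P v (w a b) + 2^-1 * (bil (dambient (J a)) v (J b)
     + bil (dambient (J b)) v (J a) - bil (dambient v) (J a) (J b)))); first last.
- by move=> c v; rewrite !bilZl dambientZ bilZA; ring.
- by move=> v1 v2; rewrite !bilDl dambientD bilDA; ring.
have wE (T : 'rV[R]_4 -> R) (TD : forall v1 v2, T (v1 + v2) = T v1 + T v2)
    (TZ : forall c v, T (c *: v) = c * T v) :
    T (w a b) = \sum_e gamma0 x e a b * T (J e) - h0 x a b * T Y.
  have T0 : T 0 = 0 by rewrite -(scale0r 0) TZ mul0r.
  have Tsum I (r : seq I) (c : I -> R) (v : I -> 'rV[R]_4) :
      T (\sum_(i <- r) c i *: v i) = \sum_(i <- r) c i * T (v i).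
    elim: r => [|i r IH]; first by rewrite !big_nil.
    by rewrite !big_cons TD TZ IH.
  by rewrite /w /jacD2 -scaleNr TD TZ Tsum mulNr.
rewrite {1}/w (jacD2_sym x b a) -/(w a b).
rewrite (wE (fun v => (v *m grad4^T) 0 0)); first last.
- by move=> c v; rewrite -scalemxAl mxE.
- by move=> v1 v2; rewrite mulmxDl mxE.
rewrite (wE (fun v => bil P proj4 v)); first last.
- by move=> c v; rewrite bilZr.
- by move=> v1 v2; rewrite bilDr.
have -> : \sum_e gamma0 x e a b * bil P proj4 (J e) =
    \sum_e gamma0 x e a b * (J e *m grad4^T) 0 0.
  by apply: eq_bigr => e _; rewrite proj4_bil.
by move: (\sum_e _) => z; ring.
Qed.

End HessianFormula.

Section FrameHessian.
Context {R : realType}.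

(* The frame components of the Hessian of a function with ambient gradient [s]
   and Hessian [D2], for the pull-back of the ambient tensor [P], whose
   derivative in the direction [v] is [dP v]. *)
Definition frame_proj (Q : 'M[R]_(3, 4)) (s : 'rV[R]_4) (P : 'M[R]_4) : 'rV[R]_4 :=
  s *m Q^T *m invmx (Q *m P *m Q^T) *m Q.

Definition frame_hess (Q : 'M[R]_(3, 4)) (Y s : 'rV[R]_4) (D2 P : 'M[R]_4)
    (dP : 'rV[R]_4 -> 'M[R]_4) : 'M[R]_3 :=
  let p := frame_proj Q s P in
  \matrix_(a, b) (bil D2 (row a Q) (row b Q) + eta a b * (bil P p Y - (Y *m s^T) 0 0)
  - 2^-1 * (bil (dP (row a Q)) p (row b Q) + bil (dP (row b Q)) p (row a Q)
            - bil (dP p) (row a Q) (row b Q))).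

(** A constant rescaling of a metric leaves its connection unchanged. It is used with c = rho^2, so
    that the Hessian on the slices has a limit. *)
Lemma frame_hess_scale Q Y s D2 P dP (c : R) : c != 0 ->
  Q *m P *m Q^T \in unitmx -> (forall (t : R) v, dP (t *: v) = t *: dP v) ->
  frame_hess Q Y s D2 (c *: P) (fun v => c *: dP v) = frame_hess Q Y s D2 P dP.
Proof.
move=> c0 U dPZ; have uc : c \is a GRing.unit by rewrite unitfE.
have E : frame_proj Q s (c *: P) = c^-1 *: frame_proj Q s P.
  rewrite /frame_proj -scalemxAr -scalemxAl.
  have V : c *: (Q *m P *m Q^T) \in unitmx by rewrite unitmxZ.
  by rewrite (invmxZ V) -scalemxAr -scalemxAl.
apply/matrixP => a b; rewrite /frame_hess [LHS]mxE [RHS]mxE E dPZ !(bilZl, bilZr, bilZA).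
by congr (_ + _ * (_ - _) - _ * (_ + _ - _)); rewrite mulrA ?mulfV ?mulVf ?mul1r.
Qed.

Lemma row_jac (x : 'rV[R]_3) a : row a (jac_embed x) = lame x 0 a *: row a (@frame R x).
Proof. by apply/rowP => mu; rewrite [LHS]mxE [RHS]mxE [row _ _ _ _]mxE -jac_embed_entry. Qed.

Lemma lame_neq0 (x : 'rV[R]_3) i : chart x -> lame x 0 i != 0.
Proof.
move=> /snx_neq0 s0; move: i; apply: ord3P; rewrite !mxE /= ?oner_neq0 ?chx_neq0//.
by rewrite mulf_neq0// chx_neq0.
Qed.

Lemma lame_unit (x : 'rV[R]_3) : chart x -> diag_mx (lame x) \in unitmx.
Proof.
move=> xc; rewrite unitmxE det_diag unitfE prodf_seq_neq0; apply/allP => i _ /=.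
exact: lame_neq0.
Qed.

Lemma pullback2_frame (x : 'rV[R]_3) (A : 'M[R]_4) : pullback2 x A =
  diag_mx (lame x) *m (frame x *m A *m (frame x)^T) *m diag_mx (lame x).
Proof. by rewrite /pullback2 jac_embedE trmx_mul tr_diag_mx !mulmxA. Qed.

Lemma diag_conj_entry n (D : 'rV[R]_n) (A : 'M[R]_n) a b :
  (diag_mx D *m A *m diag_mx D) a b = D 0 a * A a b * D 0 b.
Proof. by rewrite mul_mx_diag mxE mul_diag_mx mxE. Qed.

Lemma invmx_conj n (D A : 'M[R]_n) : D \in unitmx -> A \in unitmx ->
  invmx (D *m A *m D) = invmx D *m invmx A *m invmx D.
Proof.
move=> uD uA; have uB : D *m A *m D \in unitmx by rewrite !unitmx_mul uD uA.
have E : (D *m A *m D) *m (invmx D *m invmx A *m invmx D) = 1%:M.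
  by rewrite -!mulmxA (mulmxA D (invmx D)) mulmxV// mul1mx (mulmxA A) mulmxV// mul1mx mulmxV.
by rewrite -[LHS]mulmx1 -E (mulmxA (invmx _)) mulVmx// mul1mx.
Qed.

(** The Lamé factors, degenerate at the poles, are confined to the two outer matrices; the inner one
    is built from bounded data. *)
Theorem hessian_frame (x : 'rV[R]_3) (F : 'rV[R]_4 -> R) (f : 'rV[R]_3 -> R)
    (Phi : 'rV[R]_4 -> 'M[R]_4) (g : 'rV[R]_3 -> 'M[R]_3) : chart x ->
  smooth_on setT F -> (forall y, chart y -> f y = F (embed y)) ->
  (\forall y \near x, g y = pullback2 y (Phi (embed y))) ->
  (\forall z \near embed x, forall mu nu l, derivable (fun y => Phi y mu nu) z (dirv l)) ->
  (forall mu nu l, {for embed x, continuous (pd l (fun y => Phi y mu nu))}) ->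
  (Phi (embed x))^T = Phi (embed x) ->
  frame x *m Phi (embed x) *m (frame x)^T \in unitmx ->
  hessian g f x = diag_mx (lame x) *m
    frame_hess (frame x) (embed x) (grad4 x F) (hess4 x F) (Phi (embed x)) (dambient x Phi)
    *m diag_mx (lame x).
Proof.
move=> xc HF fF gP dP cP sP U.
have gx : g x = pullback2 x (Phi (embed x)) by exact: nbhs_singleton gP.
have gu : g x \in unitmx.
  by rewrite gx pullback2_frame !unitmx_mul lame_unit// U.
apply/matrixP => a b; rewrite (hessian_pullback xc HF fF gP dP cP sP gu) diag_conj_entry.
have -> : proj4 x F g = frame_proj (frame x) (grad4 x F) (Phi (embed x)).
  rewrite /proj4 /frame_proj gx pullback2_frame jac_embedE invmx_conj ?lame_unit//.
  rewrite trmx_mul tr_diag_mx -!mulmxA (mulmxA (invmx _) (diag_mx _)) mulVmx ?lame_unit//.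
  by rewrite mul1mx (mulmxA (diag_mx _) (invmx _)) mulmxV ?lame_unit// mul1mx !mulmxA.
rewrite h0_frame diag_conj_entry !row_jac !dambientZ !(bilZl, bilZr, bilZA).
by rewrite [frame_hess _ _ _ _ _ _ _ _]mxE; ring.
Qed.

End FrameHessian.

(** * Bounds that hold up to the poles for bounded tau *)

Section UniformBounds.
Context {R : realType}.

Lemma box_bounded n (f : 'rV[R]_n -> R) (M : R) : (forall Y, {for Y, continuous f}) ->
  exists C : R, forall Y : 'rV[R]_n, `|Y| <= M -> `|f Y| <= C.
Proof.
move=> fc; case: (leP 0 M) => M0; last first.
  by exists 0 => Y YM; have := le_lt_trans YM M0; rewrite normr_lt0.
have cA : compact [set v : 'rV[R]_n | forall i, `[- M, M]%classic (v ord0 i)].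
  by apply: (@rV_compact _ n (fun=> `[- M, M]%classic)) => i; exact: segment_compact.
have A0 : [set v : 'rV[R]_n | forall i, `[- M, M]%classic (v ord0 i)] !=set0.
  by exists 0 => i /=; rewrite mxE in_itv /= oppr_le0 M0.
have nc : continuous (fun Y : 'rV[R]_n => `|f Y|).
  move=> Y; exact: (continuous_comp (fc Y) (@norm_continuous _ _ _)).
have [c _ H] := EVT_max_rV A0 cA (continuous_subspaceT nc).
exists `|f c| => Y YM; apply: H; rewrite inE /= => i; rewrite in_itv /= -ler_norml.
exact: le_trans (rV_coord_le Y i) YM.
Qed.

Lemma interval_bounded (f : R -> R) (T : R) : continuous f ->
  exists C : R, forall t, `|t| <= T -> f t <= C.
Proof.
move=> fc; case: (leP 0 T) => T0; last first.
  by exists 0 => t tT; have := le_lt_trans tT T0; rewrite normr_lt0.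
have TT : - T <= T by rewrite (le_trans _ T0)// oppr_le0.
have [c _ H] := EVT_max TT (continuous_subspaceT fc).
by exists (f c) => t tT; apply: H; rewrite in_itv /= -ler_norml.
Qed.

Lemma chart_function_bounds (x : 'rV[R]_3) (T : R) : `|tau x| <= T ->
  [/\ `|chx x| <= expR T /\ `|shx x| <= expR T, `|snx x| <= 1 /\ `|csx x| <= 1
    & `|sphx x| <= 1 /\ `|cphx x| <= 1].
Proof.
move=> xT; rewrite !ler_norml !sin_geN1 !sin_le1 !cos_geN1 !cos_le1; split=> //.
by rewrite -!ler_norml (gtr0_norm (cosh_gt0 _)) cosh_le ?sinh_le.
Qed.

(** The entries are products of sines, cosines and at most one hyperbolic factor, with no
    denominator, so theta does not enter the bound. *)
Lemma frame_bound (x : 'rV[R]_3) (T : R) a mu : `|tau x| <= T -> `|frame x a mu| <= expR T.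
Proof.
move=> xT; have e1 : 1 <= expR T.
  by rewrite -expR0 ler_expR (le_trans _ xT).
have [[cT sT] [s1 s2] [s3 s4]] := chart_function_bounds xT.
have P (p q : R) C : 0 <= C -> `|p| <= C -> `|q| <= 1 -> `|p * q| <= C.
  by move=> C0 pC q1; rewrite normrM -[leRHS]mulr1 ler_pM.
have T0 : 0 <= expR T := expR_ge0 _.
rewrite /frame mxE; move: a mu; apply: ord3P; apply: ord4P => /=;
  rewrite ?normr0 ?normrN// ?normrN;
  repeat (first [exact: T0 | exact: cT | exact: sT | apply: (P _ _ _ T0) => //]).
all: try by apply: le_trans e1.
Qed.

Lemma embed_bound (x : 'rV[R]_3) (T : R) : `|tau x| <= T -> `|embed x| <= expR T.
Proof.
move=> xT.
have [[cT sT] [s1 s2] [s3 s4]] := chart_function_bounds xT.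
have P (p q : R) C : 0 <= C -> `|p| <= C -> `|q| <= 1 -> `|p * q| <= C.
  by move=> C0 pC q1; rewrite normrM -[leRHS]mulr1 ler_pM.
have T0 : 0 <= expR T := expR_ge0 _.
apply: rV_norm_le => // mu; rewrite /embed mxE; move: mu; apply: ord4P => /=; first exact: sT.
- by apply: (P) => //; apply: (P).
- by apply: (P) => //; apply: (P).
- exact: (P).
Qed.

Lemma lame_det_bound (x : 'rV[R]_3) (T : R) : `|tau x| <= T ->
  `|\det (diag_mx (lame x))| <= expR T ^+ 2.
Proof.
move=> xT; rewrite det_diag !big_ord_recr big_ord0 /= !mxE /= !mul1r.
have [[cT _] [s1 _] _] := chart_function_bounds xT.
rewrite normrM expr2 ler_pM//.
by rewrite normrM -[leRHS]mulr1 ler_pM.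
Qed.

End UniformBounds.

(** * Expansion of the metric, uniformly on a slab *)

Section Symbols.
Context {R : realType}.
Notation rr := (lshift 4 (ord0 : 'I_1)).

(** A symbol has bounded derivatives of every order, but their continuity is not part of its
    definition. It follows from the bounds on the next derivatives, taken on the larger radius
    [M + 1] to leave room for a ball of radius 1. *)
Lemma symbol_smooth (m : int) (F : 'rV[R]_(1 + 4) -> R) (M : R) : symbol m F ->
  exists2 rho1 : R, 0 < rho1 & forall rho (Y : 'rV[R]_4) s, rho1 < rho -> `|Y| <= M ->
    (forall i, derivable (pds s F) (pt rho Y) (dirv i)) /\
    {for Y, continuous (fun y => pds s F (pt rho y))}.
Proof.
move=> /(_ (M + 1)) [rho1 r0 H]; exists rho1 => // rho Y s rr1 YM; split.
  have [C HC] := H s; have := HC (pt rho Y); rewrite ?radius_pt ?tail_pt => HC'.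
  by have [] := HC' rr1 (le_trans YM (ler_wpDr ler01 (lexx M))).
have K (l : 'I_4) : exists C : R, forall Z : 'rV[R]_4, `|Z| <= M + 1 ->
    `|pds (rshift 1 l :: s) F (pt rho Z)| <= C.
  have [C HC] := H (rshift 1 l :: s).
  eexists => Z ZM; have := HC (pt rho Z); rewrite radius_pt tail_pt.
  by move=> /(_ rr1 ZM) [_]; apply.
have [C HC] := choice K.
pose CC := \sum_l `|C l|.
apply: (@bounded_partials_continuous _ _ _ _ 1 CC) => // Z l ZY.
have ZM : `|Z| <= M + 1.
  rewrite -(subrK Y Z) (le_trans (ler_normD _ _))// addrC lerD//.
split.
  have [C' HC'] := H s; have := HC' (pt rho Z); rewrite ?radius_pt ?tail_pt.
  move=> /(_ rr1 ZM) [/(_ (rshift 1 l)) D _].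
  by have /is_derive_slice [] := derivable_pd D.
rewrite (pd_slice (pds s F)); apply: le_trans (HC l Z ZM) _.
apply: le_trans (ler_norm _) _; rewrite /CC (bigD1 l)//= lerDl.
by apply: sumr_ge0 => ? _.
Qed.

Variables (T : R).
Definition strip (x : 'rV[R]_3) := chart x /\ `|tau x| <= T.

Lemma symbol_bigO (j : nat) (F : 'rV[R]_(1 + 4) -> R) s : symbol (- j%:Z) F ->
  bigO strip (j + count_mem rr s)%N (fun z => pds s F (pt z.1 (embed z.2))).
Proof.
move=> /(_ (expR T)) [rho1 r0 H]; have [C HC] := H s.
exists C; exists (Num.max 1 rho1); first by rewrite le_max lexx.
move=> [rho x]; rewrite gt_max /= => /andP[r1 r2] [xc xT].
have := HC (pt rho (embed x)); rewrite ?radius_pt ?tail_pt => /(_ r2 (embed_bound xT)) [_].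
by rewrite -opprD -PoszD -exprnN.
Qed.

Lemma ambient_bigO (F : 'rV[R]_4 -> R) : smooth_on setT F ->
  bigO strip 0 (fun z => F (embed z.2)).
Proof.
move=> HF; have [C HC] := @box_bounded _ _ F (expR T) (fun Y => smooth_on_continuous HF I).
by apply: (bigO_bounded (C := C)) => -[rho x] /= [_ xT]; apply: HC; exact: embed_bound.
Qed.

Lemma frame_bigO : mxO strip 0 (fun z => frame z.2).
Proof.
move=> a mu; apply: (bigO_bounded (C := expR T)) => -[rho x] [_ xT]; exact: frame_bound.
Qed.

Lemma embed_bigO : mxO strip 0 (fun z => embed z.2).
Proof.
move=> a mu; apply: (bigO_bounded (C := expR T)) => -[rho x] [_ xT] /=.
by rewrite ord1; apply: le_trans (rV_coord_le _ _) (embed_bound xT).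
Qed.

End Symbols.

(** The algebra of [dextK_frame]: [n] is the lapse, [l] and [l'] are Lamé factors, [s] is sigma, and
    [e], [w1], [w2], [w3] are entries of [eta], [h1f], [G1], [G2]. *)
Lemma radial_quotient_rule (F : fieldType) (n r l l' e w1 w2 w3 s : F) :
  n != 0 -> r != 0 -> 2 != 0 :> F ->
  - (2 * n) ^- 2 * (2 * - (s / r ^+ 2)) * (l * (2 * r * e + w1 + w2) * l')
    + (2 * n)^-1 * (l * (2 * e + w3) * l') =
  l * ((2 * n)^-1 * (2 * e + w3) + s * r^-1 ^+ 2 / (2 * n ^+ 2) * (2 * r * e + w1 + w2)) * l'.
Proof. by move=> n0 r0 t0; field; rewrite n0 r0 t0. Qed.

(** * The radial direction and the lapse *)

Section Radial.
Context {R : realType} {d : nat}.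
Implicit Types (f : 'rV[R]_(1 + d) -> R) (x : 'rV[R]_d) (rho : R).
Notation rr := (lshift d (ord0 : 'I_1)).

Lemma pt_add_radial rho x (t : R) : pt (t + rho) x = t *: dirv rr + pt rho x.
Proof.
apply/rowP => i; rewrite !mxE; case: splitP => [j Ej|j Ej].
  have -> : i = rr by apply/val_inj; rewrite /= Ej ord1.
  by rewrite !eqxx ord1 !mxE /= mulr1 mulr1n.
have -> : (i == rr) = false by apply/negbTE/eqP => E; move: Ej; rewrite E.
by rewrite andbF mulr0 add0r.
Qed.

Let radial_quotient f rho x :
  (fun t : R => t^-1 *: (f (t *: dirv rr + pt rho x) - f (pt rho x))) =
  (fun t : R => t^-1 *: (f (pt (t *: (1 : R) + rho) x) - f (pt rho x))).
Proof. by apply: funext => t; rewrite -pt_add_radial [t *: _]mulr1. Qed.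

Lemma is_derive_radial f rho x l :
  is_derive (pt rho x) (dirv rr) f l <-> is_derive rho (1 : R) (fun r => f (pt r x)) l.
Proof.
have E := radial_quotient f rho x.
split=> -[D <-]; apply: DeriveDef; rewrite /derivable /derive; by [rewrite -E|rewrite E].
Qed.

End Radial.

Section Lapse.
Context {R : realType}.
Implicit Types (p : 'rV[R]_(1 + 3)) (x : 'rV[R]_3).
Notation rr := (lshift 3 (ord0 : 'I_1)).
Notation tg a := (rshift 1 a).

Lemma ord13P (P : 'I_(1 + 3) -> Prop) : P rr -> (forall a : 'I_3, P (tg a)) -> forall i, P i.
Proof.
move=> P0 P1 i; rewrite -(fintype.splitK i); case: (fintype.split i) => j /=; last exact: P1.
by rewrite ord1.
Qed.

Lemma is_derive_tail_radius (f : 'rV[R]_3 -> R) (g dg : R -> R) rho x i :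
  chart_smooth f -> chart x -> is_derive rho (1 : R) g (dg rho) ->
  is_derive (pt rho x) (dirv i) (fun q : 'rV[R]_(1 + 3) => f (tail q) * g (radius q))
    (match fintype.split i with inl _ => f x * dg rho | inr a => pd a f x * g rho end).
Proof.
move=> fs xc Dg; move: i; apply: ord13P => [|a].
  rewrite (unsplitK (inl _ ord0)); apply/is_derive_radial.
  rewrite (_ : (fun r => _) = fun r => f x * g r); first exact: is_derive_funZ.
  by apply: funext => r; rewrite tail_pt radius_pt.
rewrite (unsplitK (inr _ a)); apply/is_derive_slice.
rewrite (_ : (fun r => _) = fun y => g rho * f y); last first.
  by apply: funext => y; rewrite tail_pt radius_pt mulrC.
rewrite mulrC; apply: is_derive_funZ; exact: chart_smooth_is_derive.
Qed.

Variables (r0 : R -> R).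
Hypotheses (r0c : continuous r0) (r0p : forall t, 0 < r0 t).

Lemma region_pt rho x : region r0 (pt rho x) <-> r0 (tau x) < rho /\ chart x.
Proof. by rewrite /region radius_pt tail_pt. Qed.

Lemma region_radius p : region r0 p -> 0 < radius p.
Proof. by move=> [/(lt_trans (r0p _))]. Qed.

Lemma region_neq0 rho x : region r0 (pt rho x) -> rho != 0.
Proof. by move=> /region_radius; rewrite radius_pt => /lt0r_neq0. Qed.

Lemma region_open p : region r0 p -> \forall q \near p, region r0 q.
Proof.
move=> [p1 p2].
have cr : {for p, continuous (fun q : 'rV[R]_(1 + 3) => radius q)}.
  rewrite (_ : (fun q => _) = fun q : 'rV[R]_(1 + 3) => q 0 rr); first exact: continuous_coord.
  by apply: funext => q; rewrite /radius !mxE.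
have ct i : {for p, continuous (fun q : 'rV[R]_(1 + 3) => tail q 0 i)}.
  rewrite (_ : (fun q => _) = fun q : 'rV[R]_(1 + 3) => q 0 (tg i)); first exact: continuous_coord.
  by apply: funext => q; rewrite /tail !mxE.
have cT : {for p, continuous (@tail R 3)} by apply: rV_continuous => i; exact: ct.
have cr0 : {for p, continuous (fun q : 'rV[R]_(1 + 3) => r0 (tau (tail q)))}.
  exact: (continuous_comp1 r0c (ct _)).
have cd : {for p, continuous (fun q : 'rV[R]_(1 + 3) => radius q + (-1) * r0 (tau (tail q)))}.
  by apply: continuous_funD => //; apply: continuous_funM => //; exact: continuous_cstfun.
have d0 : 0 < radius p + (-1) * r0 (tau (tail p)) by rewrite mulN1r subr_gt0.
have A : \forall q \near p, 0 < radius q + (-1) * r0 (tau (tail q)) := cvgr_gt _ cd _ d0.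
have {}A := A (nbhs_filter p).
have B := cT _ (chart_open p2).
apply: (@filterS _ _ (nbhs_filter p) _ _ _ (@filterI _ _ (nbhs_filter p) _ _ A B)) => q [q1 q2]; split; last exact: q2.
by move: q1 => /=; rewrite mulN1r subr_gt0.
Qed.

Variable sigma : 'rV[R]_3 -> R.
Hypothesis ss : chart_smooth sigma.

Definition bsN p := 1 + sigma (tail p) / radius p.

Lemma is_derive_inv (r : R) : r != 0 -> is_derive r (1 : R) (fun s => s^-1) (- (r ^- 2)).
Proof.
move=> r0'; have H := is_derive_funV r0' (@is_derive_id R R r 1).
by apply: is_derive_eq H _; rewrite mulr1.
Qed.

Lemma bsN_is_derive rho x i : rho != 0 -> chart x ->
  is_derive (pt rho x) (dirv i) bsN
    (match fintype.split i with inl _ => - (sigma x * rho ^- 2) | inr a => pd a sigma x * rho^-1 end).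
Proof.
move=> rho0 xc.
have D := is_derive_tail_radius i ss xc (dg := fun r => - (r ^- 2)) (is_derive_inv rho0).
have H := is_derive_funD (is_derive_cstfun 1 _ _) D.
apply: is_derive_eq H _; rewrite add0r; case: fintype.split => // _; by rewrite mulrN.
Qed.

Lemma bsN_derivable p i : region r0 p -> derivable bsN p (dirv i).
Proof.
move=> Up; have [_ c] := Up; have r := region_radius Up; rewrite -(pt_radius_tail p).
by have [] := bsN_is_derive i (lt0r_neq0 r) c.
Qed.

Lemma bsN_derivable2 p i j : region r0 p -> derivable (pd i bsN) p (dirv j).
Proof.
move=> Up; have [_ c] := Up; have r := lt0r_neq0 (region_radius Up).
(* Every first derivative of the lapse is again a function on dS_3 times a function of the radius,
   so [is_derive_tail_radius] applies a second time. *)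
have [f [g [dg [fs Dg E]]]] : exists f, exists g, exists dg : R -> R, [/\ chart_smooth f,
    is_derive (radius p) (1 : R) g (dg (radius p)) &
    forall q, region r0 q -> f (tail q) * g (radius q) = pd i bsN q].
  have [[k|a] E] : exists k, fintype.split i = k by exists (fintype.split i).
    exists sigma, (fun r => - (r^-1 ^+ 2)), (fun r => - (2 * r^-1 * - (r ^- 2))); split => //.
      exact/is_derive_funN/is_derive_funX2/is_derive_inv.
    move=> q Uq; have [_ cq] := Uq; have rq := lt0r_neq0 (region_radius Uq).
    rewrite -[in RHS](pt_radius_tail q) (is_derive_pd (bsN_is_derive i rq cq)) E mulrN.
    by rewrite exprVn.
  exists (pd a sigma), (fun r => r^-1), (fun r => - (r ^- 2)); split => //.
  - exact: chart_smooth_pd.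
  - exact: is_derive_inv.
  move=> q Uq; have [_ cq] := Uq; have rq := lt0r_neq0 (region_radius Uq).
  by rewrite -[in RHS](pt_radius_tail q) (is_derive_pd (bsN_is_derive i rq cq)) E.
have DD := is_derive_tail_radius j fs c Dg; rewrite pt_radius_tail in DD.
apply: near_eq_derivable (_ : derivable (fun q => f (tail q) * g (radius q)) p (dirv j)).
  by apply: filterS (region_open Up) => q /E.
by case: DD.
Qed.

End Lapse.

(** * Continuity of matrix-valued functions *)

Section MatrixContinuity.
Context {R : realType} {T : topologicalType}.

Definition continuous_mx m n (A : T -> 'M[R]_(m, n)) x :=
  forall i j, {for x, continuous (fun y => A y i j)}.

Lemma continuous_mulmx m n p (A : T -> 'M[R]_(m, n)) (B : T -> 'M[R]_(n, p)) x :
  continuous_mx A x -> continuous_mx B x -> continuous_mx (fun y => A y *m B y) x.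
Proof.
move=> HA HB; apply: (closed_mulmx (Pr := fun f => {for x, continuous f})) => //.
- by move=> c; exact: continuous_cstfun.
- by move=> f g; exact: continuous_funD.
- by move=> f g; exact: continuous_funM.
Qed.

Lemma continuous_mxtrace n (A : T -> 'M[R]_n) x :
  continuous_mx A x -> {for x, continuous (fun y => \tr (A y))}.
Proof.
move=> HA; apply: (closed_sum (Pr := fun f => {for x, continuous f})) => //.
- by move=> c; exact: continuous_cstfun.
- by move=> f g; exact: continuous_funD.
Qed.

Lemma continuous_det n (A : T -> 'M[R]_n) x :
  continuous_mx A x -> {for x, continuous (fun y => \det (A y))}.
Proof.
move=> HA; apply: (closed_det (Pr := fun f => {for x, continuous f})) => //.
- by move=> c; exact: continuous_cstfun.
- by move=> f g; exact: continuous_funD.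
- by move=> f g; exact: continuous_funM.
Qed.

Lemma continuous_eq_near (f g : T -> R) x : (\forall y \near x, g y = f y) ->
  {for x, continuous g} -> {for x, continuous f}.
Proof.
move=> E gc; have EY := nbhs_singleton E.
by apply: cvg_trans (near_eq_cvg E) _; rewrite -EY.
Qed.

Lemma near_neq0 (f : T -> R) x : {for x, continuous f} -> f x != 0 ->
  \forall y \near x, f y != 0.
Proof. by move=> fc f0; apply: (cvgr_neq0 _ fc). Qed.

Lemma continuous_funV (f : T -> R) x : {for x, continuous f} -> f x != 0 ->
  {for x, continuous (fun y => (f y)^-1)}.
Proof. by move=> fc f0; exact: (cvgV f0 fc). Qed.

Lemma continuous_invmx n (A : T -> 'M[R]_n) x : A x \in unitmx ->
  continuous_mx A x -> continuous_mx (fun y => invmx (A y)) x.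
Proof.
rewrite unitmxE unitfE => U HA i j; have cd := continuous_det HA.
apply: (continuous_eq_near (g := fun y => (\det (A y))^-1 * (\adj (A y)) i j)).
  have N0 : \forall y \near x, \det (A y) != 0 by exact: near_neq0.
  by apply: filterS N0 => y Uy; rewrite /invmx unitmxE unitfE Uy [RHS]mxE.
apply: continuous_funM; first exact: continuous_funV.
apply: (closed_adj (Pr := fun f => {for x, continuous f})) => //.
- by move=> c; exact: continuous_cstfun.
- by move=> f g; exact: continuous_funD.
- by move=> f g; exact: continuous_funM.
Qed.

Lemma continuous_trmx m n (A : T -> 'M[R]_(m, n)) x :
  continuous_mx A x -> continuous_mx (fun y => (A y)^T) x.
Proof.
move=> HA i j; rewrite (_ : (fun y => _) = fun y => A y j i); first exact: HA.
by apply: funext => y; rewrite mxE.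
Qed.

Lemma continuous_sqrt (f : T -> R) x : {for x, continuous f} ->
  {for x, continuous (fun y => Num.sqrt (f y))}.
Proof. by move=> fc; apply: (continuous_comp1 (phi := Num.sqrt) _ fc); exact: sqrt_continuous. Qed.

Lemma continuous_funN (f : T -> R) x : {for x, continuous f} ->
  {for x, continuous (fun y => - f y)}.
Proof.
move=> fc; rewrite (_ : (fun y => _) = fun y => (-1) * f y).
  by apply: continuous_funM => //; exact: continuous_cstfun.
by apply: funext => y; rewrite mulN1r.
Qed.

End MatrixContinuity.

(** * Frame components of a Beig-Schmidt metric and of the boundary density *)

Section Expansion.
Context {R : realType}.
Implicit Types (p : 'rV[R]_(1 + 3)) (x : 'rV[R]_3) (rho : R) (z : R * 'rV[R]_3).
Notation rr := (lshift 3 (ord0 : 'I_1)).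
Notation r4 := (lshift 4 (ord0 : 'I_1)).
Notation tg a := (rshift 1 a).
Notation eta := (@eta R).
Notation eta4 := (@eta4 R).

Definition in_frame x (A : 'M[R]_4) : 'M[R]_3 := frame x *m A *m (frame x)^T.
Definition symm n (A : 'M[R]_n) : 'M[R]_n := 2^-1 *: (A + A^T).

Lemma mxDE m n (A B : 'M[R]_(m, n)) a b : (A + B) a b = A a b + B a b.
Proof. by rewrite mxE. Qed.
Lemma mxNE m n (A : 'M[R]_(m, n)) a b : (- A) a b = - A a b.
Proof. by rewrite mxE. Qed.
Lemma mxZE m n c (A : 'M[R]_(m, n)) a b : (c *: A) a b = c * A a b.
Proof. by rewrite mxE. Qed.

Lemma framedK_entry X (s : R * X -> R) (k G G' : R * X -> 'M[R]_3) (z : R * X) a b :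
  framedK s k G G' z a b =
  (2 * lapse s z)^-1 * (2 * eta a b + G' z a b) + (s z * inv_radius z ^+ 2 / (2 * lapse s z ^+ 2))
    * (2 * z.1 * eta a b + k z a b + G z a b).
Proof.
rewrite /framedK; move: (eta) (k z) (G z) (G' z) => e k' g g'; by rewrite !mxE.
Qed.

Lemma frameK_entry X (s : R * X -> R) (k G : R * X -> 'M[R]_3) (z : R * X) a b :
  frameK s k G z a b = (2 * lapse s z)^-1 * (2 * z.1 * eta a b + k z a b + G z a b).
Proof.
rewrite /frameK; move: (eta) (k z) (G z) => e k' g; by rewrite !mxE.
Qed.

Lemma bil0 n (v w : 'rV[R]_n) : bil 0 v w = 0.
Proof. by rewrite /bil mulmx0 mul0mx mxE. Qed.
Lemma bilBA n (A B : 'M[R]_n) v w : bil (A - B) v w = bil A v w - bil B v w.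
Proof. by rewrite bilDA -scaleN1r [bil (-1 *: _) _ _]bilZA mulN1r. Qed.
Lemma bilBl n (A : 'M[R]_n) v1 v2 w : bil A (v1 - v2) w = bil A v1 w - bil A v2 w.
Proof. by rewrite bilDl -scaleN1r [bil _ (-1 *: _) _]bilZl mulN1r. Qed.

Lemma in_frameD x A B : in_frame x (A + B) = in_frame x A + in_frame x B.
Proof. by rewrite /in_frame mulmxDr mulmxDl. Qed.
Lemma in_frameZ x c A : in_frame x (c *: A) = c *: in_frame x A.
Proof. by rewrite /in_frame -scalemxAr -scalemxAl. Qed.
Lemma in_frameT x A : in_frame x A^T = (in_frame x A)^T.
Proof. by rewrite /in_frame !trmx_mul trmxK mulmxA. Qed.
Lemma in_frame_symm x A : in_frame x (symm A) = symm (in_frame x A).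
Proof. by rewrite /symm in_frameZ in_frameD in_frameT. Qed.
Lemma symmT n (A : 'M[R]_n) : (symm A)^T = symm A.
Proof. by rewrite /symm linearZ /= linearD /= trmxK addrC. Qed.
Lemma symm_id n (A : 'M[R]_n) : A^T = A -> symm A = A.
Proof.
move=> E; rewrite /symm E; apply/matrixP => i j; rewrite !mxE.
by move: (A i j) => c; field.
Qed.

Variables (r0 : R -> R) (sigma : 'rV[R]_3 -> R) (h1 h2 : 'rV[R]_3 -> 'M[R]_3)
  (h Khat : 'rV[R]_(1 + 3) -> 'M[R]_3) (Fs : 'rV[R]_4 -> R) (F1 F2 : 'rV[R]_4 -> 'M[R]_4)
  (F3 FK : 'rV[R]_(1 + 4) -> 'M[R]_4).
Hypotheses (r0c : continuous r0) (r0p : forall t, 0 < r0 t)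
  (hsmooth : forall a b, smooth_on (region r0) (fun p => h p a b))
  (hsym : forall p, region r0 p -> (h p)^T = h p)
  (hnd : forall p, region r0 p -> bs_metric sigma h p \in unitmx)
  (Fs_smooth : smooth_on setT Fs) (FsE : forall x, chart x -> sigma x = Fs (embed x))
  (F1_smooth : forall mu nu, smooth_on setT (fun y => F1 y mu nu))
  (F1E : forall x, chart x -> h1 x = pullback2 x (F1 (embed x)))
  (h1_sym : forall x, chart x -> (h1 x)^T = h1 x)
  (F2_smooth : forall mu nu, smooth_on setT (fun y => F2 y mu nu))
  (F2E : forall x, chart x -> h2 x = pullback2 x (F2 (embed x)))
  (F3_symbol : forall mu nu, symbol (- 3%:Z) (fun q => F3 q mu nu))
  (F3E : forall p, region r0 p -> radius p ^- 2 *: h p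
     - (h0 (tail p) + (radius p)^-1 *: h1 (tail p) + radius p ^- 2 *: h2 (tail p)) =
     pullback2 (tail p) (F3 (pt (radius p) (embed (tail p)))))
  (FK_symbol : forall mu nu, symbol (- 0%:Z) (fun q => FK q mu nu))
  (FKE : forall p, region r0 p -> Khat p - radius p *: h0 (tail p) =
     pullback2 (tail p) (FK (pt (radius p) (embed (tail p))))).

Let sigma_smooth : chart_smooth sigma.
Proof. by exists (fun x => Fs (embed x)) => //; exact: amb_comp. Qed.
Let N := bsN sigma.
Let ro := @region_open R r0 r0c.
Let dN := bsN_derivable r0p sigma_smooth.
Let ddN := bsN_derivable2 r0c r0p sigma_smooth.

Lemma h_derivable p i a b : region r0 p -> derivable (fun q => h q a b) p (dirv i).
Proof. by move=> Up; exact: (@smooth_on_derivable R _ _ _ p i (hsmooth a b) Up). Qed.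
Lemma h_derivable2 p i j a b : region r0 p -> derivable (pd i (fun q => h q a b)) p (dirv j).
Proof.
by move=> Up; exact: (@smooth_on_derivable R _ _ _ p j (smooth_on_pd i (hsmooth a b)) Up).
Qed.

Lemma bs_det p : \det (bs_metric sigma h p) = N p ^+ 2 * \det (h p).
Proof. by rewrite /bs_metric det_ublock det_scalar1. Qed.

Lemma N_neq0 p : region r0 p -> N p != 0.
Proof.
move=> /hnd; rewrite unitmxE bs_det unitfE mulf_eq0 negb_or expf_eq0 /=.
by case/andP.
Qed.
Lemma h_unit p : region r0 p -> h p \in unitmx.
Proof. by move=> /hnd; rewrite !unitmxE bs_det !unitfE mulf_eq0 negb_or => /andP[]. Qed.

Variable T : R.
Notation strip := (@strip R T).
Notation bigO := (@bigO R _ strip).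
Notation mxO := (@mxO R _ strip _ _).
Notation ev := (@eventually_on R _ strip).

(* Beyond [rho1], the strip [|tau| <= T] lies in the region where the metric is
   given and the remainders of the two expansions are smooth. *)
Definition threshold (rho1 : R) := [/\ 1 <= rho1,
  forall rho x, rho1 < rho -> strip x -> region r0 (pt rho x),
  forall mu nu rho (Y : 'rV[R]_4) s, rho1 < rho -> `|Y| <= expR T + 1 ->
    (forall i, derivable (pds s (fun q => F3 q mu nu)) (pt rho Y) (dirv i)) /\
    {for Y, continuous (fun y => pds s (fun q => F3 q mu nu) (pt rho y))} &
  forall mu nu rho (Y : 'rV[R]_4) s, rho1 < rho -> `|Y| <= expR T + 1 ->
    {for Y, continuous (fun y => pds s (fun q => FK q mu nu) (pt rho y))}].

Lemma ex_threshold : exists rho1, threshold rho1.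
Proof.
have [C HC] := interval_bounded T r0c.
have K3 (ij : 'I_4 * 'I_4) : exists r : R, forall rho (Y : 'rV[R]_4) s, r < rho -> `|Y| <= expR T + 1 ->
    (forall i, derivable (pds s (fun q => F3 q ij.1 ij.2)) (pt rho Y) (dirv i)) /\
    {for Y, continuous (fun y => pds s (fun q => F3 q ij.1 ij.2) (pt rho y))}.
  by have [r _ H] := symbol_smooth (expR T + 1) (F3_symbol ij.1 ij.2); exists r.
have KK (ij : 'I_4 * 'I_4) : exists r : R, forall rho (Y : 'rV[R]_4) s, r < rho -> `|Y| <= expR T + 1 ->
    {for Y, continuous (fun y => pds s (fun q => FK q ij.1 ij.2) (pt rho y))}.
  have [r _ H] := symbol_smooth (expR T + 1) (FK_symbol ij.1 ij.2); exists r.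
  by move=> rho Y s r1 YM; have [] := H rho Y s r1 YM.
have [f3 H3] := choice K3; have [fK HK] := choice KK.
(* The sum of absolute values dominates the finitely many thresholds of the entries and the bound of
   [r0] on the strip. *)
pose S := 1 + `|C| + \sum_ij (`|f3 ij| + `|fK ij|).
have S0 : 0 <= \sum_ij (`|f3 ij| + `|fK ij|) by apply: sumr_ge0 => ij _; rewrite addr_ge0.
have Sij ij : `|f3 ij| + `|fK ij| <= S.
  rewrite /S (bigD1 ij)//= addrCA lerDl addr_ge0 ?addr_ge0//.
  by apply: sumr_ge0 => k _; rewrite addr_ge0.
exists S; split.
- by rewrite /S -addrA lerDl addr_ge0.
- move=> rho x r1 [xc xT]; apply/region_pt; split=> //; apply: le_lt_trans r1.
  apply: le_trans (HC _ xT) _; apply: le_trans (ler_norm _) _.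
  by rewrite /S addrAC lerDr addr_ge0.
- move=> mu nu rho Y s r1 YM; apply: (H3 (mu, nu)) => //; apply: le_lt_trans r1.
  by apply: le_trans (Sij (mu, nu)); apply: le_trans (ler_norm _) _; rewrite lerDl.
- move=> mu nu rho Y s r1 YM; apply: (HK (mu, nu)) => //; apply: le_lt_trans r1.
  by apply: le_trans (Sij (mu, nu)); apply: le_trans (ler_norm _) _; rewrite lerDr.
Qed.

Definition lam x a : R := lame x 0 a.
Definition h1f x : 'M[R]_3 := in_frame x (F1 (embed x)).
Definition h2f x : 'M[R]_3 := in_frame x (F2 (embed x)).
Definition dF3 k (q : 'rV[R]_(1 + 4)) : 'M[R]_4 :=
  \matrix_(mu, nu) pds (nseq k r4) (fun p : 'rV[R]_(1 + 4) => F3 p mu nu) q.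
(** The [k]-th radial derivative of the remainder of rho^-2 h; each radial derivative of the symbol
    [F3] gains one power of 1 / rho, see [remainder_bigO]. *)
Definition remainder k z : 'M[R]_3 := in_frame z.2 (dF3 k (pt z.1 (embed z.2))).

Lemma h_expansion rho x a b : region r0 (pt rho x) ->
  h (pt rho x) a b = lam x a * (rho ^+ 2 * eta a b + rho * h1f x a b + h2f x a b
    + rho ^+ 2 * remainder 0 (rho, x) a b) * lam x b.
Proof.
move=> Ux; have [_ xc] := (region_pt _ _ _).1 Ux.
have r1 := region_neq0 r0p Ux.
have := F3E Ux; rewrite radius_pt tail_pt F1E// F2E// h0_frame !pullback2_frame.
rewrite -!/(in_frame _ _) -/(h1f x) -/(h2f x).
have -> : F3 (pt rho (embed x)) = dF3 0 (pt rho (embed x)).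
  by apply/matrixP => mu nu; rewrite mxE.
rewrite -/(remainder 0 (rho, x)) => /matrixP /(_ a b).
move: (diag_conj_entry (lame x) eta a b) (diag_conj_entry (lame x) (h1f x) a b)
  (diag_conj_entry (lame x) (h2f x) a b) (diag_conj_entry (lame x) (remainder 0 (rho, x)) a b).
rewrite -!/(lam x _).
move: (diag_mx (lame x) *m eta *m diag_mx (lame x)) (diag_mx (lame x) *m h1f x *m diag_mx (lame x))
  (diag_mx (lame x) *m h2f x *m diag_mx (lame x))
  (diag_mx (lame x) *m remainder 0 (rho, x) *m diag_mx (lame x)) (h (pt rho x))
  (lam x a) (lam x b) (eta a b) (h1f x a b) (h2f x a b) (remainder 0 (rho, x) a b).
move=> A0 A1 A2 A3 hh l l' e w1 w2 w3 E0 E1 E2 E3; rewrite !mxE E0 E1 E2 E3.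
move: (hh a b) => w E.
have -> : w = rho ^+ 2 * (rho ^- 2 * w) by field.
by rewrite -[rho ^- 2 * w](subrK (l * e * l' + rho^-1 * (l * w1 * l') + rho ^- 2 * (l * w2 * l'))) E; field.
Qed.

Variable rho1 : R.
Hypothesis thr : threshold rho1.

Lemma strip_region rho x : rho1 < rho -> strip x -> region r0 (pt rho x).
Proof. by case: thr => _ H _ _; exact: H. Qed.

Lemma remainder_is_derive k rho x a b : rho1 < rho -> strip x ->
  is_derive rho (1 : R) (fun r => remainder k (r, x) a b) (remainder k.+1 (rho, x) a b).
Proof.
move=> r1 [xc xT].
have D mu nu : is_derive rho (1 : R) (fun r => dF3 k (pt r (embed x)) mu nu)
    (dF3 k.+1 (pt rho (embed x)) mu nu).
  rewrite (_ : (fun r => _) = fun r => pds (nseq k r4) (fun p : 'rV[R]_(1 + 4) => F3 p mu nu) (pt r (embed x))).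
    apply/is_derive_radial; rewrite mxE; case: thr => _ _ H _.
    have [|Hd _] := H mu nu rho (embed x) (nseq k r4) r1; first by rewrite ler_wpDr ?embed_bound.
    exact: derivable_pd (Hd r4).
  by apply: funext => r; rewrite mxE.
have E r j : remainder j (r, x) a b =
    \sum_nu \sum_mu frame x a mu * dF3 j (pt r (embed x)) mu nu * frame x b nu.
  rewrite mxE; apply: eq_bigr => nu _; rewrite [in LHS]mxE mulr_suml.
  by apply: eq_bigr => mu _; rewrite [_^T _ _]mxE.
rewrite (_ : (fun r => _) = fun r => \sum_nu \sum_mu frame x a mu * dF3 k (pt r (embed x)) mu nu * frame x b nu).
  rewrite E; apply: is_derive_funsum => nu; apply: is_derive_funsum => mu.
  apply: is_derive_eq (is_derive_funM (is_derive_funZ _ (D mu nu)) (is_derive_cstfun _ _ _)) _.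
  by rewrite mulr0 addr0.
by apply: funext => r; rewrite E.
Qed.

Lemma remainder_bigO k : mxO (3 + k) (remainder k).
Proof.
have F : mxO (3 + k) (fun z => dF3 k (pt z.1 (embed z.2))).
  move=> mu nu; have := symbol_bigO T (nseq k r4) (F3_symbol mu nu).
  have -> : count_mem r4 (nseq k r4) = k.
    rewrite -[RHS](size_nseq k r4); apply/eqP; rewrite -all_count.
    by apply/all_pred1P; rewrite size_nseq.
  by apply: bigO_ext => z; rewrite mxE.
by have := mxO_mul (mxO_mul (frame_bigO T) F) (mxO_trmx (frame_bigO T)); rewrite addn0.
Qed.

(** [G1] and [G2] are the first two radial derivatives of rho^2 times the remainder, of orders
    rho^-2 and rho^-3. *)
Definition G1 z : 'M[R]_3 := (2 * z.1) *: remainder 0 z + z.1 ^+ 2 *: remainder 1 z.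
Definition G2 z : 'M[R]_3 :=
  2 *: remainder 0 z + (4 * z.1) *: remainder 1 z + z.1 ^+ 2 *: remainder 2 z.

Lemma near_radial rho x : rho1 < rho -> strip x ->
  \forall r \near rho, rho1 < r /\ region r0 (pt r x).
Proof.
move=> r1 xs; have : \forall r \near rho, rho1 < r by exact: lt_nbhsr.
by apply: filterS => r rr1; split=> //; case: thr => _ H _ _; exact: H.
Qed.

Lemma h_dradial rho x a b : rho1 < rho -> strip x ->
  dmx h rr (pt rho x) a b =
  lam x a * (2 * rho * eta a b + h1f x a b + G1 (rho, x) a b) * lam x b.
Proof.
move=> r1 xs; rewrite mxE; apply: is_derive_pd; apply/is_derive_radial.
have NR := near_radial r1 xs.
have D0 := remainder_is_derive 0 a b r1 xs.
have I := @is_derive_id R R rho 1.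
have DD := is_derive_funM (is_derive_funZ (lam x a) (is_derive_funD (is_derive_funD (is_derive_funD
  (is_derive_funM (is_derive_funX2 I) (is_derive_cstfun (eta a b) rho (1 : R)))
  (is_derive_funM I (is_derive_cstfun (h1f x a b) _ _)))
  (is_derive_cstfun (h2f x a b) _ _))
  (is_derive_funM (is_derive_funX2 I) D0))) (is_derive_cstfun (lam x b) _ _).
have E : {near (rho : R), (fun r : R => lam x a * (r ^+ 2 * eta a b + r * h1f x a b + h2f x a b
    + r ^+ 2 * remainder 0 (r, x) a b) * lam x b) =1 (fun r => h (pt r x) a b)}.
  by apply: filterS NR => r [_ Ur]; rewrite h_expansion.
apply: (near_eq_is_derive E).
apply: is_derive_eq DD _; rewrite /G1 /G2 !(mxDE, mxZE); change (rho, x).1 with rho.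
by ring.
Qed.

Lemma h_dradial2 rho x a b : rho1 < rho -> strip x ->
  is_derive rho (1 : R) (fun r => dmx h rr (pt r x) a b)
   (lam x a * (2 * eta a b + G2 (rho, x) a b) * lam x b).
Proof.
move=> r1 xs.
have NR := near_radial r1 xs.
have D0 := remainder_is_derive 0 a b r1 xs.
have D1 := remainder_is_derive 1 a b r1 xs.
have I := @is_derive_id R R rho 1.
have DD := is_derive_funM (is_derive_funZ (lam x a) (is_derive_funD (is_derive_funD
  (is_derive_funM (is_derive_funZ 2 I) (is_derive_cstfun (eta a b) rho (1 : R)))
  (is_derive_cstfun (h1f x a b) _ _))
  (is_derive_funD (is_derive_funM (is_derive_funZ 2 I) D0)
    (is_derive_funM (is_derive_funX2 I) D1)))) (is_derive_cstfun (lam x b) _ _).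
apply: near_eq_is_derive (is_derive_eq DD _).
  apply: filterS NR => r [rr1 _]; rewrite h_dradial// /G1 !(mxDE, mxZE); change (r, x).1 with r.
  by ring.
rewrite /G1 /G2 !(mxDE, mxZE); change (rho, x).1 with rho; ring.
Qed.

Let sg z := sigma z.2.
Let h1z z := h1f z.2.

Lemma bsN_lapse rho x : bsN sigma (pt rho x) = lapse sg (rho, x).
Proof. by rewrite /bsN /lapse radius_pt tail_pt /inv_radius mulrC. Qed.

Lemma extK_frame rho x a b : rho1 < rho -> strip x ->
  extK N h (pt rho x) a b = lam x a * frameK sg h1z G1 (rho, x) a b * lam x b.
Proof.
move=> r1 xs; rewrite extKE (h_dradial _ _ r1 xs) /N bsN_lapse (frameK_entry sg h1z G1 (rho, x) a b) /h1z.
change (rho, x).1 with rho; change (rho, x).2 with x.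
by move: (eta a b) (h1f x a b) (G1 _ a b) (_^-1) => c d e f; ring.
Qed.

Lemma dextK_frame rho x a b : rho1 < rho -> strip x ->
  dextK N h (pt rho x) a b = lam x a * framedK sg h1z G1 G2 (rho, x) a b * lam x b.
Proof.
move=> r1 xs; rewrite mxE; apply: is_derive_pd; apply/is_derive_radial.
have Ux := strip_region r1 xs.
have xc := xs.1.
have rn := region_neq0 r0p Ux.
have n0 : 2 * N (pt rho x) != 0 by rewrite mulf_neq0 ?N_neq0.
have DN : is_derive rho (1 : R) (fun r => N (pt r x)) (- (sigma x * rho ^- 2)).
  apply/is_derive_radial; have := bsN_is_derive sigma_smooth rr rn xc.
  by rewrite (unsplitK (inl _ ord0)).
have DD := is_derive_funM (@is_derive_funV _ _ (fun r : R => 2 * N (pt r x)) rho 1 _ n0 (is_derive_funZ 2 DN)) (h_dradial2 a b r1 xs).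
rewrite (_ : (fun r => _) = fun r => (2 * N (pt r x))^-1 * dmx h rr (pt r x) a b); last first.
  by apply: funext => r; rewrite extKE.
apply: is_derive_eq DD _; rewrite (h_dradial _ _ r1 xs) (framedK_entry sg h1z G1 G2 (rho, x) a b).
move: n0; rewrite /N !bsN_lapse /inv_radius /sg /h1z.
change (rho, x).1 with rho; change (rho, x).2 with x.
rewrite mulf_eq0 negb_or => /andP[t0 n0]; exact: radial_quotient_rule.
Qed.

Lemma hessN_slice rho x a b : region r0 (pt rho x) ->
  hessN N h (pt rho x) a b = rho^-1 * hessian (slice h rho) sigma x a b.
Proof.
move=> Ux; have [_ xc] := (region_pt _ _ _).1 Ux.
have rn := region_neq0 r0p Ux.
have D c y : chart y -> pd (tg c) N (pt rho y) = rho^-1 * pd c sigma y.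
  move=> yc; apply: is_derive_pd.
  have := bsN_is_derive sigma_smooth (tg c) rn yc.
  by rewrite (unsplitK (inr _ c)) mulrC.
have DD : pd (tg b) (pd (tg a) N) (pt rho x) = rho^-1 * pd b (pd a sigma) x.
  apply: is_derive_pd; apply/is_derive_slice.
  apply: (near_eq_is_derive (f := fun y => rho^-1 * pd a sigma y)).
    by apply: filterS (chart_open xc) => y yc; rewrite D.
  apply: is_derive_funZ; apply: chart_smooth_is_derive => //; exact: chart_smooth_pd.
rewrite hessNE DD hessianE mulrBr mulr_sumr (chart_smooth_pd_comm _ _ sigma_smooth xc).
congr (_ - _); apply: eq_bigr => c _; rewrite D// /slice slice_christoffel.
by move: (gam _ _ _ _ _) => u; ring.
Qed.

(** An ambient representative of rho^-2 h. The fields [F1], [F2], [F3] need not be symmetric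
    although h is; passing to the symmetric part keeps the pull-back ([h_FF]) and meets the symmetry
    hypothesis of [hessian_frame]. *)
Definition FF rho (Y : 'rV[R]_4) : 'M[R]_4 :=
  symm (eta4 + rho^-1 *: F1 Y + rho ^- 2 *: F2 Y + F3 (pt rho Y)).
Definition pdmx l (F : 'rV[R]_4 -> 'M[R]_4) (Y : 'rV[R]_4) : 'M[R]_4 :=
  \matrix_(mu, nu) pd l (fun y => F y mu nu) Y.
Definition dF3t l (q : 'rV[R]_(1 + 4)) : 'M[R]_4 :=
  \matrix_(mu, nu) pds [:: rshift 1 l] (fun p : 'rV[R]_(1 + 4) => F3 p mu nu) q.
Definition dFF rho (Y : 'rV[R]_4) l : 'M[R]_4 :=
  symm (rho^-1 *: pdmx l F1 Y + rho ^- 2 *: pdmx l F2 Y + dF3t l (pt rho Y)).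
Definition Hf z : 'M[R]_3 := in_frame z.2 (FF z.1 (embed z.2)).

Lemma pullback2_in_frame x A a b : pullback2 x A a b = lam x a * in_frame x A a b * lam x b.
Proof. by rewrite pullback2_frame diag_conj_entry. Qed.

Lemma in_frame_eta4 x : in_frame x eta4 = eta.
Proof. exact: frame_eta4. Qed.

Lemma h_FF rho x : region r0 (pt rho x) ->
  h (pt rho x) = pullback2 x (rho ^+ 2 *: FF rho (embed x)).
Proof.
move=> Ux; have rn := region_neq0 r0p Ux.
pose A := eta4 + rho^-1 *: F1 (embed x) + rho ^- 2 *: F2 (embed x) + F3 (pt rho (embed x)).
have E a b : h (pt rho x) a b = lam x a * (rho ^+ 2 * in_frame x A a b) * lam x b.
  rewrite h_expansion// /A !in_frameD !in_frameZ in_frame_eta4 !(mxDE, mxZE).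
  rewrite /remainder; change (rho, x).2 with x; change (rho, x).1 with rho.
  rewrite -/(h1f x) -/(h2f x) (_ : dF3 0 (pt rho (embed x)) = F3 (pt rho (embed x))).
    move: (lam x a) (lam x b) (eta a b) (h1f x a b) (h2f x a b) (in_frame _ _ _ _).
    by move=> l l' e w1 w2 w3; field.
  by apply/matrixP => mu nu; rewrite mxE.
apply/matrixP => a b; rewrite pullback2_in_frame in_frameZ mxZE in_frame_symm -/A.
have := hsym Ux => /matrixP /(_ a b); rewrite mxE !E /symm mxZE mxDE [_^T _ _]mxE => E2.
move: E2; move: (lam x a) (lam x b) (in_frame x A a b) (in_frame x A b a) => l l' w w' E2.
have -> : l * (rho ^+ 2 * (2^-1 * (w + w'))) * l' =
  2^-1 * (l * (rho ^+ 2 * w) * l' + l' * (rho ^+ 2 * w') * l) by ring.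
by rewrite E2; field.
Qed.

Lemma Hf_conj rho x : region r0 (pt rho x) -> h (pt rho x) =
  diag_mx (lame x) *m (rho ^+ 2 *: Hf (rho, x)) *m diag_mx (lame x).
Proof. by move=> Ux; rewrite h_FF// pullback2_frame -/(in_frame _ _) in_frameZ. Qed.

Lemma Hf_unit rho x : region r0 (pt rho x) -> Hf (rho, x) \in unitmx.
Proof.
move=> Ux; have := h_unit Ux; rewrite Hf_conj// !unitmx_mul => /andP[/andP[_ U] _].
move: U; rewrite unitmxZ// unitfE expf_eq0 /=.
by move: (lt0r_neq0 (region_radius r0p Ux)); rewrite radius_pt.
Qed.

Lemma Hf_expansion rho x a b : region r0 (pt rho x) ->
  Hf (rho, x) a b = eta a b + rho^-1 * h1f x a b + rho ^- 2 * h2f x a b + remainder 0 (rho, x) a b.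
Proof.
move=> Ux; have [_ xc] := (region_pt _ _ _).1 Ux.
have rn := region_neq0 r0p Ux.
have := h_expansion a b Ux; rewrite Hf_conj// diag_conj_entry -!/(lam x _) mxZE.
have l1 : lam x a != 0 := lame_neq0 a xc; have l2 : lam x b != 0 := lame_neq0 b xc.
move=> /(mulIf l2) /(mulfI l1).
move: (Hf _ a b) (eta a b) (h1f x a b) (h2f x a b) (remainder _ _ a b) => w e w1 w2 w3 E.
have -> : w = rho ^- 2 * (rho ^+ 2 * w) by field.
by rewrite E; field.
Qed.

Lemma near_norm (Y : 'rV[R]_4) (M : R) : `|Y| <= M -> \forall y \near Y, `|y| <= M + 1.
Proof.
move=> YM; have H := nbhsx_ballx Y 1 ltr01; rewrite -ball_normE in H.
apply: filterS H => y /ltW yY; rewrite -(subrK Y y) (le_trans (ler_normD _ _))// addrC lerD//.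
by rewrite distrC.
Qed.

Lemma FF_is_derive rho (Y : 'rV[R]_4) l mu nu : rho1 < rho -> `|Y| <= expR T + 1 ->
  is_derive Y (dirv l) (fun y => FF rho y mu nu) (dFF rho Y l mu nu).
Proof.
move=> r1 YM.
have D a b : is_derive Y (dirv l) (fun y => eta4 a b + rho^-1 * F1 y a b + rho ^- 2 * F2 y a b
     + F3 (pt rho y) a b)
   (0 + rho^-1 * pdmx l F1 Y a b + rho ^- 2 * pdmx l F2 Y a b + dF3t l (pt rho Y) a b).
  rewrite ![pdmx _ _ _ _ _]mxE [dF3t _ _ _ _]mxE.
  apply: is_derive_funD; first apply: is_derive_funD; first apply: is_derive_funD.
  - by apply: is_derive_funZ; apply: derivable_pd; exact: (@smooth_on_derivable R _ _ _ Y l (F1_smooth a b) I).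
  - by apply: is_derive_funZ; apply: derivable_pd; exact: (@smooth_on_derivable R _ _ _ Y l (F2_smooth a b) I).
  apply/(is_derive_slice (fun p : 'rV[R]_(1 + 4) => F3 p a b)); apply: derivable_pd.
  case: thr => _ _ H _; have [] := H a b rho Y [::] r1 YM.
  by move=> /(_ (rshift 1 l)).
rewrite (_ : (fun y => _) = fun y => 2^-1 * ((eta4 mu nu + rho^-1 * F1 y mu nu + rho ^- 2 * F2 y mu nu
     + F3 (pt rho y) mu nu) + (eta4 nu mu + rho^-1 * F1 y nu mu + rho ^- 2 * F2 y nu mu
     + F3 (pt rho y) nu mu))).
  apply: is_derive_eq (is_derive_funZ 2^-1 (is_derive_funD (D mu nu) (D nu mu))) _.
  by rewrite /dFF /symm mxZE mxDE [_^T _ _]mxE !(mxDE, mxZE) !add0r.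
by apply: funext => y; rewrite /FF /symm mxZE mxDE [_^T _ _]mxE !(mxDE, mxZE).
Qed.

Lemma dFF_continuous rho (Y : 'rV[R]_4) l mu nu : rho1 < rho -> `|Y| <= expR T + 1 ->
  {for Y, continuous (fun y => dFF rho y l mu nu)}.
Proof.
move=> r1 YM.
have D a b : {for Y, continuous (fun y => rho^-1 * pd l (fun y => F1 y a b) y
   + rho ^- 2 * pd l (fun y => F2 y a b) y + pds [:: rshift 1 l] (fun p : 'rV[R]_(1 + 4) => F3 p a b) (pt rho y))}.
  apply: continuous_funD; first apply: continuous_funD.
  - apply: continuous_funM; first exact: continuous_cstfun.
    exact: (smooth_on_continuous (smooth_on_pd l (F1_smooth a b)) I).
  - apply: continuous_funM; first exact: continuous_cstfun.
    exact: (smooth_on_continuous (smooth_on_pd l (F2_smooth a b)) I).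
  by case: thr => _ _ H _; have [] := H a b rho Y [:: rshift 1 l] r1 YM.
rewrite (_ : (fun y => _) = fun y => 2^-1 * ((rho^-1 * pd l (fun y => F1 y mu nu) y
   + rho ^- 2 * pd l (fun y => F2 y mu nu) y + pds [:: rshift 1 l] (fun p : 'rV[R]_(1 + 4) => F3 p mu nu) (pt rho y))
  + (rho^-1 * pd l (fun y => F1 y nu mu) y
   + rho ^- 2 * pd l (fun y => F2 y nu mu) y + pds [:: rshift 1 l] (fun p : 'rV[R]_(1 + 4) => F3 p nu mu) (pt rho y)))).
  apply: continuous_funM; first exact: continuous_cstfun.
  by apply: continuous_funD; exact: D.
apply: funext => y; rewrite /dFF /symm mxZE mxDE [_^T _ _]mxE !(mxDE, mxZE).
by rewrite ![pdmx _ _ _ _ _]mxE ![dF3t _ _ _ _]mxE.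
Qed.

Definition dFFv rho Y (v : 'rV[R]_4) : 'M[R]_4 := \sum_l v 0 l *: dFF rho Y l.
Definition Sf z : 'M[R]_3 := frame_hess (frame z.2) (embed z.2) (grad4 z.2 Fs) (hess4 z.2 Fs)
  (FF z.1 (embed z.2)) (dFFv z.1 (embed z.2)).

(** The slice metric is the pull-back of rho^2 [FF], and [frame_hess_scale] removes the factor. The
    equality with the pull-back is needed on a neighbourhood, hence the continuity of [r0]. *)
Lemma hessian_slice_frame rho x : rho1 < rho -> strip x ->
  hessian (slice h rho) sigma x = diag_mx (lame x) *m Sf (rho, x) *m diag_mx (lame x).
Proof.
move=> r1 xs; have [xc xT] := xs.
have Ux := strip_region r1 xs.
have rn := region_neq0 r0p Ux.
have r2 : rho ^+ 2 != 0 by rewrite expf_eq0.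
pose Phi (y : 'rV[R]_4) := rho ^+ 2 *: FF rho y.
have PD (Y : 'rV[R]_4) l mu nu : `|Y| <= expR T + 1 ->
    is_derive Y (dirv l) (fun y => Phi y mu nu) (rho ^+ 2 * dFF rho Y l mu nu).
  move=> YM; rewrite (_ : (fun y => _) = fun y => rho ^+ 2 * FF rho y mu nu).
    by apply: is_derive_funZ; exact: FF_is_derive.
  by apply: funext => y; rewrite /Phi mxZE.
have NN := near_norm (embed_bound xT).
have YM : `|embed x| <= expR T + 1 by rewrite ler_wpDr ?embed_bound.
rewrite (hessian_frame xc Fs_smooth FsE (Phi := Phi)).
- congr (_ *m _ *m _); rewrite /Sf; change (rho, x).2 with x; change (rho, x).1 with rho.
  have -> : dambient x Phi = fun v => rho ^+ 2 *: dFFv rho (embed x) v.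
    apply: funext => v; rewrite /dambient /dFFv scaler_sumr; apply: eq_bigr => l _.
    rewrite scalerA mulrC -scalerA; congr (_ *: _); apply/matrixP => mu nu.
    by rewrite mxE mxZE; apply: is_derive_pd; exact: PD.
  rewrite /Phi frame_hess_scale//; first exact: (Hf_unit Ux).
  by move=> t v; rewrite /dFFv scaler_sumr; apply: eq_bigr => l _; rewrite mxE scalerA.
- have rc : {for x, continuous (fun y : 'rV[R]_3 => r0 (tau y))}.
    exact: (continuous_comp1 (f := @tau R) r0c (@continuous_coord _ _ x o0)).
  have N1 : \forall y \near x, r0 (tau y) < rho.
    by apply: (cvgr_lt _ rc); have /region_pt[] := Ux.
  by apply: filterS (filterI N1 (chart_open xc)) => y [y1 yc]; rewrite /slice h_FF//; exact/region_pt.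
- by apply: filterS NN => y yM mu nu l; have [] := PD y l mu nu yM.
- move=> mu nu l; apply: (continuous_eq_near (g := fun y => rho ^+ 2 * dFF rho y l mu nu)).
    by apply: filterS NN => y yM; symmetry; apply: is_derive_pd; exact: PD.
  by apply: continuous_funM; [exact: continuous_cstfun|exact: dFF_continuous].
- by rewrite /Phi linearZ /= /FF symmT.
- rewrite -/(in_frame _ _) in_frameZ unitmxZ ?unitfE//; exact: (Hf_unit Ux).
Qed.

Lemma bigO_radiusX n m (f : R * 'rV[R]_3 -> R) : bigO (n + m) f -> bigO m (fun z => z.1 ^+ n * f z).
Proof.
move=> [C H]; exists C; apply: ev_imp H _ => z z1 _ hz.
have z0 : 0 < z.1 := lt_trans ltr01 z1.
have zn : 0 <= z.1 ^+ n by rewrite exprn_ge0// ltW.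
rewrite normrM (ger0_norm zn); apply: le_trans (ler_wpM2l zn hz) _.
rewrite mulrCA le_eqVlt; apply/orP; left; apply/eqP; congr (_ * _).
by rewrite exprD invfM mulrA mulfV ?mul1r// expf_neq0// lt0r_neq0.
Qed.

Lemma mxO_radius m a b c (A : R * 'rV[R]_3 -> 'M[R]_(a, b)) :
  mxO m.+1 A -> mxO m (fun z => (c * z.1) *: A z).
Proof.
move=> H i j; have := bigO_mul (bigO_cst strip c) (@bigO_radiusX 1 m _ (H i j)).
by apply: bigO_ext => z; rewrite mxZE expr1 mulrA.
Qed.

Lemma mxO_radius2 m a b (A : R * 'rV[R]_3 -> 'M[R]_(a, b)) :
  mxO m.+2 A -> mxO m (fun z => z.1 ^+ 2 *: A z).
Proof.
by move=> H i j; apply: bigO_ext (@bigO_radiusX 2 m _ (H i j)) => z; rewrite mxZE.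
Qed.

Lemma in_frame_bigO m (A : R * 'rV[R]_3 -> 'M[R]_4) : mxO m A -> mxO m (fun z => in_frame z.2 (A z)).
Proof.
by move=> H; have := mxO_mul (mxO_mul (frame_bigO T) H) (mxO_trmx (frame_bigO T)); rewrite addn0.
Qed.

Lemma ev_threshold (P : R * 'rV[R]_3 -> Prop) :
  (forall rho x, rho1 < rho -> strip x -> P (rho, x)) -> ev P.
Proof. by move=> H; case: thr => t1 _ _ _; exists rho1 => // -[rho x] r1 xs; exact: H. Qed.

Lemma sg_bigO : bigO 0 sg.
Proof.
apply: bigO_eq (ambient_bigO T Fs_smooth); apply: ev_threshold => rho x _ [xc _].
by rewrite /sg /= FsE.
Qed.

Lemma ambient_mxO (F : 'rV[R]_4 -> 'M[R]_4) : (forall mu nu, smooth_on setT (fun y => F y mu nu)) ->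
  mxO 0 (fun z => F (embed z.2)).
Proof. by move=> H mu nu; exact: (ambient_bigO T (H mu nu)). Qed.

Lemma h1z_bigO : mxO 0 h1z.
Proof. exact: (in_frame_bigO (ambient_mxO F1_smooth)). Qed.

Lemma Hf_bigO : mxO 2 (fun z => Hf z - eta - inv_radius z *: h1z z).
Proof.
apply: (mxO_eq (B := fun z => inv_radius z ^+ 2 *: h2f z.2 + remainder 0 z)).
  apply: ev_threshold => rho x r1 xs.
  have Ux := strip_region r1 xs.
  apply/matrixP => a b; rewrite !mxDE !mxNE !mxZE (Hf_expansion _ _ Ux) /inv_radius /h1z.
  change (rho, x).1 with rho; change (rho, x).2 with x; rewrite exprVn.
  by move: (eta a b) (h1f _ _ _) (h2f _ _ _) (remainder _ _ _ _) => e w1 w2 w3; ring.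
apply: mxO_add; last by have := mxO_weak (isT : (2 <= 3)%N) (remainder_bigO 0).
by have := mxO_scale (bigO_uX strip 2) (in_frame_bigO (ambient_mxO F2_smooth)).
Qed.

Lemma G1_bigO : mxO 2 G1.
Proof.
apply: mxO_add; first exact: (mxO_radius 2 (remainder_bigO 0)).
exact: (mxO_radius2 (remainder_bigO 1)).
Qed.

Lemma G2_bigO : mxO 3 G2.
Proof.
apply: mxO_add; last exact: (mxO_radius2 (remainder_bigO 2)).
apply: mxO_add; last exact: (mxO_radius 4 (remainder_bigO 1)).
by have := mxO_scale (bigO_cst strip 2) (remainder_bigO 0).
Qed.

Lemma symm_bigO m (A : R * 'rV[R]_3 -> 'M[R]_4) : mxO m A -> mxO m (fun z => symm (A z)).
Proof.
move=> H; have := mxO_scale (bigO_cst strip 2^-1) (mxO_add H (mxO_trmx H)).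
exact: mxO_ext.
Qed.

Lemma FF_bigO : mxO 1 (fun z => FF z.1 (embed z.2) - eta4).
Proof.
have F30 : mxO 3 (fun z => F3 (pt z.1 (embed z.2))).
  by move=> mu nu; exact: (symbol_bigO T [::] (F3_symbol mu nu)).
have A1 := mxO_scale (bigO_u strip) (ambient_mxO F1_smooth).
have A2 := mxO_scale (bigO_uX strip 2) (ambient_mxO F2_smooth).
have A := mxO_add (mxO_add A1 (mxO_weak (isT : (1 <= 2)%N) A2)) (mxO_weak (isT : (1 <= 3)%N) F30).
apply: mxO_ext (symm_bigO A) => z; rewrite /FF.
have s4 : symm eta4 = eta4 by apply: symm_id; rewrite tr_diag_mx.
rewrite -[in X in _ - X]s4; apply/matrixP => mu nu.
rewrite mxDE mxNE !mxZE !mxDE !mxZE ![_^T _ _]mxE !mxDE !mxZE /inv_radius exprVn.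
move: (eta4 mu nu) (eta4 nu mu) (F1 _ mu nu) (F1 _ nu mu) (F2 _ mu nu) (F2 _ nu mu) (F3 _ mu nu) (F3 _ nu mu).
by move=> *; ring.
Qed.

Lemma dFF_bigO l : mxO 1 (fun z => dFF z.1 (embed z.2) l).
Proof.
have F30 : mxO 3 (fun z => dF3t l (pt z.1 (embed z.2))).
  move=> mu nu; have := symbol_bigO T [:: rshift 1 l] (F3_symbol mu nu).
  by apply: bigO_ext => z; rewrite mxE.
have D (F : 'rV[R]_4 -> 'M[R]_4) : (forall mu nu, smooth_on setT (fun y => F y mu nu)) -> mxO 0 (fun z => pdmx l F (embed z.2)).
  move=> HF mu nu; apply: bigO_ext (ambient_bigO T (smooth_on_pd l (HF mu nu))) => z.
  by rewrite mxE.
have A1 := mxO_scale (bigO_u strip) (D _ F1_smooth).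
have A2 := mxO_scale (bigO_uX strip 2) (D _ F2_smooth).
have A := mxO_add (mxO_add A1 (mxO_weak (isT : (1 <= 2)%N) A2)) (mxO_weak (isT : (1 <= 3)%N) F30).
by apply: mxO_ext (symm_bigO A) => z; rewrite /dFF /inv_radius exprVn.
Qed.

Lemma Hf_bigO0 : mxO 1 (fun z => Hf z - eta) /\ mxO 0 Hf.
Proof.
have H0 : mxO 1 (fun z => Hf z - eta).
  have A := mxO_scale (bigO_u strip) h1z_bigO.
  apply: mxO_ext (mxO_add (mxO_weak (isT : (1 <= 2)%N) Hf_bigO) A) => z.
  by rewrite subrK.
split=> //; apply: mxO_ext (mxO_add (mxO_weak (isT : (0 <= 1)%N) H0) (mxO_cst strip eta)) => z.
by rewrite subrK.
Qed.

Lemma det_Hf_bound : ev (fun z => 2^-1 <= `|\det (Hf z)|).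
Proof.
have B := det_bigO1 Hf_bigO0.2 (mxO_cst strip eta) Hf_bigO0.1.
have c0 : 0 < (2^-1 : R) by rewrite invr_gt0.
apply: ev_imp (bigO1_small c0 B) _ => z _ _; rewrite det_eta; move: (\det _) => d.
by rewrite ler_norml ler_normr => /andP[d1 d2]; apply/orP; right; lra.
Qed.

Lemma invHf_bigO : mxO 0 (fun z => invmx (Hf z)).
Proof.
by apply: (invmx_bigO (c := 2^-1)); [rewrite invr_gt0|exact: Hf_bigO0.2|exact: det_Hf_bound].
Qed.

Lemma invHf_bigO1 : mxO 1 (fun z => invmx (Hf z) - eta).
Proof.
have A := mxO_opp (mxO_mul (mxO_mul invHf_bigO Hf_bigO0.1) (mxO_cst strip eta)).
apply: mxO_eq A; apply: ev_threshold => rho x r1 xs.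
have Ux := strip_region r1 xs.
have U := Hf_unit Ux.
by rewrite mulmxBr mulVmx// mulmxBl mul1mx -mulmxA eta_eta mulmx1 opprB.
Qed.

Lemma invmx_eta : invmx eta = eta.
Proof.
have [U1 U2] := mulmx1_unit (@eta_eta R).
by rewrite -[LHS]mulmx1 -eta_eta mulmxA mulVmx// mul1mx.
Qed.

Lemma bil_bigO n m1 m2 m3 (A : R * 'rV[R]_3 -> 'M[R]_n) (v w : R * 'rV[R]_3 -> 'rV[R]_n) :
  mxO m1 A -> mxO m2 v -> mxO m3 w -> bigO (m2 + m1 + m3) (fun z => bil (A z) (v z) (w z)).
Proof. by move=> HA Hv Hw; exact: (mxO_mul (mxO_mul Hv HA) (mxO_trmx Hw) 0 0). Qed.

Let gradz z := grad4 z.2 Fs.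
Let hessz z := hess4 z.2 Fs.

Lemma grad_bigO : mxO 0 gradz.
Proof.
move=> i j; apply: bigO_ext (ambient_bigO T (smooth_on_pd j Fs_smooth)) => z.
by rewrite mxE.
Qed.
Lemma hess_bigO : mxO 0 hessz.
Proof.
move=> i j; apply: bigO_ext (ambient_bigO T (smooth_on_pd i (smooth_on_pd j Fs_smooth))) => z.
by rewrite mxE.
Qed.

(** [frame_hess] for the constant ambient metric, whose derivative vanishes: the frame Hessian of
    sigma under [h0] ([hessian_h0_frame]) and the limit of [Sf] ([Sf_bigO]). *)
Definition S0f x : 'M[R]_3 :=
  frame_hess (frame x) (embed x) (grad4 x Fs) (hess4 x Fs) eta4 (fun=> 0).
Let S0z z := S0f z.2.
Let pz z := frame_proj (frame z.2) (gradz z) (FF z.1 (embed z.2)).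
Let p0z z := frame_proj (frame z.2) (gradz z) eta4.

Lemma frame_proj_bigO : [/\ mxO 0 pz, mxO 0 p0z & mxO 1 (fun z => pz z - p0z z)].
Proof.
have A := mxO_mul grad_bigO (mxO_trmx (frame_bigO T)).
have B := mxO_mul (mxO_mul A invHf_bigO) (frame_bigO T).
have C := mxO_mul (mxO_mul A (mxO_cst strip eta)) (frame_bigO T).
have D := mxO_mul (mxO_mul A invHf_bigO1) (frame_bigO T).
have E z : p0z z = gradz z *m (frame z.2)^T *m eta *m frame z.2.
  by rewrite /p0z /frame_proj -/(in_frame _ _) in_frame_eta4 invmx_eta.
split; [exact: B|exact: mxO_ext E C|].
by apply: mxO_ext D => z; rewrite E mulmxBr mulmxBl.
Qed.

Lemma dFFv_bigO (v : R * 'rV[R]_3 -> 'rV[R]_4) : mxO 0 v ->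
  mxO 1 (fun z => dFFv z.1 (embed z.2) (v z)).
Proof.
move=> Hv i j.
apply: (bigO_ext (g := fun z => \sum_l v z 0 l * dFF z.1 (embed z.2) l i j)).
  by move=> z; rewrite /dFFv summxE; apply: eq_bigr => l _; rewrite mxZE.
by apply: bigO_sum => l; exact: (bigO_mul (Hv 0 l) (dFF_bigO l i j)).
Qed.

Lemma frame_row_bigO a : mxO 0 (fun z => row a (frame z.2)).
Proof. by move=> i j; apply: bigO_ext (frame_bigO T a j) => z; rewrite mxE. Qed.

Lemma S0z_bigO : mxO 0 S0z.
Proof.
have [_ Hp0 _] := frame_proj_bigO; move=> a b.
have A := bil_bigO hess_bigO (frame_row_bigO a) (frame_row_bigO b).
have B := bil_bigO (mxO_cst strip eta4) Hp0 (embed_bigO T).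
have C := mxO_mul (embed_bigO T) (mxO_trmx grad_bigO) 0 0.
have D := bigO_add A (bigO_mul (bigO_cst strip (eta a b)) (bigO_sub B C)).
apply: bigO_ext D => z; by rewrite mxE !bil0 subr0 addr0 mulr0 subr0.
Qed.

Lemma Sf_bigO : mxO 1 (fun z => Sf z - S0z z).
Proof.
have [Hp Hp0 Hpp] := frame_proj_bigO; move=> a b.
have A := bil_bigO FF_bigO Hp (embed_bigO T).
have B := bil_bigO (mxO_cst strip eta4) Hpp (embed_bigO T).
have C1 := bil_bigO (dFFv_bigO (frame_row_bigO a)) Hp (frame_row_bigO b).
have C2 := bil_bigO (dFFv_bigO (frame_row_bigO b)) Hp (frame_row_bigO a).
have C3 := bil_bigO (dFFv_bigO Hp) (frame_row_bigO a) (frame_row_bigO b).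
have D := bigO_sub (bigO_mul (bigO_cst strip (eta a b)) (bigO_add A B))
  (bigO_mul (bigO_cst strip 2^-1) (bigO_sub (bigO_add C1 C2) C3)).
apply: bigO_ext D => z; rewrite mxDE mxNE /Sf /S0z /S0f [X in X - _]mxE [X in _ - X]mxE.
rewrite !bil0.
rewrite bilBA bilBl.
rewrite -/(gradz z) -/(pz z) -/(p0z z).
move: (bil _ _ _) (bil _ _ _) (bil _ _ _) (bil _ _ _) (bil _ _ _) (bil _ _ _) (bil _ _ _) (eta a b) ((_ *m _) 0 0).
by move=> *; ring.
Qed.

Lemma S0f_sym x : (S0f x)^T = S0f x.
Proof.
have HS : (hess4 x Fs)^T = hess4 x Fs.
  apply/matrixP => mu nu; rewrite !mxE; apply: pd_comm.
    apply: rV_nearW => y; split=> [k|k l]; first exact: (@smooth_on_derivable R _ _ _ y k Fs_smooth).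
    exact: (@smooth_on_derivable R _ _ _ y l (smooth_on_pd k Fs_smooth)).
  by move=> k l; exact: (smooth_on_continuous (smooth_on_pd k (smooth_on_pd l Fs_smooth)) I).
apply/matrixP => a b; rewrite [LHS]mxE ![S0f x _ _]mxE (bil_sym _ _ HS).
rewrite -[eta b a](_ : eta^T a b = _); last by rewrite mxE.
by rewrite tr_diag_mx; congr (_ + _ - _ * _); rewrite !bil0.
Qed.

Lemma h0_pullback x : h0 x = pullback2 x eta4.
Proof. by rewrite pullback2_frame frame_eta4 h0_frame. Qed.

Lemma hessian_h0_frame x : chart x ->
  hessian h0 sigma x = diag_mx (lame x) *m S0f x *m diag_mx (lame x).
Proof.
move=> xc; rewrite (hessian_frame xc Fs_smooth FsE (Phi := fun=> eta4)).
- congr (_ *m _ *m _); rewrite /S0f; congr (frame_hess _ _ _ _ _ _).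
  apply: funext => v; rewrite /dambient big1// => l _.
  rewrite (_ : \matrix_(_, _) _ = 0) ?scaler0//; apply/matrixP => mu nu; rewrite [LHS]mxE [RHS]mxE.
  exact: is_derive_pd (is_derive_cstfun _ _ _).
- by apply: rV_nearW => y; rewrite h0_pullback.
- by apply: rV_nearW => y mu nu l; have [] := is_derive_cstfun (eta4 mu nu) y (dirv l).
- move=> mu nu l; rewrite (_ : pd l _ = fun=> 0); first exact: continuous_cstfun.
  by apply: funext => y; exact: is_derive_pd (is_derive_cstfun _ _ _).
- by rewrite tr_diag_mx.
- rewrite frame_eta4; exact: (mulmx1_unit eta_eta).1.
Qed.

(** Under the trace the Lamé matrices meet their inverses, so no bound on 1 / sin theta is called
    for. *)
Lemma tr_conj x (A B : 'M[R]_3) : chart x -> A \in unitmx ->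
  \tr (invmx (diag_mx (lame x) *m A *m diag_mx (lame x)) *m (diag_mx (lame x) *m B *m diag_mx (lame x)))
  = \tr (invmx A *m B).
Proof.
move=> xc uA; rewrite invmx_conj ?lame_unit//.
have := lame_unit xc; move: (diag_mx (lame x)) => D uD.
rewrite -!mulmxA (mulmxA (invmx D) D) mulVmx// mul1mx mxtrace_mulC -!mulmxA mulmxV//.
by rewrite mulmx1.
Qed.

Hypotheses (box : forall x, chart x ->
    dalembertian h0 (tensor0 sigma) x [::] + 3 * sigma x = 0)
  (trk : forall x, chart x -> gtrace h0 x (k_of sigma h1 x) = 0).

Lemma eta_unit : eta \in unitmx.
Proof. exact: (mulmx1_unit eta_eta).1. Qed.

Lemma tr_S0f x : chart x -> \tr (eta *m S0f x) = -3 * sigma x.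
Proof.
move=> xc; have := box xc.
have -> : dalembertian h0 (tensor0 sigma) x [::] = \tr (invmx (h0 x) *m hessian h0 sigma x).
  have sI : (invmx (h0 x))^T = invmx (h0 x) by rewrite trmx_inv h0_sym.
  rewrite /dalembertian /contract /mxtrace exchange_big; apply: eq_bigr => c _.
  rewrite mxE; apply: eq_bigr => d _; rewrite -[in RHS]sI [_^T _ _]mxE; congr (_ * _).
  by rewrite [RHS]mxE.
rewrite hessian_h0_frame// h0_frame tr_conj ?eta_unit// invmx_eta => E.
by move: E; move: (\tr _) => t E; lra.
Qed.

Lemma k_frame x : chart x ->
  k_of sigma h1 x = diag_mx (lame x) *m (h1f x + (2 * sigma x) *: eta) *m diag_mx (lame x).
Proof.
move=> xc; apply/matrixP => a b; rewrite /k_of mxDE mxZE F1E// pullback2_in_frame h0_frame.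
rewrite !diag_conj_entry -!/(lam x _) mxDE mxZE -/(h1f x).
by move: (eta a b) (h1f x a b) (lam x a) (lam x b) => *; ring.
Qed.

Lemma h1f_sym x : chart x -> (h1f x)^T = h1f x.
Proof.
move=> xc; apply/matrixP => a b; rewrite mxE.
have := h1_sym xc => /matrixP /(_ b a); rewrite mxE F1E// !pullback2_in_frame -!/(h1f x).
have l1 : lam x a != 0 := lame_neq0 a xc; have l2 : lam x b != 0 := lame_neq0 b xc.
move: (h1f x b a) (h1f x a b) => w w' E.
apply/esym/(mulfI l1)/(mulIf l2); rewrite E; ring.
Qed.

Lemma tr_h1f x : chart x -> \tr (eta *m h1f x) = -6 * sigma x.
Proof.
move=> xc; have := trk xc; rewrite /gtrace k_frame// h0_frame tr_conj ?eta_unit// invmx_eta.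
rewrite mulmxDr mxtraceD -scalemxAr mxtraceZ eta_eta mxtrace1.
by move: (\tr _) => t E; lra.
Qed.

Definition GKf z : 'M[R]_3 := in_frame z.2 (FK (pt z.1 (embed z.2))).

Lemma GKf_bigO : mxO 0 GKf.
Proof. by apply: in_frame_bigO => mu nu; exact: (symbol_bigO T [::] (FK_symbol mu nu)). Qed.

Lemma Khat_frame rho x : region r0 (pt rho x) -> Khat (pt rho x) =
  diag_mx (lame x) *m frameKhat GKf (rho, x) *m diag_mx (lame x).
Proof.
move=> Ux; have := FKE Ux; rewrite radius_pt tail_pt pullback2_frame -/(in_frame _ _).
rewrite -/(GKf (rho, x)) h0_frame => E.
rewrite -[LHS](subrK (rho *: (diag_mx (lame x) *m eta *m diag_mx (lame x)))) E.
rewrite /frameKhat; change (rho, x).1 with rho.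
by rewrite mulmxDr mulmxDl -scalemxAr -scalemxAl addrC.
Qed.

Lemma inv_h rho x : region r0 (pt rho x) -> invmx (h (pt rho x)) =
  invmx (diag_mx (lame x)) *m (rho ^- 2 *: invmx (Hf (rho, x))) *m invmx (diag_mx (lame x)).
Proof.
move=> Ux; have [_ xc] := (region_pt _ _ _).1 Ux; have U := Hf_unit Ux.
have rn := region_neq0 r0p Ux.
have U2 : rho ^+ 2 *: Hf (rho, x) \in unitmx by rewrite unitmxZ// unitfE expf_eq0.
by rewrite Hf_conj// invmx_conj ?lame_unit// (invmxZ U2).
Qed.

Lemma tr_inv_h rho x (B : 'M[R]_3) : region r0 (pt rho x) ->
  \tr (invmx (h (pt rho x)) *m (diag_mx (lame x) *m B *m diag_mx (lame x))) =
  rho ^- 2 * \tr (invmx (Hf (rho, x)) *m B).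
Proof.
move=> Ux; have [_ xc] := (region_pt _ _ _).1 Ux; rewrite inv_h//.
have := lame_unit xc; move: (diag_mx (lame x)) => D uD.
rewrite -!mulmxA (mulmxA (invmx D) D) mulVmx// mul1mx mxtrace_mulC -!mulmxA mulmxV//.
by rewrite mulmx1 -scalemxAl mxtraceZ.
Qed.

Lemma conj_inv_h rho x (A B : 'M[R]_3) : region r0 (pt rho x) ->
  (diag_mx (lame x) *m A *m diag_mx (lame x)) *m invmx (h (pt rho x)) *m
    (diag_mx (lame x) *m B *m diag_mx (lame x)) =
  diag_mx (lame x) *m (rho ^- 2 *: (A *m invmx (Hf (rho, x)) *m B)) *m diag_mx (lame x).
Proof.
move=> Ux; have [_ xc] := (region_pt _ _ _).1 Ux; rewrite inv_h//.
have := lame_unit xc; move: (diag_mx (lame x)) (invmx (Hf _)) => D W uD.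
rewrite -!mulmxA (mulmxA D (invmx D)) mulmxV// mul1mx (mulmxA (invmx D) D) mulVmx// mul1mx.
by rewrite -!scalemxAl -!scalemxAr !mulmxA.
Qed.

Lemma conj_inj x (A B : 'M[R]_3) : chart x ->
  diag_mx (lame x) *m A *m diag_mx (lame x) = diag_mx (lame x) *m B *m diag_mx (lame x) -> A = B.
Proof.
move=> xc /(congr1 (fun M => invmx (diag_mx (lame x)) *m M *m invmx (diag_mx (lame x)))).
have := lame_unit xc; move: (diag_mx (lame x)) => D uD.
by rewrite -!mulmxA !mulKmx// !mulmxA !mulmxK.
Qed.

Hypotheses (flat : ricci_flat r0 (bs_metric sigma h))
  (Keq : forall rho x, region r0 (pt rho x) -> ricci (slice h rho) x =
      gtrace (slice h rho) x (Khat (pt rho x)) *: Khat (pt rho x)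
      - Khat (pt rho x) *m invmx (h (pt rho x)) *m Khat (pt rho x)).

Let Kf := frameK sg h1z G1.
Let Ricf := frameRic sg h1z Hf G1 G2 Sf.

Lemma extK_conj rho x : rho1 < rho -> strip x ->
  extK N h (pt rho x) = diag_mx (lame x) *m Kf (rho, x) *m diag_mx (lame x).
Proof. by move=> r1 xs; apply/matrixP => a b; rewrite extK_frame// diag_conj_entry. Qed.

Lemma ricci_slice_frame rho x : rho1 < rho -> strip x ->
  ricci (slice h rho) x = diag_mx (lame x) *m Ricf (rho, x) *m diag_mx (lame x).
Proof.
move=> r1 xs; have Ux := strip_region r1 xs.
have := adm_ricci_tangential ro N_neq0 h_unit hsym dN ddN h_derivable2 Ux (flat Ux).
rewrite radius_pt tail_pt -/(slice h rho) => ->.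
rewrite extK_conj// tr_inv_h// conj_inv_h//.
have -> : dextK N h (pt rho x) =
    diag_mx (lame x) *m framedK sg h1z G1 G2 (rho, x) *m diag_mx (lame x).
  by apply/matrixP => a b; rewrite dextK_frame// diag_conj_entry.
have -> : hessN N h (pt rho x) =
    diag_mx (lame x) *m (rho^-1 *: Sf (rho, x)) *m diag_mx (lame x).
  apply/matrixP => a b; rewrite hessN_slice// hessian_slice_frame// !diag_conj_entry mxZE.
  by move: (Sf _ a b) (lame x 0 a) (lame x 0 b) => *; ring.
rewrite /Ricf /frameRic /N bsN_lapse -/Kf; change (inv_radius (rho, x)) with (rho^-1); rewrite exprVn.
move: (lapse _ _) (framedK _ _ _ _ _) (Sf _) (Kf _) (invmx _) (\tr _) (diag_mx _) => n K' S K W t D.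
rewrite !mulmxDr !mulmxDl !mulmxN !mulNmx -!scalemxAr -!scalemxAl !scalerA.
by rewrite mulrC.
Qed.

(** The conormal is defined by a square root and equals |N| d rho; positivity of the lapse, which
    [lapse_bound] gives eventually, identifies |N| with N. *)
Lemma extrinsic_extK rho x : region r0 (pt rho x) -> 0 < lapse sg (rho, x) ->
  extrinsic (bs_metric sigma h) (pt rho x) = extK N h (pt rho x).
Proof.
move=> Ux n0; apply/matrixP => a b; rewrite mxE.
have cn q c : conormal (bs_metric sigma h) q (tg c) = 0.
  rewrite /conormal; case: eqP => // E; by have := congr1 val E.
rewrite (_ : (fun q => _) = fun=> 0); last by apply: funext => q; exact: cn.
rewrite (is_derive_pd (is_derive_cstfun 0 _ _)) sub0r sum1d big1 ?addr0; last by move=> c _; rewrite cn mulr0.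
rewrite /conormal eqxx (ig_rr N_neq0 h_unit Ux) (chr_rtt N_neq0 h_unit _ _ Ux).
rewrite /N bsN_lapse -exprVn sqrtr_sqr gtr0_norm ?invr_gt0// invrK.
by move: n0; move: (lapse _ _) (extK _ _ _ _ _) => n K /lt0r_neq0 n0; field.
Qed.

Lemma boundary_density_frame rho x : rho1 < rho -> strip x -> 0 < lapse sg (rho, x) ->
  boundary_density sigma h Khat rho x = `|\det (diag_mx (lame x))| *
   (rho ^+ 3 * Num.sqrt (- \det (Hf (rho, x))) * (rho^-1 ^+ 2 * \tr (invmx (Hf (rho, x)) *m Kf (rho, x))
    - rho^-1 ^+ 2 * \tr (invmx (Hf (rho, x)) *m frameKhat GKf (rho, x)))).
Proof.
move=> r1 xs n0; have Ux := strip_region r1 xs.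
have rp : 0 < rho by move: (region_radius r0p Ux); rewrite radius_pt.
have -> : boundary_density sigma h Khat rho x = Num.sqrt (- \det (h (pt rho x))) *
  (\tr (invmx (h (pt rho x)) *m extrinsic (bs_metric sigma h) (pt rho x))
   - \tr (invmx (h (pt rho x)) *m Khat (pt rho x))) by [].
rewrite extrinsic_extK//.
rewrite extK_conj// Khat_frame// !tr_inv_h// exprVn; rewrite [RHS]mulrA; congr (_ * _).
rewrite Hf_conj// !det_mulmx detZ.
have -> : - (\det (diag_mx (lame x)) * ((rho ^+ 2) ^+ 3 * \det (Hf (rho, x))) * \det (diag_mx (lame x))) =
  (\det (diag_mx (lame x)) * rho ^+ 3) ^+ 2 * (- \det (Hf (rho, x))).
  by move: (\det _) (\det _) => d d'; ring.
by rewrite sqrtrM ?sqr_ge0// sqrtr_sqr normrM (gtr0_norm (exprn_gt0 3 rp)) [RHS]mulrA.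
Qed.

Lemma lagrangian_frame x : chart x -> lagrangian sigma (k_of sigma h1) x =
  3 * sigma x ^+ 2 + \tr (eta *m S0f x *m (eta *m (h1f x + (2 * sigma x) *: eta)))
   - \tr (eta *m S0f x *m (eta *m S0f x)).
Proof.
move=> xc; have C A B : gdot h0 x (diag_mx (lame x) *m A *m diag_mx (lame x))
    (diag_mx (lame x) *m B *m diag_mx (lame x)) = \tr (eta *m A *m (eta *m B^T)).
  rewrite /gdot h0_frame invmx_conj ?lame_unit ?eta_unit// invmx_eta !trmx_mul tr_diag_mx.
  have := lame_unit xc; move: (diag_mx (lame x)) => D uD.
  rewrite -!mulmxA (mulmxA D (invmx D)) mulmxV// mul1mx (mulmxA (invmx D) D) mulVmx// mul1mx.
  rewrite (mulmxA D (invmx D)) mulmxV// mul1mx mxtrace_mulC -!mulmxA mulVmx// mulmx1.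
  by rewrite (mxtrace_mulC eta) !mulmxA.
rewrite /lagrangian hessian_h0_frame// k_frame// !C S0f_sym.
rewrite (_ : (h1f x + (2 * sigma x) *: eta)^T = h1f x + (2 * sigma x) *: eta)//.
by rewrite linearD /= linearZ /= h1f_sym// tr_diag_mx.
Qed.

Lemma sqrt_det_h0 x : Num.sqrt (- \det (h0 x)) = `|\det (diag_mx (lame x))|.
Proof.
rewrite h0_frame !det_mulmx det_eta mulrN1 mulNr opprK -expr2; exact: sqrtr_sqr.
Qed.

(** [frame_density] multiplied by the absolute Lamé determinant, which equals sqrt(-h0) and is
    bounded on the strip. *)
Theorem boundary_density_bigO : bigO 1 (fun z => boundary_density sigma h Khat z.1 z.2
  - 4^-1 * (Num.sqrt (- \det (h0 z.2)) * lagrangian sigma (k_of sigma h1) z.2)).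
Proof.
have KE : ev (fun z => Ricf z =
     (inv_radius z ^+ 2 * \tr (invmx (Hf z) *m frameKhat GKf z)) *: frameKhat GKf z
     - inv_radius z ^+ 2 *: (frameKhat GKf z *m invmx (Hf z) *m frameKhat GKf z)).
  apply: ev_threshold => rho x r1 xs.
  have Ux := strip_region r1 xs.
  apply: (@conj_inj x) (xs.1) _; rewrite -ricci_slice_frame// Keq//.
  have -> : gtrace (slice h rho) x (Khat (pt rho x)) =
    \tr (invmx (h (pt rho x)) *m Khat (pt rho x)) by [].
  rewrite Khat_frame// tr_inv_h// conj_inv_h//.
  change (inv_radius (rho, x)) with (rho^-1); rewrite exprVn.
  by rewrite mulmxBr mulmxBl -!scalemxAr -!scalemxAl.
have HE : ev (fun z => \tr (invmx (Hf z) *m Ricf z) =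
     inv_radius z ^+ 2 * (\tr (invmx (Hf z) *m Kf z) ^+ 2
       - \tr (invmx (Hf z) *m Kf z *m (invmx (Hf z) *m Kf z)))).
  apply: ev_threshold => rho x r1 xs.
  have Ux := strip_region r1 xs.
  have rn := region_neq0 r0p Ux.
  have := hamiltonian_constraint ro N_neq0 h_unit hsym dN ddN h_derivable h_derivable2 Ux (flat Ux).
  rewrite radius_pt tail_pt -/(slice h rho) ricci_slice_frame// extK_conj// -mulmxA mulmxA.
  rewrite -(mulmxA (invmx (h (pt rho x))) _ (invmx _ *m _)) (mulmxA _ (invmx (h (pt rho x))) _) conj_inv_h// !tr_inv_h//.
  change (inv_radius (rho, x)) with (rho^-1); move: (Kf _) (Ricf _) (invmx (Hf _)) => K Ri W.
  rewrite exprVn -scalemxAr mxtraceZ !mulmxA.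
  move: (\tr _) (\tr _) (\tr _) => t1 t2 t3 E.
  have -> : t3 = rho ^+ 2 * (rho ^- 2 * t3) by field.
  by rewrite E; field.
have T1 : ev (fun z => \tr (eta *m h1z z) = -6 * sg z).
  by apply: ev_threshold => rho x r1 xs; exact: tr_h1f xs.1.
have T2 : ev (fun z => \tr (eta *m S0z z) = -3 * sg z).
  by apply: ev_threshold => rho x r1 xs; exact: tr_S0f xs.1.
have M := frame_density sg_bigO h1z_bigO S0z_bigO Hf_bigO G1_bigO G2_bigO Sf_bigO GKf_bigO KE HE T1 T2.
have DB : bigO 0 (fun z => `|\det (diag_mx (lame z.2))|).
  by apply: (bigO_bounded (C := expR T ^+ 2)) => -[rho x] [_ xT]; rewrite normr_id; exact: lame_det_bound.
apply: bigO_eq (bigO_mul DB M).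
have c0 : 0 < (2^-1 : R) by rewrite invr_gt0.
have TT : ev (fun z => strip z.2 /\ rho1 < z.1) by exact: ev_threshold.
apply: ev_imp (ev_and TT (lapse_bound sg_bigO)) _ => -[rho x] _ _ [[xs r1] n0].
rewrite boundary_density_frame//; last exact: lt_le_trans n0.
rewrite lagrangian_frame ?sqrt_det_h0; last exact: xs.1.
rewrite [RHS]mulrBr; congr (_ - _); exact: mulrCA.
Qed.

Lemma lagrangian_bounded : exists C : R, forall x, strip x ->
  `|Num.sqrt (- \det (h0 x)) * lagrangian sigma (k_of sigma h1) x| <= C.
Proof.
have DB : bigO 0 (fun z => `|\det (diag_mx (lame z.2))|).
  by apply: (bigO_bounded (C := expR T ^+ 2)) => -[rho x] [_ xT]; rewrite normr_id; exact: lame_det_bound.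
have HE : mxO 0 (fun=> eta) := mxO_cst strip eta.
have HS := mxO_mul HE S0z_bigO.
have Hk : mxO 0 (fun z => h1z z + (2 * sg z) *: eta).
  by apply: mxO_add h1z_bigO _; have := mxO_scale (bigO_mul (bigO_cst strip 2) sg_bigO) HE.
have A := bigO_mul DB (bigO_sub (bigO_add (bigO_mul (bigO_cst strip 3) (bigO_mul sg_bigO sg_bigO))
  (mxO_tr (mxO_mul HS (mxO_mul HE Hk)))) (mxO_tr (mxO_mul HS HS))).
have [C [r1 r1P H]] := A; exists C => x xs.
(* The function does not involve the radius, so its [bigO 0] bound may be read off at the single
   radius [r1 + 1]. *)
have r11 : r1 < r1 + 1 by rewrite ltrDl.
have := H (r1 + 1, x) r11 xs; rewrite expr0 invr1 mulr1; apply: le_trans.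
by rewrite le_eqVlt; apply/orP; left; apply/eqP; congr `|_|; rewrite lagrangian_frame ?sqrt_det_h0//; case: xs.
Qed.

Lemma pt_continuous rho x : {for x, continuous (fun y : 'rV[R]_3 => pt rho y)}.
Proof.
apply: rV_continuous; apply: ord13P => [|a].
  rewrite (_ : (fun y => _) = fun=> rho); first exact: continuous_cstfun.
  by apply: funext => y; rewrite /pt row_mxEl mxE.
rewrite (_ : (fun y => _) = fun y : 'rV[R]_3 => y 0 a); first exact: continuous_coord.
by apply: funext => y; rewrite /pt row_mxEr.
Qed.

Lemma amb_lam c : ambient_algebra (fun y => lam y c).
Proof.
move: c; apply: ord3P.
- rewrite (_ : (fun y => _) = fun=> 1); first exact: amb_cst.
  by apply: funext => y; rewrite /lam mxE.
- rewrite (_ : (fun y => _) = @chx R); first exact: amb_chx.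
  by apply: funext => y; rewrite /lam mxE.
- rewrite (_ : (fun y => _) = fun y => chx y * snx y).
    by apply: amb_mul; [exact: amb_chx|exact: amb_snx].
  by apply: funext => y; rewrite /lam mxE.
Qed.

Lemma amb_h0 a b : ambient_algebra (fun y : 'rV[R]_3 => h0 y a b).
Proof.
rewrite (_ : (fun y => _) = fun y => lam y a * eta a b * lam y b).
  by apply: amb_mul (amb_lam b); apply: amb_mul (amb_lam a) _; exact: amb_cst.
by apply: funext => y; rewrite h0_frame diag_conj_entry.
Qed.

Lemma continuous_h0 x : continuous_mx (@h0 R) x.
Proof. by move=> a b; exact: amb_continuous (amb_h0 a b). Qed.

(** The regularity of [Khat] along a slice is inherited from the ambient remainder [FK] of its
    expansion. *)
Lemma Khat_continuous rho x : rho1 < rho -> region r0 (pt rho x) -> strip x ->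
  continuous_mx (fun y => Khat (pt rho y)) x.
Proof.
move=> r1 Ux xs a b.
have rc : {for x, continuous (fun y : 'rV[R]_3 => r0 (tau y))}.
  exact: (continuous_comp1 (f := @tau R) r0c (@continuous_coord _ _ x o0)).
have N1 : \forall y \near x, r0 (tau y) < rho.
  by apply: (cvgr_lt _ rc); have /region_pt[] := Ux.
apply: (continuous_eq_near (g := fun y => rho * h0 y a b
   + pullback2 y (FK (pt rho (embed y))) a b)).
  apply: filterS (filterI N1 (chart_open xs.1)) => y [y1 yc].
  have Uy : region r0 (pt rho y) by exact/region_pt.
  have := FKE Uy; rewrite radius_pt tail_pt => /matrixP /(_ a b) <-.
  by rewrite mxDE mxNE mxZE addrC subrK.
apply: continuous_funD.
  by apply: continuous_funM; [exact: continuous_cstfun|exact: continuous_h0].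
have J : continuous_mx (@jac_embed R) x by move=> i j; apply: amb_continuous; exact: amb_jac.
apply: continuous_mulmx; last exact: continuous_trmx.
apply: continuous_mulmx => // mu nu.
case: thr => _ _ _ H.
have := H mu nu rho (embed x) [::] r1 _; rewrite ler_wpDr ?embed_bound//; last by case: xs.
by move=> /(_ isT) Hc; exact: (continuous_comp (@continuous_embed R x) Hc).
Qed.

(** Continuity makes the density measurable on the slabs. *)
Lemma boundary_density_continuous : exists r2 : R, forall rho x, r2 < rho -> chart x -> `|tau x| < T ->
  {for x, continuous (boundary_density sigma h Khat rho)}.
Proof.
have [r2 r2P H2] := lapse_bound sg_bigO.
exists (Num.max r2 rho1) => rho x; rewrite gt_max => /andP[rr2 rr1] xc xT.
have xs : strip x by split=> //; exact: ltW.
have c0 : 0 < (2^-1 : R) by rewrite invr_gt0.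
have reg y : strip y -> region r0 (pt rho y) by move=> ys; case: thr => _ H _ _; exact: H.
have Ux := reg x xs.
have tc : {for x, continuous (fun y : 'rV[R]_3 => `|tau y|)}.
  apply: (continuous_comp1 (f := @tau R) _ (@continuous_coord _ _ x o0)); exact: norm_continuous.
have NS : \forall y \near x, strip y.
  have N1 : \forall y \near x, `|tau y| < T by apply: (cvgr_lt _ tc); exact: xT.
  by apply: filterS (filterI N1 (chart_open xc)) => y [y1 yc]; split=> //; exact: ltW.
apply: (continuous_eq_near (g := fun y => Num.sqrt (- \det (h (pt rho y))) *
  (\tr (invmx (h (pt rho y)) *m extK N h (pt rho y))
    - \tr (invmx (h (pt rho y)) *m Khat (pt rho y))))).
  apply: filterS NS => y ys; rewrite -extrinsic_extK//; first exact: reg.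
  exact: lt_le_trans c0 (H2 (rho, y) rr2 ys).
have hc : continuous_mx (fun y => h (pt rho y)) x.
  by move=> a b; exact: (continuous_comp (@pt_continuous rho x) (smooth_on_continuous (hsmooth a b) Ux)).
have hic := continuous_invmx (h_unit Ux) hc.
apply: continuous_funM.
  by apply: continuous_sqrt; apply: continuous_funN; exact: continuous_det.
apply: continuous_funD.
  apply: continuous_mxtrace; apply: continuous_mulmx => // a b.
  rewrite (_ : (fun y => _) = fun y => (2 * (1 + sigma y * rho^-1))^-1 * dmx h rr (pt rho y) a b); last first.
    by apply: funext => y; rewrite extKE /N /bsN radius_pt tail_pt.
  apply: continuous_funM.
    have n0 : 2 * (1 + sigma x * rho^-1) != 0.
      rewrite mulf_neq0//; have := N_neq0 Ux; by rewrite /N /bsN radius_pt tail_pt.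
    have cc : {for x, continuous (fun y : 'rV[R]_3 => 2 * (1 + sigma y * rho^-1))}.
      apply: continuous_funM; first exact: continuous_cstfun.
      apply: continuous_funD; first exact: continuous_cstfun.
      by apply: continuous_funM; [exact: chart_smooth_continuous|exact: continuous_cstfun].
    exact: (continuous_funV cc n0).
  rewrite (_ : (fun y => _) = fun y => pd rr (fun p => h p a b) (pt rho y)); last first.
    by apply: funext => y; rewrite mxE.
  exact: (continuous_comp (@pt_continuous rho x) (smooth_on_continuous (smooth_on_pd rr (hsmooth a b)) Ux)).
apply: continuous_funN; apply: continuous_mxtrace; apply: continuous_mulmx => //.
exact: Khat_continuous.
Qed.

Lemma continuous_sum_at (D : topologicalType) (I : Type) (r : seq I) (F : I -> D -> R) (x : D) :
  (forall i, {for x, continuous (F i)}) -> {for x, continuous (fun y => \sum_(i <- r) F i y)}.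
Proof.
move=> HF; apply: (closed_sum (Pr := fun f => {for x, continuous f})) => //.
- by move=> c; exact: continuous_cstfun.
- by move=> f g; exact: continuous_funD.
Qed.

Lemma lagrangian_continuous x : chart x ->
  {for x, continuous (fun y => Num.sqrt (- \det (h0 y)) * lagrangian sigma (k_of sigma h1) y)}.
Proof.
move=> xc; have h0c := @continuous_h0 x.
have u0 : h0 x \in unitmx by rewrite h0_frame !unitmx_mul lame_unit// eta_unit.
have h0i := continuous_invmx u0 h0c.
have hess : continuous_mx (hessian h0 sigma) x.
  move=> a b; rewrite (_ : (fun y => _) = fun y => pd a (pd b sigma) y
      - \sum_d christoffel h0 y d a b * pd d sigma y); last first.
    by apply: funext => y; rewrite hessianE.
  apply: continuous_funD.
    by apply: chart_smooth_continuous => //; do 2 apply: chart_smooth_pd.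
  apply: continuous_funN; apply: continuous_sum_at => d; apply: continuous_funM; last first.
    by apply: chart_smooth_continuous => //; exact: chart_smooth_pd.
  have P i e f : {for x, continuous (fun y => pd i (fun w : 'rV[R]_3 => h0 w e f) y)}.
    by apply: chart_smooth_continuous => //; apply: chart_smooth_pd; exists (fun w : 'rV[R]_3 => h0 w e f) => //; exact: amb_h0.
  apply: continuous_funM; first exact: continuous_cstfun.
  apply: continuous_sum_at => e; apply: continuous_funM; first exact: h0i.
  by apply: continuous_funD; [apply: continuous_funD|apply: continuous_funN]; exact: P.
have kc : continuous_mx (k_of sigma h1) x.
  move=> a b; rewrite (_ : (fun y => _) = fun y => h1 y a b + (2 * sigma y) * h0 y a b); last first.
    by apply: funext => y; rewrite /k_of mxDE mxZE.
  apply: continuous_funD.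
    apply: chart_smooth_continuous => //; apply: smooth_tensor2_chart; by exists F1.
  apply: continuous_funM => //; apply: continuous_funM; first exact: continuous_cstfun.
  exact: chart_smooth_continuous.
have gd A B : continuous_mx A x -> continuous_mx B x -> {for x, continuous (fun y => gdot h0 y (A y) (B y))}.
  move=> HA HB; apply: continuous_mxtrace; apply: continuous_mulmx => //.
  by apply: continuous_mulmx; [exact: continuous_mulmx|exact: continuous_trmx].
apply: continuous_funM.
  by apply: continuous_sqrt; apply: continuous_funN; exact: continuous_det.
apply: continuous_funD; last by apply: continuous_funN; exact: gd.
apply: continuous_funD; last exact: gd.
apply: continuous_funM; first exact: continuous_cstfun.
rewrite (_ : (fun y => _) = fun y => sigma y * sigma y)//.
by apply: continuous_funM; exact: chart_smooth_continuous.
Qed.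

End Expansion.

(** * Integration over slabs *)

Section Slabs.
Context {R : realType}.
Notation M3 := (measurableTypeR R * measurableTypeR R * measurableTypeR R)%type.
Implicit Types (P : set 'rV[R]_3) (f : 'rV[R]_3 -> R) (u v : R * R * R).

Lemma tau_coord u : tau (coord_point u) = u.1.1. Proof. by rewrite /tau mxE. Qed.
Lemma theta_coord u : theta (coord_point u) = u.1.2. Proof. by rewrite /theta mxE. Qed.
Lemma phi_coord u : phi (coord_point u) = u.2. Proof. by rewrite /phi mxE. Qed.

Lemma coord_point_dist u v (e : R) : 0 <= e -> `|u.1.1 - v.1.1| <= e -> `|u.1.2 - v.1.2| <= e ->
  `|u.2 - v.2| <= e -> `|coord_point u - coord_point v| <= e.
Proof.
move=> e0 e1 e2 e3; apply: rV_norm_le => // j; rewrite !mxE; move: j.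
by apply: ord3P.
Qed.

Lemma rational_box (c e : R) : 0 < e -> exists q : rat, `|ratr q - c| < e.
Proof.
move=> e0; have : c - e < c + e by rewrite ltrD2l gtrN.
move=> /rat_in_itvoo [q]; rewrite in_itv /= => qc; exists q.
by rewrite ltr_distl.
Qed.

(* A set open at each of its coordinate points is a countable union of boxes
   with rational centres. *)
Lemma measurable_coord_preimage P :
  (forall u, P (coord_point u) -> \forall y \near coord_point u, P y) ->
  measurable ([set u | P (coord_point u)] : set M3).
Proof.
move=> oP.
pose box (q1 q2 q3 : rat) (n : nat) : set M3 :=
  (ball (ratr q1 : R) n.+1%:R^-1 `*` ball (ratr q2 : R) n.+1%:R^-1) `*` ball (ratr q3 : R) n.+1%:R^-1.
pose good q1 q2 q3 n := forall v, box q1 q2 q3 n v -> P (coord_point v).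
have -> : [set u | P (coord_point u)] = \bigcup_(q1 in [set: rat]) \bigcup_(q2 in [set: rat])
    \bigcup_(q3 in [set: rat]) \bigcup_(n in [set: nat])
      (if `[< good q1 q2 q3 n >] then box q1 q2 q3 n else set0).
  apply/seteqP; split => u /=; last first.
    move=> [q1 _ [q2 _ [q3 _ [n _]]]]; case: asboolP => // g; exact: g.
  move=> /oP /nbhs_ballP [e /= e0 He].
  have [n nP] : exists n : nat, n.+1%:R^-1 < e / 2.
    have e2 : 0 < e / 2 by rewrite divr_gt0.
    have [n _ H] := near_infty_natSinv_lt (PosNum e2).
    by exists n; apply: (H n) => /=.
  have d0 : 0 < n.+1%:R^-1 :> R by rewrite invr_gt0.
  have [q1 h1] := rational_box u.1.1 d0; have [q2 h2] := rational_box u.1.2 d0.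
  have [q3 h3] := rational_box u.2 d0.
  exists q1 => //; exists q2 => //; exists q3 => //; exists n => //.
  have g : good q1 q2 q3 n.
    move=> v [[/= v1 v2] v3]; apply: He; rewrite -ball_normE /=.
    have T (q a b : R) : `|q - a| < n.+1%:R^-1 -> `|q - b| < n.+1%:R^-1 -> `|a - b| <= n.+1%:R^-1 + n.+1%:R^-1.
      move=> qa qb; have -> : a - b = (q - b) - (q - a) by ring.
      by rewrite (le_trans (ler_normB _ _))// lerD// ltW.
    apply: le_lt_trans (_ : n.+1%:R^-1 + n.+1%:R^-1 < e); last by rewrite [ltRHS]splitr ltrD.
    apply: coord_point_dist; first by rewrite addr_ge0// ltW.
    - exact: T h1 v1.
    - exact: T h2 v2.
    - exact: T h3 v3.
  case: asboolP => // _; by split; first split; rewrite -ball_normE.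
apply: bigcupT_measurable_rat => q1; apply: bigcupT_measurable_rat => q2.
apply: bigcupT_measurable_rat => q3; apply: bigcupT_measurable => n.
case: asboolP => _; last exact: measurable0.
apply: measurableX; first apply: measurableX.
- by apply: measurable_realfun.open_measurable; exact: ball_open.
- by apply: measurable_realfun.open_measurable; exact: ball_open.
- by apply: measurable_realfun.open_measurable; exact: ball_open.
Qed.

Definition in_slab (t1 t2 : R) (y : 'rV[R]_3) :=
  [/\ t1 < tau y < t2, 0 < theta y < pi & 0 < phi y < 2 * pi].

Lemma slabE t1 t2 u : slab t1 t2 u <-> in_slab t1 t2 (coord_point u).
Proof.
rewrite /slab /in_slab tau_coord theta_coord phi_coord /=; rewrite !in_itv /=.
by split=> [[[? ?] ?]|[? ? ?]].
Qed.

Lemma in_slab_open t1 t2 x : in_slab t1 t2 x -> \forall y \near x, in_slab t1 t2 y.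
Proof.
have C i (a b : R) : a < x 0 i < b -> \forall y \near x, a < (y : 'rV[R]_3) 0 i < b.
  move=> /andP[xa xb]; have cx := @continuous_coord R 3 x i.
  have A : \forall y \near x, a < (y : 'rV[R]_3) 0 i by apply: (cvgr_gt _ cx).
  have B : \forall y \near x, (y : 'rV[R]_3) 0 i < b by apply: (cvgr_lt _ cx).
  by apply: filterS (filterI A B) => y [-> ->].
move=> [/C A /C B /C D]; apply: filterS (filterI A (filterI B D)) => y [y1 [y2 y3]].
by split.
Qed.

Lemma measurable_slab t1 t2 : measurable (slab t1 t2 : set M3).
Proof.
rewrite (_ : slab t1 t2 = [set u | in_slab t1 t2 (coord_point u)]).
  by apply: measurable_coord_preimage => u; exact: in_slab_open.
by apply/seteqP; split=> u /slabE.
Qed.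

Lemma measurable_fun_slab f t1 t2 :
  (forall x, in_slab t1 t2 x -> {for x, continuous f}) ->
  measurable_fun (slab t1 t2 : set M3) (fun u => f (coord_point u)).
Proof.
move=> fc mD; apply: (measurability _ (measurable_realfun.RGenOInfty.measurableE R)) => // _ [_ [a ->] <-].
(* A superlevel set of a continuous function inside the open slab is open at each of its coordinate
   points. *)
rewrite (_ : slab t1 t2 `&` _ = [set u | (in_slab t1 t2 `&` [set y | a < f y]) (coord_point u)]).
  apply: measurable_coord_preimage => u [us ua].
  have A : \forall y \near coord_point u, a < f y by apply: (cvgr_gt _ (fc _ us)).
  exact: filterI (in_slab_open us) A.
apply/seteqP; split=> u /=.
  by move=> [/slabE us]; rewrite in_itv /= andbT.
by move=> [us ua]; split; [exact/slabE|rewrite in_itv /= andbT].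
Qed.

Lemma slab_finite t1 t2 : t1 < t2 -> (@lebesgue3 R (slab t1 t2) < +oo)%E.
Proof.
move=> t12; have m (a b : R) : measurable (`]a, b[%classic : set (measurableTypeR R)) by exact: measurable_itv.
have mm := measurableX (m t1 t2) (m 0 pi).
have -> : @lebesgue3 R (slab t1 t2) = (lebesgue_measure `]t1, t2[%classic
    * lebesgue_measure `](0 : R)%R, pi[%classic * lebesgue_measure `](0 : R)%R, (2 * pi)%R[%classic)%E.
  apply: etrans (product_measure1E _ _ mm (m 0 (2 * pi))) _; congr (_ * _)%E.
  exact: product_measure1E.
rewrite !lebesgue_measure_itv /=.
by do 3 case: ifP => _; rewrite ?mule0 ?mul0e -?EFinB -?EFinM ?ltry.
Qed.

Lemma bounded_slab_integrable f t1 t2 (C : R) : t1 < t2 ->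
  (forall x, in_slab t1 t2 x -> {for x, continuous f}) ->
  (forall x, in_slab t1 t2 x -> `|f x| <= C) ->
  (@lebesgue3 R).-integrable (slab t1 t2) (EFin \o (fun u => f (coord_point u))).
Proof.
move=> t12 fc fb; apply: measurable_bounded_integrable.
- exact: measurable_slab.
- exact: slab_finite.
- exact: measurable_fun_slab.
exists C; split; first exact: num_real.
by move=> M CM u /slabE us; apply: le_trans (fb _ us) (ltW CM).
Qed.

Lemma slab_int_dist f g t1 t2 (C D : R) : t1 < t2 ->
  (forall x, in_slab t1 t2 x -> {for x, continuous f}) ->
  (forall x, in_slab t1 t2 x -> {for x, continuous g}) ->
  (forall x, in_slab t1 t2 x -> `|g x| <= D) ->
  (forall x, in_slab t1 t2 x -> `|f x - g x| <= C) ->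
  `|slab_int t1 t2 f - slab_int t1 t2 g| <= C * fine (@lebesgue3 R (slab t1 t2)).
Proof.
move=> t12 fc gc gb fg.
have mS := measurable_slab t1 t2.
have fb x : in_slab t1 t2 x -> `|f x| <= C + D.
  move=> xs; rewrite -(subrK (g x) (f x)) (le_trans (ler_normD _ _))// lerD//; [exact: fg|exact: gb].
have fgc x : in_slab t1 t2 x -> {for x, continuous (fun x => f x - g x)}.
  by move=> xs; apply: continuous_funD; [exact: fc|apply: continuous_funN; exact: gc].
have If := bounded_slab_integrable t12 fc fb.
have Ig := bounded_slab_integrable t12 gc gb.
have Ifg := bounded_slab_integrable t12 fgc fg.
rewrite /slab_int -RintegralB//.
apply: le_trans (le_normr_Rintegral mS Ifg) _.
rewrite -Rintegral_cst//; apply: le_Rintegral => //.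
- by have := integrable_norm Ifg; apply: eq_integrable => // u _.
- apply: (bounded_slab_integrable (f := fun=> C) (C := `|C|)) => // x _; exact: continuous_cstfun.
- by move=> u /slabE us; exact: fg.
Qed.

End Slabs.

Lemma cvg_mull (R : realType) (T : Type) (F : set_system T) (FF : Filter F) (f : T -> R) (c a : R) :
  f x @[x --> F] --> a -> c * f x @[x --> F] --> c * a.
Proof. by move=> H; exact: (cvgM (cvg_cst _) H). Qed.

(** * The limit of the action *)

Section Asymptotics.
Context {R : realType}.
Variables (G : R) (r0 : R -> R) (sigma : 'rV[R]_3 -> R) (h1 h2 : 'rV[R]_3 -> 'M[R]_3)
  (h Khat : 'rV[R]_(1 + 3) -> 'M[R]_3).
Let k := k_of sigma h1.
Let lag x := Num.sqrt (- \det (h0 x)) * lagrangian sigma k x.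
Hypotheses (G0 : 0 < G) (bs : beig_schmidt r0 sigma h1 h2 h)
  (flat : ricci_flat r0 (bs_metric sigma h))
  (box : forall x, chart x -> dalembertian h0 (tensor0 sigma) x [::] + 3 * sigma x = 0)
  (trk : forall x, chart x -> gtrace h0 x (k x) = 0)
  (HK : is_Khat r0 h Khat).

(** The ambient representatives and the threshold are chosen here; the integrals below use only
    these four facts. *)
Lemma density_asymptotics T :
  [/\ exists C : R, eventually_on (strip T) (fun z =>
        `|boundary_density sigma h Khat z.1 z.2 - 4^-1 * lag z.2| <= C / z.1),
      exists r2 : R, forall rho x, r2 < rho -> chart x -> `|tau x| < T ->
        {for x, continuous (boundary_density sigma h Khat rho)},
      exists C : R, forall x, strip T x -> `|lag x| <= C &
      forall x, chart x -> {for x, continuous lag}].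
Proof.
case: bs => r0p r0c [Fs Fss FsE] [F1 F1s F1E] h1s [F2 F2s F2E] h2s hsm hsy hnd [F3 F3s F3E].
case: HK => Ks Keq [FK FKs FKE].
have [rho1 thr] := ex_threshold (F3 := F3) (FK := FK) r0c F3s FKs T.
split.
- have [C H] := boundary_density_bigO r0c r0p hsm hsy hnd Fss FsE F1s F1E h1s F2s F2E F3s F3E FKs FKE thr box trk flat Keq.
  by exists C; apply: ev_imp H _ => z _ _; rewrite expr1.
- exact: (boundary_density_continuous r0c hsm hnd Fss FsE FKE thr).
- exact: (lagrangian_bounded r0p hsy hnd Fss FsE F1s F1E h1s F2s F2E F3s F3E thr).
- move=> x xc; exact: (@lagrangian_continuous R sigma h1 Fs F1 Fss FsE F1s F1E x xc).
Qed.

Lemma in_slab_strip t1 t2 (x : 'rV[R]_3) : in_slab t1 t2 x ->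
  chart x /\ `|tau x| < Num.max `|t1| `|t2|.
Proof.
move=> [/andP[a b] xc _]; split=> //; rewrite lt_max; case: (leP 0 (tau x)) => t0.
  by rewrite (ger0_norm t0) (lt_le_trans b (ler_norm _)) orbT.
rewrite (ltr0_norm t0) (lt_le_trans _ (_ : - t1 <= _)) ?ltrN2//.
by rewrite -normrN ler_norm.
Qed.

(** The density converges uniformly on the slab, whose coordinate measure is finite. *)
Lemma cvg_slab_int t1 t2 : t1 < t2 ->
  slab_int t1 t2 (boundary_density sigma h Khat rho) @[rho --> +oo] --> 4^-1 * slab_int t1 t2 lag.
Proof.
move=> t12; have [[C [r1 r1P HC]] [r2 H2] [D HD] Hc] := density_asymptotics (Num.max `|t1| `|t2|).
pose V := fine (@lebesgue3 R (slab t1 t2)).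
have Ilag : (@lebesgue3 R).-integrable (slab t1 t2) (EFin \o (fun u => lag (coord_point u))).
  apply: (bounded_slab_integrable (C := D)) => // x /in_slab_strip[xc xT]; first exact: Hc.
  by apply: HD; split=> //; exact: ltW.
have <- : slab_int t1 t2 (fun x => 4^-1 * lag x) = 4^-1 * slab_int t1 t2 lag.
  by rewrite /slab_int -RintegralZl//; exact: measurable_slab.
apply/cvgrPdist_le => e e0.
(* Beyond |C V| / e the error C V / rho is at most e. *)
exists (Num.max (Num.max r1 r2) (`|C * V| / e)); split; first exact: num_real.
move=> rho; rewrite !gt_max => /andP[/andP[rr1 rr2] rr3].
have rp : 0 < rho by apply: lt_trans rr1; exact: lt_le_trans r1P.
rewrite distrC; apply: le_trans (slab_int_dist (C := C / rho) (D := 4^-1 * D) t12 _ _ _ _) _.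
- by move=> x /in_slab_strip[xc xT]; exact: H2.
- move=> x /in_slab_strip[xc xT]; apply: continuous_funM; first exact: continuous_cstfun.
  exact: Hc.
- move=> x /in_slab_strip[xc xT]; rewrite normrM ger0_norm ?invr_ge0// ler_pM2l ?invr_gt0//.
  by apply: HD; split=> //; exact: ltW.
- move=> x /in_slab_strip[xc xT]; apply: (HC (rho, x)) => //.
  by split=> //; exact: ltW.
rewrite mulrAC ler_pdivrMr//; apply: le_trans (ler_norm _) _.
by move: rr3; rewrite ltr_pdivrMr// [rho * e]mulrC => /ltW.
Qed.

Lemma bulk_density0 rho x : chart x -> bulk_density r0 (bs_metric sigma h) rho x = 0.
Proof.
move=> xc; rewrite /bulk_density (@eq_Rintegral _ _ _ _ _ (fun=> 0)).
  by rewrite Rintegral_cst ?mul0r//; exact: measurable_itv.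
move=> r; rewrite inE /= in_itv /= => /andP[r1 _].
rewrite /scalar_curvature /gtrace flat ?mulmx0 ?mxtrace0 ?mulr0//.
exact/region_pt.
Qed.

Lemma action_boundary t1 t2 rho : 16 * pi * G * action G r0 sigma h Khat t1 t2 rho =
  2 * slab_int t1 t2 (boundary_density sigma h Khat rho).
Proof.
have p0 : pi != 0 :> R by rewrite gt_eqF// pi_gt0.
have g0 : G != 0 by rewrite gt_eqF.
rewrite /action (_ : slab_int t1 t2 (bulk_density _ _ _) = 0).
  rewrite mulr0 add0r.
  have E (p g s : R) : p != 0 -> g != 0 -> 16 * p * g * ((8 * p * g)^-1 * s) = 2 * s.
    by move=> p1 g1; field; rewrite p1 g1.
  exact: E.
rewrite /slab_int (@eq_Rintegral _ _ _ _ _ (fun=> 0)).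
  by rewrite Rintegral_cst ?mul0r//; exact: measurable_slab.
move=> u; rewrite inE => /slabE [_ xc _]; exact: bulk_density0.
Qed.

Theorem action_limit t1 t2 : t1 < t2 ->
  16 * pi * G * action G r0 sigma h Khat t1 t2 rho @[rho --> +oo] --> 2^-1 * slab_int t1 t2 lag.
Proof.
move=> /cvg_slab_int H.
rewrite (_ : (fun rho => _) = fun rho => 2 * slab_int t1 t2 (boundary_density sigma h Khat rho)).
  by rewrite (_ : 2^-1 * _ = 2 * (4^-1 * slab_int t1 t2 lag)); [exact: cvg_mull|field].
by apply: funext => rho; rewrite action_boundary.
Qed.

(** By uniqueness of limits any witness [A] agrees with the rescaled slab integral wherever tau1 <
    tau2, so both sides assert the same outer limit. *)
Theorem action_value_integral S : action_value G r0 sigma h Khat S <->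
  exists2 I : R, dS_integral (lagrangian sigma k) I & 16 * pi * G * S = 2^-1 * I.
Proof.
have pG : 16 * pi * G != 0 by rewrite !mulf_neq0// gt_eqF// pi_gt0.
set c := 16 * pi * G in pG *.
have AL t1 t2 : t1 < t2 -> action G r0 sigma h Khat t1 t2 rho @[rho --> +oo] -->
    c^-1 * (2^-1 * slab_int t1 t2 lag).
  move=> /action_limit H.
  rewrite (_ : (fun rho => _) = fun rho => c^-1 * (c * action G r0 sigma h Khat t1 t2 rho)).
    exact: cvg_mull.
  by apply: funext => rho; rewrite mulrA mulVf// mul1r.
(* Eventually tau1 < 0 < tau2; for other pairs the action value leaves [A] unconstrained. *)
have NF : \forall u \near filter_prod (ninfty_nbhs R) (pinfty_nbhs R), u.1 < u.2.
  exists ([set x | x < 0], [set x | 0 < x]); first by split; exists 0; split=> //; exact: num_real.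
  by move=> [a b] /= [a0 b0]; exact: lt_trans b0.
split=> [[A HA HS]|[I HI E]].
  exists (2 * (c * S)); last by field.
  have EA : \forall u \near filter_prod (ninfty_nbhs R) (pinfty_nbhs R),
      2 * (c * A u.1 u.2) = slab_int u.1 u.2 lag.
    apply: filterS NF => -[a b] /= ab.
    have -> : A a b = c^-1 * (2^-1 * slab_int a b lag).
      by apply: (cvg_unique _ (HA a b ab) (AL a b ab)).
    by field.
  apply: cvg_trans (near_eq_cvg EA) _.
  by apply: cvg_mull; apply: cvg_mull.
exists (fun a b => c^-1 * (2^-1 * slab_int a b lag)) => //.
have -> : S = c^-1 * (2^-1 * I) by rewrite -E mulrA mulVf// mul1r.
by apply: cvg_mull; apply: cvg_mull.
Qed.

End Asymptotics.

(** * The Lagrangian as a divergence on dS_3 *)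

Section MatrixDerivative.
Context {R : realType} {V : normedModType R}.
Implicit Types (x w : V).

Definition is_derive_mx m n (A : V -> 'M[R]_(m, n)) x w (dA : 'M[R]_(m, n)) :=
  forall i j, is_derive x w (fun y => A y i j) (dA i j).

Lemma is_derive_mxD m n (A B : V -> 'M[R]_(m, n)) x w dA dB :
  is_derive_mx A x w dA -> is_derive_mx B x w dB ->
  is_derive_mx (fun y => A y + B y) x w (dA + dB).
Proof.
move=> HA HB i j; rewrite mxDE (_ : (fun y => _) = fun y => A y i j + B y i j).
  exact: is_derive_funD.
by apply: funext => y; rewrite mxDE.
Qed.

Lemma is_derive_mxN m n (A : V -> 'M[R]_(m, n)) x w dA :
  is_derive_mx A x w dA -> is_derive_mx (fun y => - A y) x w (- dA).
Proof.
move=> HA i j; rewrite mxNE (_ : (fun y => _) = fun y => - A y i j).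
  exact: is_derive_funN.
by apply: funext => y; rewrite mxNE.
Qed.

Lemma is_derive_mxZ m n (f : V -> R) (A : V -> 'M[R]_(m, n)) x w (df : R) dA :
  is_derive x w f df -> is_derive_mx A x w dA ->
  is_derive_mx (fun y => f y *: A y) x w (df *: A x + f x *: dA).
Proof.
move=> Hf HA i j; rewrite mxDE !mxZE (_ : (fun y => _) = fun y => f y * A y i j).
  exact: is_derive_funM.
by apply: funext => y; rewrite mxZE.
Qed.

Lemma is_derive_mxM m n p (A : V -> 'M[R]_(m, n)) (B : V -> 'M[R]_(n, p)) x w dA dB :
  is_derive_mx A x w dA -> is_derive_mx B x w dB ->
  is_derive_mx (fun y => A y *m B y) x w (dA *m B x + A x *m dB).
Proof.
move=> HA HB i j; rewrite (_ : (fun y => _) = fun y => \sum_k A y i k * B y k j).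
  rewrite mxDE [X in X + _]mxE [X in _ + X]mxE -big_split.
  by apply: is_derive_funsum => k; exact: is_derive_funM.
by apply: funext => y; rewrite mxE.
Qed.

Lemma is_derive_mxT m n (A : V -> 'M[R]_(m, n)) x w dA :
  is_derive_mx A x w dA -> is_derive_mx (fun y => (A y)^T) x w dA^T.
Proof.
move=> HA i j; rewrite mxE (_ : (fun y => _) = fun y => A y j i); first exact: HA.
by apply: funext => y; rewrite mxE.
Qed.

Lemma is_derive_mxC m n (A : 'M[R]_(m, n)) x w : is_derive_mx (fun=> A) x w 0.
Proof. by move=> i j; rewrite mxE; exact: is_derive_cstfun. Qed.

Lemma is_derive_mx_uniq m n (A : V -> 'M[R]_(m, n)) x w dA dB :
  is_derive_mx A x w dA -> is_derive_mx A x w dB -> dA = dB.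
Proof.
move=> HA HB; apply/matrixP => i j.
by rewrite -(@derive_val _ _ _ _ _ _ _ (HA i j)) -(@derive_val _ _ _ _ _ _ _ (HB i j)).
Qed.

Lemma is_derive_mx_near m n (A B : V -> 'M[R]_(m, n)) x w dA :
  (\forall y \near x, A y = B y) -> is_derive_mx A x w dA -> is_derive_mx B x w dA.
Proof.
move=> E HA i j; apply: near_eq_is_derive (HA i j).
by apply: filterS E => y ->.
Qed.

Lemma is_derive_mx_tr n (A : V -> 'M[R]_n) x w dA : is_derive_mx A x w dA ->
  is_derive x w (fun y => \tr (A y)) (\tr dA).
Proof. by move=> HA; apply: is_derive_funsum => i; exact: HA. Qed.

End MatrixDerivative.

(** * The connection and curvature of dS_3, and the current *)

Section DeSitterCalculus.
Context {R : realType}.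
Implicit Types (x : 'rV[R]_3).

(** The connection matrix in direction [e], with a covector written as a row [v] and differentiated
    covariantly as d_e v - v [Gam e]. *)
Definition Gam (e : 'I_3) x : 'M[R]_3 := \matrix_(f, b) gamma0 x f e b.

Lemma entry_mul_row_tr m (A : 'M[R]_(m, 4)) i (J : 'M[R]_(3, 4)) e :
  (A *m (row e J)^T) i 0 = (A *m J^T) i e.
Proof. by rewrite !mxE; apply: eq_bigr => mu _; rewrite !mxE. Qed.

Lemma jac_eta4_jac x : jac_embed x *m @eta4 R *m (jac_embed x)^T = h0 x.
Proof. by rewrite h0_pullback. Qed.

Lemma embed_eta4_jac x : embed x *m @eta4 R *m (jac_embed x)^T = 0.
Proof.
rewrite jac_embedE trmx_mul tr_diag_mx mulmxA.
have -> : embed x *m @eta4 R *m (frame x)^T = (frame x *m @eta4 R *m (embed x)^T)^T.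
  by rewrite !trmx_mul trmxK tr_diag_mx mulmxA.
by rewrite frame_normal trmx0 mul0mx.
Qed.

(** For the constant ambient metric [christoffel_pullback] reduces to the tangential part of the
    second derivatives of the embedding, whose coefficients are [gamma0] by the Gauss formula; the
    normal part is orthogonal to the Jacobian. *)
Lemma christoffel_h0 x c a b : chart x -> christoffel h0 x c a b = gamma0 x c a b.
Proof.
move=> xc.
have D0 : dambient x (fun=> @eta4 R) = fun=> 0.
  apply: funext => v; rewrite /dambient big1// => l _.
  rewrite (_ : \matrix_(_, _) _ = 0) ?scaler0//; apply/matrixP => mu nu; rewrite [LHS]mxE [RHS]mxE.
  exact: is_derive_pd (is_derive_cstfun _ _ _).
have h0u : h0 x \in unitmx by rewrite h0_frame !unitmx_mul lame_unit// eta_unit.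
rewrite (@christoffel_pullback R x xc (fun=> @eta4 R) (@h0 R)).
- rewrite D0; have -> : gamma0 x c a b = \sum_e invmx (h0 x) c e * \sum_f h0 x e f * gamma0 x f a b.
    transitivity ((invmx (h0 x) *m h0 x *m (\col_f gamma0 x f a b)) c 0).
      by rewrite mulVmx// mul1mx mxE.
    rewrite -mulmxA mxE; apply: eq_bigr => e _; congr (_ * _); rewrite mxE.
    by apply: eq_bigr => f _; congr (_ * _); rewrite mxE.
  apply: eq_bigr => e _; congr (_ * _); rewrite !bil0 !addr0 subr0 mulr0 addr0.
  transitivity ((row e (jac_embed x) *m @eta4 R *m (jacD2 x a b)^T) 0 0) => //.
  rewrite /jacD2 linearB linear_sum /= mulmxBr linearZ /= -scalemxAr.
  have -> : row e (jac_embed x) *m @eta4 R *m (embed x)^T = 0.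
    have -> : row e (jac_embed x) *m @eta4 R *m (embed x)^T =
        (embed x *m @eta4 R *m (row e (jac_embed x))^T)^T.
      by rewrite !trmx_mul trmxK tr_diag_mx mulmxA.
    apply/matrixP => i j; rewrite !ord1 [LHS]mxE entry_mul_row_tr embed_eta4_jac.
    by rewrite [LHS]mxE [RHS]mxE.
  rewrite scaler0 subr0 mulmx_sumr summxE; apply: eq_bigr => f _.
  rewrite linearZ /= -scalemxAr mxZE mulrC; congr (_ * _).
  by rewrite entry_mul_row_tr -!row_mul jac_eta4_jac mxE.
- by apply: rV_nearW => y; rewrite h0_pullback.
- by apply: rV_nearW => y mu nu l; have [] := is_derive_cstfun (@eta4 R mu nu) y (dirv l).
- move=> mu nu l; rewrite (_ : pd l _ = fun=> 0); first exact: continuous_cstfun.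
  by apply: funext => y; exact: is_derive_pd (is_derive_cstfun _ _ _).
- by rewrite tr_diag_mx.
Qed.

Lemma gamma0_derivable x i c a b : chart x -> derivable (fun y : 'rV[R]_3 => gamma0 y c a b) x (dirv i).
Proof.
move=> xc; have c0 := chx_neq0 x; have s0 := snx_neq0 xc.
have D1 : derivable (fun y : 'rV[R]_3 => shx y / chx y) x (dirv i).
  by have [] := is_derive_funM (is_derive_shx x i) (is_derive_funV c0 (is_derive_chx x i)).
have D2 : derivable (fun y : 'rV[R]_3 => csx y / snx y) x (dirv i).
  by have [] := is_derive_funM (is_derive_csx x i) (is_derive_funV s0 (is_derive_snx x i)).
have D3 : derivable (fun y : 'rV[R]_3 => chx y * shx y) x (dirv i).
  by have [] := is_derive_funM (is_derive_chx x i) (is_derive_shx x i).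
have D4 : derivable (fun y : 'rV[R]_3 => chx y * shx y * snx y ^+ 2) x (dirv i).
  by have [] := is_derive_funM (is_derive_funM (is_derive_chx x i) (is_derive_shx x i))
    (is_derive_funX2 (is_derive_snx x i)).
have D5 : derivable (fun y : 'rV[R]_3 => - (snx y * csx y)) x (dirv i).
  by have [] := is_derive_funN (is_derive_funM (is_derive_snx x i) (is_derive_csx x i)).
have D0 : derivable (fun y : 'rV[R]_3 => 0 : R) x (dirv i).
  by have [] := is_derive_cstfun (0 : R) x (dirv i).
move: c a b; apply: ord3P; apply: ord3P; apply: ord3P; rewrite /gamma0 /=; assumption.
Qed.

Definition pdm (i : 'I_3) m n (A : 'rV[R]_3 -> 'M[R]_(m, n)) x : 'M[R]_(m, n) :=
  \matrix_(a, b) pd i (fun y => A y a b) x.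

Lemma pdm_is_derive i m n (A : 'rV[R]_3 -> 'M[R]_(m, n)) x :
  (forall a b, derivable (fun y => A y a b) x (dirv i)) -> is_derive_mx A x (dirv i) (pdm i A x).
Proof. by move=> H a b; rewrite mxE; apply: derivable_pd. Qed.

Lemma Gam_is_derive e i x : chart x -> is_derive_mx (Gam e) x (dirv i) (pdm i (Gam e) x).
Proof.
move=> xc; apply: pdm_is_derive => a b.
rewrite (_ : (fun y => _) = fun y : 'rV[R]_3 => gamma0 y a e b); first exact: gamma0_derivable.
by apply: funext => y; rewrite mxE.
Qed.

Lemma jac_is_derive d x : chart x -> is_derive_mx (@jac_embed R) x (dirv d)
  ((Gam d x)^T *m jac_embed x - col d (h0 x) *m embed x).
Proof.
move=> xc a mu; apply: is_derive_eq (is_derive_jac d a mu xc) _.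
rewrite mxDE mxNE [X in _ = X - _]mxE [X in _ = _ - X]mxE big_ord1 [col _ _ _ _]mxE.
congr (_ - _ * _).
  by apply: eq_bigr => c _; rewrite [_^T _ _]mxE [Gam _ _ _ _]mxE gamma0_sym.
Qed.

(** Metric compatibility of the connection, from [h0] being the Gram matrix of the Jacobian. *)
Lemma h0_is_derive c x : chart x -> is_derive_mx (@h0 R) x (dirv c)
  (h0 x *m Gam c x + (h0 x *m Gam c x)^T).
Proof.
move=> xc; have DJ := jac_is_derive c xc.
have D := is_derive_mxM (is_derive_mxM DJ (is_derive_mxC (@eta4 R) x (dirv c))) (is_derive_mxT DJ).
set M := (Gam c x)^T *m jac_embed x - _ in D.
have M1 : M *m @eta4 R *m (jac_embed x)^T = (h0 x *m Gam c x)^T.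
  rewrite /M !mulmxBl -!mulmxA (mulmxA (embed x)) embed_eta4_jac mulmx0 subr0.
  by rewrite (mulmxA (jac_embed x)) jac_eta4_jac trmx_mul h0_sym.
have M2 : jac_embed x *m @eta4 R *m M^T = (M *m @eta4 R *m (jac_embed x)^T)^T.
  by rewrite !trmx_mul trmxK tr_diag_mx mulmxA.
rewrite mulmx0 addr0 M2 M1 trmxK addrC in D.
by apply: is_derive_mx_near D; apply: rV_nearW => y; rewrite jac_eta4_jac.
Qed.

Lemma invh0_is_derive c x : chart x -> is_derive_mx (fun y => invmx (h0 y)) x (dirv c)
  (- (Gam c x *m invmx (h0 x) + invmx (h0 x) *m (Gam c x)^T)).
Proof.
move=> xc; have U (y : 'rV[R]_3) : chart y -> h0 y \in unitmx.
  by move=> yc; rewrite h0_frame !unitmx_mul lame_unit// eta_unit.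
have N : \forall y \near x, h0 y \in unitmx by apply: filterS (chart_open xc) => y; exact: U.
move=> i j; apply: is_derive_eq (derive_invmx N (U x xc) (h0_is_derive c xc) i j) _.
rewrite mxNE; congr (- _); congr (fun_of_matrix _ i j).
rewrite trmx_mul h0_sym mulmxDr mulmxDl !mulmxA mulVmx ?U// mul1mx.
by rewrite -!mulmxA mulmxV ?U// mulmx1.
Qed.

Lemma embed_is_derive e x : is_derive_mx (@embed R) x (dirv e) (row e (jac_embed x)).
Proof. by move=> i mu; rewrite ord1 mxE; exact: is_derive_embed. Qed.

Lemma col_is_derive n (d : 'I_n) (A : 'rV[R]_3 -> 'M[R]_n) x w dA : is_derive_mx A x w dA ->
  is_derive_mx (fun y => col d (A y)) x w (col d dA).
Proof.
move=> HA i j; rewrite mxE (_ : (fun y => _) = fun y => A y i d); first exact: HA.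
by apply: funext => y; rewrite mxE.
Qed.

Lemma zmod_rearrange (V : zmodType) (a b c d : V) : a - b + c - d = (a + c) - (b + d).
Proof. by rewrite opprD addrA (addrAC a). Qed.

(** Its entry (f, b) is the Riemann component R^f_{bed}. *)
Definition curvature e d x : 'M[R]_3 :=
  pdm e (Gam d) x - pdm d (Gam e) x + Gam e x *m Gam d x - Gam d x *m Gam e x.

(* The Gauss equation, from the symmetry of the second derivatives of the
   Jacobian of the embedding. *)
Lemma curvature_h0 e d x : chart x -> h0 x *m curvature e d x =
  col e (h0 x) *m row d (h0 x) - col d (h0 x) *m row e (h0 x).
Proof.
move=> xc.
pose Jd d y := (Gam d y)^T *m jac_embed y - col d (h0 y) *m embed y.
have M1 c : Jd c x *m @eta4 R *m (jac_embed x)^T = (h0 x *m Gam c x)^T.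
  rewrite /Jd !mulmxBl -!mulmxA (mulmxA (embed x)) embed_eta4_jac mulmx0 subr0.
  by rewrite (mulmxA (jac_embed x)) jac_eta4_jac trmx_mul h0_sym.
pose dh f c := col c (h0 x *m Gam f x + (h0 x *m Gam f x)^T).
pose Z f c := ((pdm f (Gam c) x)^T *m jac_embed x + (Gam c x)^T *m Jd f x)
   - (dh f c *m embed x + col c (h0 x) *m row f (jac_embed x)).
have DZ f c : is_derive_mx (Jd c) x (dirv f) (Z f c).
  apply: is_derive_mxD; first exact: (is_derive_mxM (is_derive_mxT (Gam_is_derive c f xc)) (jac_is_derive f xc)).
  apply: is_derive_mxN; apply: is_derive_mxM; last exact: embed_is_derive.
  exact: (col_is_derive c (h0_is_derive f xc)).
have PZ f c b mu : pd f (pd c (fun y => jac_embed y b mu)) x = Z f c b mu.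
  apply: is_derive_pd; apply: near_eq_is_derive (DZ f c b mu).
  apply: filterS (chart_open xc) => y yc; symmetry; exact: is_derive_pd (jac_is_derive c yc b mu).
(* [Z] holds the second derivatives of the Jacobian, symmetric in the two directions. Their
   tangential parts contain the curvature, their normal parts the right-hand side. *)
have ZZ : Z e d = Z d e.
  by apply/matrixP => b mu; rewrite -!PZ; apply: amb_pd_comm; exact: amb_jac.
have X f c : (Z f c *m @eta4 R *m (jac_embed x)^T)^T =
    h0 x *m pdm f (Gam c) x + h0 x *m Gam f x *m Gam c x - col f (h0 x) *m row c (h0 x).
  rewrite /Z !(mulNmx, mulmxDl) -!mulmxA.
  rewrite (mulmxA (embed x)) embed_eta4_jac mulmx0 add0r.
  rewrite (mulmxA (jac_embed x)) jac_eta4_jac (mulmxA (Jd f x)) M1.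
  rewrite (mulmxA (row f _)) -!row_mul jac_eta4_jac.
  rewrite linearB linearD /= !trmx_mul !trmxK h0_sym.
  by rewrite tr_row tr_col h0_sym (mulmxA (h0 x)).
have E f c : h0 x *m pdm f (Gam c) x + h0 x *m Gam f x *m Gam c x =
    (Z f c *m @eta4 R *m (jac_embed x)^T)^T + col f (h0 x) *m row c (h0 x).
  by rewrite X subrK.
rewrite /curvature !(mulmxBr, mulmxDr) !mulmxA.
by rewrite zmod_rearrange !E ZZ opprD addrACA subrr add0r.
Qed.

(** Constant curvature 1, as it acts on covectors. *)
Lemma mul_curvature e d x (v : 'rV[R]_3) : chart x ->
  v *m curvature e d x = v 0 e *: row d (h0 x) - v 0 d *: row e (h0 x).
Proof.
move=> xc; have h0u : h0 x \in unitmx by rewrite h0_frame !unitmx_mul lame_unit// eta_unit.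
rewrite -[in LHS](mulmxKV h0u v) -(mulmxA _ (h0 x) (curvature _ _ _)) curvature_h0// mulmxBr !mulmxA.
have C c : v *m invmx (h0 x) *m col c (h0 x) = (v 0 c)%:M.
  have -> : v *m invmx (h0 x) *m col c (h0 x) = col c (v *m invmx (h0 x) *m h0 x).
    by rewrite !colE mulmxA.
  by rewrite mulmxKV//; apply/matrixP => i j; rewrite !ord1 !mxE eqxx mulr1n.
by rewrite !C !mul_scalar_mx.
Qed.

Variables (sigma : 'rV[R]_3 -> R) (k : 'rV[R]_3 -> 'M[R]_3).
Hypotheses (ss : chart_smooth sigma) (sk : forall a b, chart_smooth (fun x => k x a b))
  (k_sym : forall x, chart x -> (k x)^T = k x)
  (box : forall x, chart x -> dalembertian h0 (tensor0 sigma) x [::] + 3 * sigma x = 0)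
  (divk : forall x a, chart x -> divergence h0 (tensor2 k) x [:: a] = 0).

Definition gradient x : 'rV[R]_3 := \row_b pd b sigma x.
Notation v := gradient.
Notation S := (hessian h0 sigma).
Notation ih x := (invmx (h0 x)).
(** The covariant derivative in direction [c] of a rank two tensor, in matrix form. *)
Definition Dcov c (A : 'rV[R]_3 -> 'M[R]_3) x : 'M[R]_3 :=
  pdm c A x - (Gam c x)^T *m A x - A x *m Gam c x.

Lemma v_is_derive c x : chart x -> is_derive_mx v x (dirv c) (pdm c v x).
Proof.
move=> xc; apply: pdm_is_derive => a b.
rewrite (_ : (fun y => _) = pd b sigma); last by apply: funext => y; rewrite mxE.
by have [] := chart_smooth_is_derive c (chart_smooth_pd b ss) xc.
Qed.

Lemma pdm_v_is_derive c d x : chart x -> is_derive_mx (pdm d v) x (dirv c) (pdm c (pdm d v) x).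
Proof.
move=> xc; apply: pdm_is_derive => a b.
rewrite (_ : (fun y => _) = pd d (pd b sigma)).
  by have [] := chart_smooth_is_derive c (chart_smooth_pd d (chart_smooth_pd b ss)) xc.
apply: funext => y; rewrite mxE; congr (pd d _ y); apply: funext => w; by rewrite mxE.
Qed.

Lemma hess_row d x : chart x -> row d (S x) = pdm d v x - v x *m Gam d x.
Proof.
move=> xc; apply/rowP => b; rewrite [LHS]mxE mxDE mxNE hessianE; congr (_ - _).
  by rewrite mxE; congr (pd d _ x); apply: funext => w; rewrite mxE.
rewrite mxE; apply: eq_bigr => f _; rewrite christoffel_h0// [gradient x 0 f]mxE [Gam d x f b]mxE.
by rewrite mulrC.
Qed.

Lemma hess_row_is_derive e d x : chart x -> is_derive_mx (fun y => row d (S y)) x (dirv e)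
  (pdm e (pdm d v) x - (pdm e v x *m Gam d x + v x *m pdm e (Gam d) x)).
Proof.
move=> xc; apply: is_derive_mx_near (_ : is_derive_mx (fun y => pdm d v y - v y *m Gam d y) x _ _).
  by apply: filterS (chart_open xc) => y yc; rewrite hess_row.
apply: is_derive_mxD; first exact: pdm_v_is_derive.
by apply: is_derive_mxN; apply: is_derive_mxM; [exact: v_is_derive|exact: Gam_is_derive].
Qed.

Lemma hess_is_derive e x : chart x -> is_derive_mx S x (dirv e) (pdm e S x).
Proof.
move=> xc; apply: pdm_is_derive => d b.
have [D _] := hess_row_is_derive e d xc 0 b.
rewrite (_ : (fun y => _) = fun y => row d (S y) 0 b)//.
by apply: funext => y; rewrite [RHS]mxE.
Qed.

Lemma hess_sym x : chart x -> (S x)^T = S x.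
Proof.
move=> xc; apply/matrixP => a b; rewrite mxE !hessianE (chart_smooth_pd_comm _ _ ss xc).
by congr (_ - _); apply: eq_bigr => f _; rewrite !christoffel_h0// gamma0_sym.
Qed.

Lemma row_pdm_hess e d x : chart x -> row d (pdm e S x) =
  pdm e (pdm d v) x - (pdm e v x *m Gam d x + v x *m pdm e (Gam d) x).
Proof.
move=> xc; apply: is_derive_mx_uniq (hess_row_is_derive e d xc) => i b.
rewrite mxE (_ : (fun y => _) = fun y => S y d b); first exact: hess_is_derive.
by apply: funext => y; rewrite mxE.
Qed.

Lemma pdm_pdm_comm e d x : chart x -> pdm e (pdm d v) x = pdm d (pdm e v) x.
Proof.
move=> xc; apply/matrixP => i b; rewrite [LHS]mxE [RHS]mxE.
have E c : (fun y => pdm c v y i b) = pd c (pd b sigma).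
  apply: funext => y; rewrite mxE; congr (pd c _ y); apply: funext => w; by rewrite mxE.
have H := chart_smooth_pd_comm e d (chart_smooth_pd b ss) xc.
exact: etrans (congr1 (fun f => pd e f x) (E d)) (etrans H (esym (congr1 (fun f => pd d f x) (E e)))).
Qed.

Lemma row_GamT e d x : row d (Gam e x)^T = row e (Gam d x)^T.
Proof. by apply/rowP => f; rewrite !mxE gamma0_sym. Qed.

Lemma row_Dcov_hess e d x : chart x -> row d (Dcov e S x) =
  pdm e (pdm d v) x - (pdm e v x *m Gam d x + v x *m pdm e (Gam d) x)
  - row d (Gam e x)^T *m S x - (pdm d v x *m Gam e x - v x *m Gam d x *m Gam e x).
Proof.
move=> xc; rewrite -row_pdm_hess// -row_mul -mulmxBl -hess_row// -row_mul.
by apply/rowP => b; rewrite [LHS]mxE !mxDE !mxNE [in RHS]mxE [row _ _ 0 b]mxE [row _ _ 0 b]mxE.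
Qed.

Lemma commutator_rearrange (A1 A2 A3 A4 A5 A6 A7 A8 : 'rV[R]_3) :
  (A1 - (A2 + A3) - A4 - (A5 - A6)) - (A1 - (A5 + A7) - A4 - (A2 - A8)) = - (A3 - A7 + A8 - A6).
Proof.
apply/rowP => b; rewrite !mxE.
move: (A1 0 b) (A2 0 b) (A3 0 b) (A4 0 b) (A5 0 b) (A6 0 b) (A7 0 b) (A8 0 b).
by move=> *; ring.
Qed.

(** The Ricci identity for the gradient of sigma. Second partial derivatives and the torsion-free
    part of the connection cancel in the antisymmetrisation. *)
Lemma Dcov_hess_comm e d x : chart x ->
  row d (Dcov e S x) - row e (Dcov d S x) = - (v x *m curvature e d x).
Proof.
move=> xc; rewrite !row_Dcov_hess// (pdm_pdm_comm e d xc) (row_GamT e d) commutator_rearrange.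
congr (- _); rewrite /curvature (mulmxBr _ (_ + _)) mulmxDr mulmxBr.
by rewrite !mulmxA.
Qed.

Lemma invh0_sym x : (ih x)^T = ih x.
Proof. by rewrite trmx_inv h0_sym. Qed.

Lemma contract_tr x (B : 'M[R]_3) : \sum_c \sum_d ih x c d * B c d = \tr (B *m ih x).
Proof.
apply: eq_bigr => c _; rewrite [RHS]mxE; apply: eq_bigr => d _.
by rewrite mulrC -{1}invh0_sym [_^T c d]mxE.
Qed.

Lemma tr_invh0_hess x : chart x -> \tr (ih x *m S x) = - (3 * sigma x).
Proof.
move=> xc; have := box xc; rewrite mxtrace_mulC -contract_tr => E.
apply/eqP; rewrite -addr_eq0; apply/eqP; rewrite -[RHS]E; congr (_ + _); rewrite /dalembertian /contract.
by apply: eq_bigr => c _; apply: eq_bigr => d _; rewrite mxE.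
Qed.

Lemma h0u x : chart x -> h0 x \in unitmx.
Proof. by move=> xc; rewrite h0_frame !unitmx_mul lame_unit// eta_unit. Qed.

(** The metric is parallel, so the trace of the covariant derivative is the derivative of box sigma
    = - 3 sigma. *)
Lemma tr_Dcov_hess d x : chart x -> \tr (ih x *m Dcov d S x) = - (3 * v x 0 d).
Proof.
move=> xc.
have D := is_derive_mx_tr (is_derive_mxM (invh0_is_derive d xc) (hess_is_derive d xc)).
have D2 : is_derive x (dirv d) (fun y => \tr (ih y *m S y)) (- (3 * v x 0 d)).
  apply: (near_eq_is_derive (f := fun y => - (3 * sigma y))).
    by apply: filterS (chart_open xc) => y yc; rewrite tr_invh0_hess.
  apply: is_derive_funN; apply: is_derive_funZ; rewrite [v x 0 d]mxE.
  exact: chart_smooth_is_derive.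
rewrite -(@derive_val _ _ _ _ _ _ _ D2) (@derive_val _ _ _ _ _ _ _ D) /Dcov.
have T1 : \tr (Gam d x *m ih x *m S x) = \tr (ih x *m S x *m Gam d x).
  by rewrite -mulmxA mxtrace_mulC.
rewrite mulNmx mulmxDl !mulmxBr !(mxtraceD, mxtraceN) !mulmxA T1.
move: (\tr _) (\tr _) (\tr _) => a b c; ring.
Qed.

(** D^b sigma_db = D_d box sigma + R_d^b sigma_b = - 3 sigma_d + 2 sigma_d. *)
Lemma div_hess d x : chart x ->
  \sum_e \sum_b ih x e b * Dcov e S x d b = - v x 0 d.
Proof.
move=> xc.
have E e b : Dcov e S x d b = Dcov d S x e b - (v x 0 e * h0 x d b - v x 0 d * h0 x e b).
  have /rowP /(_ b) := Dcov_hess_comm e d xc; rewrite mul_curvature//.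
  rewrite mxDE !mxNE mxDE mxNE !mxZE ![row _ _ 0 b]mxE => <-; by rewrite addrC subrK.
under eq_bigr do under eq_bigr do rewrite E mulrBr mulrBr opprB addrA.
under eq_bigr do rewrite sumrB big_split.
rewrite sumrB big_split /=.
rewrite contract_tr mxtrace_mulC tr_Dcov_hess//.
have -> : \sum_e \sum_b ih x e b * (v x 0 d * h0 x e b) = 3 * v x 0 d.
  under eq_bigr do under eq_bigr do rewrite mulrCA.
  under eq_bigr do rewrite -mulr_sumr.
  by rewrite -mulr_sumr contract_tr mulmxV ?h0u// mxtrace1 mulrC.
have -> : \sum_e \sum_b ih x e b * (v x 0 e * h0 x d b) = v x 0 d.
  transitivity ((v x *m (ih x *m h0 x)) 0 d); last by rewrite mulVmx ?h0u// mulmx1.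
  rewrite mulmxA mxE exchange_big; apply: eq_bigr => b _; rewrite [in RHS]mxE mulr_suml.
  apply: eq_bigr => e _; have -> : h0 x d b = h0 x b d by rewrite -{1}(h0_sym x) [_^T d b]mxE.
  by rewrite mulrCA mulrA.
ring.
Qed.


Lemma Dcov_k_sym c x : chart x -> (Dcov c k x)^T = Dcov c k x.
Proof.
move=> xc; rewrite /Dcov !linearB /= !trmx_mul trmxK (k_sym xc) addrAC.
have -> // : (pdm c k x)^T = pdm c k x.
apply/matrixP => a b; rewrite mxE ![pdm c k x _ _]mxE.
apply: chart_eq_pd xc => y yc; by rewrite -{1}(k_sym yc) mxE.
Qed.

Lemma k_is_derive c x : chart x -> is_derive_mx k x (dirv c) (pdm c k x).
Proof.
move=> xc; apply: pdm_is_derive => a b.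
by have [] := chart_smooth_is_derive c (sk a b) xc.
Qed.

Lemma div_k d x : chart x -> \sum_e \sum_b ih x e b * Dcov e k x d b = 0.
Proof.
move=> xc; apply: etrans _ (divk d xc); rewrite /divergence /contract.
apply: eq_bigr => e _; apply: eq_bigr => b _; congr (_ * _).
(* [divergence] contracts the derivative with the first index of [k], the sum here with the second;
   the symmetry of the covariant derivative exchanges them. *)
rewrite -{1}(Dcov_k_sym e xc) mxE /cov /= big_ord_recl big_ord1 /=.
rewrite /Dcov 2!mxDE 2!mxNE mxE -addrA -opprD; congr (_ - (_ + _)).
- by rewrite mxE; apply: eq_bigr => f _; rewrite christoffel_h0// [_^T _ _]mxE [Gam _ _ _ _]mxE.
- by rewrite mxE; apply: eq_bigr => f _; rewrite christoffel_h0// [Gam _ _ _ _]mxE mulrC.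
Qed.

(** The first two terms produce sigma_ab k^ab and - sigma_ab sigma^ab, the second also + sigma_a
    sigma^a by [div_hess]. The divergence of - sigma sigma_b is - sigma_a sigma^a + 3 sigma^2, which
    removes this surplus and supplies the remaining term. *)
Definition current x : 'rV[R]_3 :=
  v x *m ih x *m k x - v x *m ih x *m S x - sigma x *: v x.

(** The last summand is the connection term of the free index, which [cov] subtracts. *)
Lemma product_rule (A : 'rV[R]_3 -> 'M[R]_3) c x : chart x ->
  is_derive_mx A x (dirv c) (pdm c A x) ->
  is_derive_mx (fun y => v y *m ih y *m A y) x (dirv c)
    (row c (S x) *m ih x *m A x + v x *m ih x *m Dcov c A x + v x *m ih x *m A x *m Gam c x).
Proof.
move=> xc DA; have D := is_derive_mxM (is_derive_mxM (v_is_derive c xc) (invh0_is_derive c xc)) DA.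
move=> i j; apply: is_derive_eq (D i j) _; congr (fun_of_matrix _ i j).
rewrite hess_row// /Dcov !(mulmxDl, mulmxDr, mulNmx, mulmxN) !mulmxA.
move: (pdm c v x *m ih x *m A x) (v x *m Gam c x *m ih x *m A x) (v x *m ih x *m (Gam c x)^T *m A x)
  (v x *m ih x *m pdm c A x) (v x *m ih x *m A x *m Gam c x) => B1 B2 B3 B4 B5.
apply/rowP => b; rewrite !mxE; move: (B1 0 b) (B2 0 b) (B3 0 b) (B4 0 b) (B5 0 b) => *; ring.
Qed.

Lemma divergence_current x (V : 'rV[R]_3 -> seq 'I_3 -> R) : chart x ->
  (forall y b, V y [:: b] = current y 0 b) ->
  divergence h0 V x [::] = lagrangian sigma k x.
Proof.
move=> xc VE.
have D c := is_derive_mxD (is_derive_mxD (product_rule xc (k_is_derive c xc))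
   (is_derive_mxN (product_rule xc (hess_is_derive c xc))))
  (is_derive_mxN (is_derive_mxZ (chart_smooth_is_derive c ss xc) (v_is_derive c xc))).
pose W c := row c (S x) *m ih x *m (k x - S x) + v x *m ih x *m (Dcov c k x - Dcov c S x)
  - (v x 0 c *: v x + sigma x *: row c (S x)).
have CV c d : cov h0 V x [:: c; d] = W c 0 d.
  rewrite /cov /= big_ord1 /=.
  have -> : pd c (fun y => V y [:: d]) x = pd c (fun y => current y 0 d) x.
    by congr (pd c _ x); apply: funext => y; rewrite VE.
  rewrite (is_derive_pd (D c 0 d)).
  under eq_bigr do rewrite VE christoffel_h0// mulrC.
  have -> : \sum_e current x 0 e * gamma0 x e c d = (current x *m Gam c x) 0 d.
    by rewrite mxE; apply: eq_bigr => e _; rewrite [Gam _ _ _ _]mxE.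
  rewrite -mxNE -mxDE; congr (fun_of_matrix _ 0 d).
  have HR := hess_row c xc; rewrite /W /current -[pdm c v x](subrK (v x *m Gam c x)) -HR.
  rewrite [v x 0 c]mxE !(mulmxBr, mulmxBl) -scalemxAl scalerDr.
  move: (row c (S x) *m ih x *m k x) (row c (S x) *m ih x *m S x) (v x *m ih x *m Dcov c k x)
    (v x *m ih x *m Dcov c S x) (v x *m ih x *m k x *m Gam c x) (v x *m ih x *m S x *m Gam c x)
    (sigma x *: (v x *m Gam c x)) (sigma x *: row c (S x)) (pd c sigma x *: v x).
  move=> B1 B2 B3 B4 B5 B6 B7 B8 B9; apply/rowP => b; rewrite !mxE.
  move: (B1 0 b) (B2 0 b) (B3 0 b) (B4 0 b) (B5 0 b) (B6 0 b) (B7 0 b) (B8 0 b) (B9 0 b) => *; ring.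
rewrite /divergence /contract.
under eq_bigr do under eq_bigr do rewrite CV.
(* [T1] to [T4] evaluate the contractions of the four kinds of terms in [W]: Hessian times a matrix,
   gradient times a covariant derivative, gradient squared, and sigma times its Hessian. *)
have T1 (M : 'M[R]_3) : \sum_c \sum_d ih x c d * (row c (S x) *m M) 0 d = \tr (S x *m M *m ih x).
  rewrite -contract_tr; apply: eq_bigr => c _; apply: eq_bigr => d _; congr (_ * _).
  by rewrite -row_mul [LHS]mxE.
have T2 (B : 'I_3 -> 'M[R]_3) : \sum_c \sum_d ih x c d * (v x *m ih x *m B c) 0 d =
    \sum_f (v x *m ih x) 0 f * (\sum_c \sum_d ih x c d * B c f d).
  under [RHS]eq_bigr do rewrite mulr_sumr.
  rewrite [RHS]exchange_big; apply: eq_bigr => c _.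
  under [RHS]eq_bigr do rewrite mulr_sumr.
  rewrite [RHS]exchange_big; apply: eq_bigr => d _; rewrite mxE mulr_sumr.
  by apply: eq_bigr => f _; rewrite mulrCA.
have T3 : \sum_c \sum_d ih x c d * (v x 0 c *: v x) 0 d = (v x *m ih x *m (v x)^T) 0 0.
  rewrite [RHS]mxE exchange_big; apply: eq_bigr => d _; rewrite [(v x)^T _ _]mxE [in RHS]mxE mulr_suml.
  by apply: eq_bigr => c _; rewrite mxZE; move: (ih x c d) (v x 0 c) (v x 0 d) => *; ring.
have T4 : \sum_c \sum_d ih x c d * (sigma x *: row c (S x)) 0 d = sigma x * \tr (ih x *m S x).
  rewrite mxtrace_mulC -contract_tr mulr_sumr; apply: eq_bigr => c _.
  rewrite mulr_sumr; apply: eq_bigr => d _; rewrite mxZE [row _ _ _ _]mxE; exact: mulrCA.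
transitivity ((\sum_c \sum_d ih x c d * (row c (S x) *m (ih x *m (k x - S x))) 0 d)
    + ((\sum_c \sum_d ih x c d * (v x *m ih x *m Dcov c k x) 0 d)
       - (\sum_c \sum_d ih x c d * (v x *m ih x *m Dcov c S x) 0 d))
    - ((\sum_c \sum_d ih x c d * (v x 0 c *: v x) 0 d)
       + \sum_c \sum_d ih x c d * (sigma x *: row c (S x)) 0 d)).
  rewrite -sumrB -!big_split -sumrB /=; apply: eq_bigr => c _.
  rewrite -sumrB -!big_split -sumrB /=; apply: eq_bigr => d _.
  rewrite /W [v x *m ih x *m (_ - _)]mulmxBr (mulmxA (row c (S x))).
  move: (row c (S x) *m ih x *m (k x - S x)) (v x *m ih x *m Dcov c k x)
    (v x *m ih x *m Dcov c S x) (v x 0 c *: v x) (sigma x *: row c (S x)) (ih x c d).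
  move=> B1 B2 B3 B4 B5 z; rewrite !(mxDE, mxNE).
  move: (B1 0 d) (B2 0 d) (B3 0 d) (B4 0 d) (B5 0 d) => *; ring.
rewrite T1 !T2 T3 T4 tr_invh0_hess//.
under [\sum_f _ * (\sum_c \sum_d _ * Dcov c k x f d)]eq_bigr do rewrite div_k// mulr0.
under [\sum_f _ * _]eq_bigr do rewrite div_hess// mulrN.
rewrite big1_eq sumrN (_ : \sum_f _ = (v x *m ih x *m (v x)^T) 0 0); last first.
  by rewrite [RHS]mxE; apply: eq_bigr => f _; rewrite [(v x)^T _ _]mxE.
have C (A B : 'M[R]_3) : B^T = B -> gdot h0 x A B = \tr (A *m ih x *m B *m ih x).
  by move=> sB; rewrite /gdot sB.
rewrite /lagrangian !C ?hess_sym ?k_sym//.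
rewrite !(mulmxBr, mulmxBl) mxtraceD mxtraceN !mulmxA.
move: (\tr _) (\tr _) (_ 0 0) (sigma x) => a b c d; ring.
Qed.

Lemma cov_tensor0 y b : cov h0 (tensor0 sigma) y [:: b] = v y 0 b.
Proof. by rewrite /cov /= big_ord0 subr0 mxE. Qed.

Theorem lagrangian_divergence : exists2 V, local_tensor h0 sigma k 1 V &
  forall x, chart x -> divergence h0 V x [::] = lagrangian sigma k x.
Proof.
have L0 := local_scalar h0 sigma k; have L1 := local_cov L0; have L2 := local_cov L1.
(* [contract] pairs the first two indices, so the products are ordered as sigma_c k_db and sigma_c
   sigma_db, leaving [b] free. *)
have Lk := local_contract (local_prod L1 (local_sym2 h0 sigma k) : local_tensor h0 sigma k 3 _).
have LS := local_contract (local_prod L1 L2 : local_tensor h0 sigma k 3 _).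
have Ls := local_prod L0 L1 : local_tensor h0 sigma k 1 _.
have LV := local_add (local_add Lk (local_scale (-1) LS)) (local_scale (-1) Ls).
eexists; first exact: LV.
move=> x xc; apply: divergence_current => // y b.
rewrite /current !mxDE !mxNE mxZE !mulN1r; congr (_ - _ - _).
- rewrite /contract exchange_big mxE; apply: eq_bigr => d _.
  rewrite mxE mulr_suml; apply: eq_bigr => c _.
  change (take 1 [:: c; d; b]) with [:: c]; change (drop 1 [:: c; d; b]) with [:: d; b].
  by rewrite cov_tensor0 mulrA /=; congr (_ * _); exact: mulrC.
- rewrite /contract exchange_big mxE; apply: eq_bigr => d _.
  rewrite mxE mulr_suml; apply: eq_bigr => c _.
  change (take 1 [:: c; d; b]) with [:: c]; change (drop 1 [:: c; d; b]) with [:: d; b].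
  by rewrite cov_tensor0 mulrA [hessian _ _ _ _ _]mxE; congr (_ * _); exact: mulrC.
- by rewrite take0 drop0 cov_tensor0.
Qed.

End DeSitterCalculus.

Theorem mainTheorem3 (R : realType) (G : R) (r0 : R -> R)
    (sigma : 'rV[R]_3 -> R) (h1 h2 : 'rV[R]_3 -> 'M[R]_3)
    (h Khat : 'rV[R]_(1 + 3) -> 'M[R]_3) (k := k_of sigma h1) :
  0 < G ->
  beig_schmidt r0 sigma h1 h2 h ->
  ricci_flat r0 (bs_metric sigma h) ->
  (forall x, chart x ->
    dalembertian h0 (tensor0 sigma) x [::] + 3 * sigma x = 0) ->
  (forall x a b, chart x ->
    dalembertian h0 (tensor2 k) x [:: a; b] - 3 * k x a b = 0) ->
  (forall x, chart x -> gtrace h0 x (k x) = 0) ->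
  (forall x a, chart x -> divergence h0 (tensor2 k) x [:: a] = 0) ->
  is_Khat r0 h Khat ->
  [/\ (* sqrt(-h) (K - Khat) = sqrt(-h0) L / 4 + O(1/rho), locally uniformly *)
      forall T : R, exists C rho1 : R, forall rho x,
        region r0 (pt rho x) -> `|tau x| <= T -> rho1 < rho ->
        `|boundary_density sigma h Khat rho x
          - 4^-1 * (Num.sqrt (- \det (h0 x)) * lagrangian sigma k x)|
        <= C / rho,
      (* the action is finite as rho -> +oo, over every slab of dS_3 ... *)
      forall tau1 tau2, tau1 < tau2 ->
        16 * pi * G * action G r0 sigma h Khat tau1 tau2 rho
          @[rho --> +oo] -->
        2^-1 * slab_int tau1 tau2
          (fun x => Num.sqrt (- \det (h0 x)) * lagrangian sigma k x),
      (* ... and over all of dS_3, either side existing if the other does *)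
      forall S : R, action_value G r0 sigma h Khat S <->
        exists2 I : R, dS_integral (lagrangian sigma k) I &
          16 * pi * G * S = 2^-1 * I
    & no_boundary_terms sigma k -> action_value G r0 sigma h Khat 0].
Proof.
move=> G0 bs flat box _ trk divk HK; split.
- move=> T; have [[C [r1 _ H]] _ _ _] := density_asymptotics bs flat box trk HK T.
  exists C, r1 => rho x /region_pt[_ xc] xT rr1.
  exact: (H (rho, x) rr1 (conj xc xT)).
- by move=> t1 t2 t12; exact: (action_limit G0 bs flat box trk HK t12).
- by move=> S; exact: (action_value_integral G0 bs flat box trk HK S).
move=> NB; apply/(action_value_integral G0 bs flat box trk HK); exists 0; last by rewrite !mulr0.
have ss := smooth_scalar_chart (bs_sigma bs).
have k_smooth a b : chart_smooth (fun x => k x a b).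
  have [f fa fE] := smooth_tensor2_chart a b (bs_h1 bs); have [g ga gE] := ss.
  exists (fun x => f x + (2 * g x) * h0 x a b).
    apply: amb_add => //; apply: amb_mul (amb_h0 a b); apply: amb_mul => //; exact: amb_cst.
  by move=> x xc; rewrite mxDE mxZE -(fE x xc) -(gE x xc).
have k_sym x : chart x -> (k x)^T = k x.
  by move=> xc; rewrite /k /k_of linearD linearZ /= (bs_h1_sym bs xc) h0_sym.
have [V LV VE] := lagrangian_divergence ss k_smooth k_sym box divk.
(* Slab points lie in the chart, where the Lagrangian is the divergence of the local current [V];
   the hypothesis on boundary terms then gives the integral 0. *)
apply: cvg_trans (NB V LV); rewrite (_ : (fun u => _) = (fun u : R * R =>
   slab_int u.1 u.2 (fun x => Num.sqrt (- \det (h0 x)) * divergence h0 V x [::])))//.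
apply: funext => u; apply: eq_Rintegral => w; rewrite inE => /slabE [_ xc _].
by rewrite VE.
Qed.
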